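(* Let $\Bbbk$ be an algebraically closed field of characteristic $p\ge0$, let $r\in\mathbb{N}$, and let $V$ be a finite dimensional super vector space over $\Bbbk$ with an even form $\langle\cdot,\cdot\rangle$ and $\dim V=(m|2n)$. Assume $p\notin\{2,3,\dots,r\}$ and $\min(m,n)\ge r$, and set $\delta=m-2n\in\Bbbk$. (i) The action of the Brauer algebra on $V^{\otimes r}$ gives an algebra isomorphism $\mathcal{B}_r(\delta)\stackrel{\sim}{\to}\underline{\mathrm{End}}_{\mathsf{OSp}(V)}(V^{\otimes r})$. (ii) The space of $\mathsf{OSp}(V)$-invariant multilinear forms $V^{\times 2r}\to\Bbbk$ is spanned by all transforms under the symmetric group of $$(v_1,v_2,\dots,v_{2r})\mapsto\langle v_1,v_2\rangle\cdots\langle v_{2r-1},v_{2r}\rangle.$$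
   Context: Super spaces: $\mathbb{Z}_2$-graded vector spaces with braiding $\gamma(v\otimes w)=(-1)^{|v||w|}w\otimes v$. A form on $V$ is a non-degenerate bilinear form with $\langle v,w\rangle=(-1)^{|v||w|}\langle w,v\rangle$; it is even if $\langle v,w\rangle=0$ whenever $|v|+|w|=\bar1$. The Brauer algebra $\mathcal{B}_r(\delta)$ has as basis the Brauer diagrams (perfect pairings of $r$ lower and $r$ upper points), with multiplication given by concatenation with closed loops replaced by $\delta$. It acts on $V^{\otimes r}$ as the endomorphism algebra of $[r]$ under the symmetric monoidal functor from the Brauer category to super spaces with $[1]\mapsto V$, crossing $\mapsto\gamma_{V,V}$, cap $\mapsto\langle\cdot,\cdot\rangle$ and cup $\mapsto$ the dual copairing. $\mathsf{OSp}(V)$ is the algebraic super group (functor from commutative super algebras to groups, represented by a commutative Hopf super algebra $\mathcal{O}$) with $\mathsf{OSp}(V)(R)$ the group of even $R$-linear automorphisms of the right $R$-module $V\otimes R$ preserving $\langle v\otimes a,w\otimes b\rangle=(-1)^{|a||w|}\langle v,w\rangle ab$. For a representation (comodule) $M$ with coaction $c_M:M\to M\otimes\mathcal{O}$, $\underline{\mathrm{End}}_{\mathsf{OSp}(V)}(M)$ is the space of all linear (not necessarily grading preserving) maps $f:M\to M$ with $(f\otimes\mathrm{id})c_M=c_Mf$. An invariant multilinear form $V^{\times2r}\to\Bbbk$ is a (not necessarily grading preserving) linear map $V^{\otimes 2r}\to\Bbbk$ which is a comodule morphism to the trivial comodule. The symmetric group $S_{2r}$ acts on $V^{\otimes2r}$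 (and hence on forms) through the super braiding $\gamma$. *)

(* Defs.v *)
From HB Require Import structures.
From mathcomp Require Import all_boot all_order all_fingroup all_algebra.

Set Implicit Arguments.
Unset Strict Implicit.
Unset Printing Implicit Defensive.

Import GRing.Theory.
Local Open Scope ring_scope.

(* Parities are booleans: [false] is 0 and [true] is 1 in Z/2, with addition
   [addb] and multiplication [andb]. *)

Record superVect (K : fieldType) := SuperVect {
  sv_sort :> vectType K;
  sv_part : bool -> {vspace sv_sort};
  sv_full : (sv_part false + sv_part true)%VS = fullv;
  sv_direct : directv (sv_part false + sv_part true) }.

Definition sdim (K : fieldType) (V : superVect K) (b : bool) : nat :=
  \dim (sv_part V b).

Record evenForm (K : fieldType) (V : superVect K) := EvenForm {
  ef_form :> {biscalar V};
  ef_sym : forall (b c : bool) (v w : V), v \in sv_part V b ->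
    w \in sv_part V c -> ef_form v w = (-1) ^+ (b && c) * ef_form w v;
  ef_even : forall (b c : bool) (v w : V), v \in sv_part V b ->
    w \in sv_part V c -> b (+) c = true -> ef_form v w = 0;
  ef_nondeg : forall v : V, (forall w : V, ef_form v w = 0) -> v = 0 }.

(* Index set of the homogeneous basis of V obtained by joining a basis of the
   even part and a basis of the odd part. *)
Definition ix (K : fieldType) (V : superVect K) : finType :=
  ('I_(sdim V false) + 'I_(sdim V true))%type.

Definition hbasis (K : fieldType) (V : superVect K) (i : ix V) : V :=
  match i with
  | inl a => (vbasis (sv_part V false))`_a
  | inr a => (vbasis (sv_part V true))`_a
  end.

Definition par (K : fieldType) (V : superVect K) (i : ix V) : bool :=
  if i is inr _ then true else false.

Definition word (K : fieldType) (V : superVect K) (n : nat) : finType :=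
  {ffun 'I_n -> ix V}.

(* The function x stands for the sum of the x(a) e_(a 0) (x) ... (x) e_(a n-1);
   in particular the 0-th power is K, through the unique word of length 0. *)
Definition tpow (K : fieldType) (V : superVect K) (n : nat) : vectType K :=
  {ffun word V n -> K^o}.

Section TensorPowers.
Variables (K : fieldType) (V : superVect K).

Definition tbasis n (a : word V n) : tpow V n := [ffun b => (b == a)%:R].

Definition coef i j (f : 'Hom(tpow V i, tpow V j)) (a : word V j)
  (b : word V i) : K := f (tbasis b) a.

Definition hom_fun i j (c : word V j -> word V i -> K) (x : tpow V i) :
  tpow V j := [ffun a => \sum_b c a b * x b].

Lemma hom_fun_is_linear i j (c : word V j -> word V i -> K) :
  linear (hom_fun c).
Proof.
move=> k x y; apply/ffunP=> a; rewrite !ffunE /GRing.scale /= mulr_sumr.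
rewrite -big_split /=; apply: eq_bigr => b _; rewrite !ffunE mulrDr.
by rewrite /GRing.scale /= mulrCA.
Qed.

HB.instance Definition _ i j (c : word V j -> word V i -> K) :=
  GRing.isLinear.Build K (tpow V i) (tpow V j) _ (hom_fun c)
    (hom_fun_is_linear c).

Definition hom_of_coef i j (c : word V j -> word V i -> K) :
  'Hom(tpow V i, tpow V j) := linfun (hom_fun c).

Lemma coef_hom_of_coef i j (c : word V j -> word V i -> K) a b :
  coef (hom_of_coef c) a b = c a b.
Proof.
rewrite /coef /hom_of_coef lfunE /= ffunE (bigD1 b) //= ffunE eqxx mulr1.
by rewrite big1 ?addr0 // => b' /negPf b'b; rewrite ffunE b'b mulr0.
Qed.

Definition wleft m n (a : word V (m + n)) : word V m :=
  [ffun s => a (lshift n s)].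
Definition wright m n (a : word V (m + n)) : word V n :=
  [ffun s => a (rshift m s)].

(* No sign occurs as this is only used for even maps. *)
Definition tens_hom i j i' j' (f : 'Hom(tpow V i, tpow V j))
    (g : 'Hom(tpow V i', tpow V j')) :
  'Hom(tpow V (i + i'), tpow V (j + j')) :=
  hom_of_coef (fun a b =>
    coef f (wleft a) (wleft b) * coef g (wright a) (wright b)).

Definition wpar n (a : word V n) : bool := \big[addb/false]_(s < n) par (a s).

Definition even_hom i j (f : 'Hom(tpow V i, tpow V j)) : Prop :=
  forall a b, wpar a != wpar b -> coef f a b = 0.

Definition word2 (x y : ix V) : word V 2 :=
  [ffun s => if s == ord0 then x else y].

(* gamma (e_x (x) e_y) = (-1)^(|x||y|) e_y (x) e_x *)
Definition braiding : 'Hom(tpow V 2, tpow V 2) :=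
  hom_of_coef (fun a b =>
    let x := b ord0 in let y := b ord_max in
    (-1) ^+ (par x && par y) * (a == word2 y x)%:R).

(* The map moving the t-th tensor factor to position s t through braidings:
   each inversion of s exchanges two factors, which gives the Koszul sign. *)
Definition koszul n (s : 'S_n) (b : word V n) : K :=
  \prod_(t < n) \prod_(t' < n | (t < t')%N && (s t' < s t)%N)
    (-1) ^+ (par (b t) && par (b t')).

Definition perm_act n (s : 'S_n) : 'Hom(tpow V n, tpow V n) :=
  hom_of_coef (fun a b => koszul s b * [forall t, a (s t) == b t]%:R).

End TensorPowers.

Definition pairing (T : finType) (f : {ffun T -> T}) : bool :=
  [forall x, (f x != x) && (f (f x) == x)].

(* Diagrams from i lower points (left summand) to j upper points. *)
Definition diagram (i j : nat) : finType :=
  {f : {ffun ('I_i + 'I_j)%type -> ('I_i + 'I_j)%type} | pairing f}.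

Definition partner i j (D : diagram i j) :
  ('I_i + 'I_j)%type -> ('I_i + 'I_j)%type := val D.

Lemma pairingP (T : finType) (f : T -> T) :
  (forall x, f x != x) -> involutive f -> pairing (finfun f).
Proof.
by move=> fx ff; apply/forallP=> x; rewrite !ffunE fx ff eqxx.
Qed.

Definition mk_diagram i j (f : ('I_i + 'I_j)%type -> ('I_i + 'I_j)%type)
  (fx : forall x, f x != x) (ff : involutive f) : diagram i j :=
  exist _ (finfun f) (pairingP fx ff).

Lemma partner_neq i j (D : diagram i j) x : partner D x != x.
Proof. by have /forallP/(_ x)/andP[] := valP D. Qed.

Lemma partnerK i j (D : diagram i j) : involutive (partner D).
Proof. by move=> x; have /forallP/(_ x)/andP[_ /eqP] := valP D. Qed.

Definition did_fun n (x : ('I_n + 'I_n)%type) : ('I_n + 'I_n)%type :=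
  match x with inl a => inr a | inr a => inl a end.
Lemma did_neq n x : @did_fun n x != x. Proof. by case: x. Qed.
Lemma didK n : involutive (@did_fun n). Proof. by case. Qed.
Definition did n : diagram n n := mk_diagram (@did_neq n) (@didK n).

Definition dcross_fun (x : ('I_2 + 'I_2)%type) : ('I_2 + 'I_2)%type :=
  match x with inl a => inr (rev_ord a) | inr a => inl (rev_ord a) end.
Lemma dcross_neq x : dcross_fun x != x. Proof. by case: x. Qed.
Lemma dcrossK : involutive dcross_fun.
Proof. by case=> a; rewrite /= rev_ordK. Qed.
Definition dcross : diagram 2 2 := mk_diagram dcross_neq dcrossK.

Lemma rev_ord2_neq (a : 'I_2) : rev_ord a != a.
Proof. by case: a => [[|[|]]]. Qed.

Definition dcap_fun (x : ('I_2 + 'I_0)%type) : ('I_2 + 'I_0)%type :=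
  match x with inl a => inl (rev_ord a) | inr a => inr a end.
Lemma dcap_neq x : dcap_fun x != x.
Proof. by case: x => [a|[]//]; apply: rev_ord2_neq. Qed.
Lemma dcapK : involutive dcap_fun.
Proof. by case=> a; rewrite /= ?rev_ordK. Qed.
Definition dcap : diagram 2 0 := mk_diagram dcap_neq dcapK.

Definition dcup_fun (x : ('I_0 + 'I_2)%type) : ('I_0 + 'I_2)%type :=
  match x with inl a => inl a | inr a => inr (rev_ord a) end.
Lemma dcup_neq x : dcup_fun x != x.
Proof. by case: x => [[]//|a]; apply: rev_ord2_neq. Qed.
Lemma dcupK : involutive dcup_fun.
Proof. by case=> a; rewrite /= ?rev_ordK. Qed.
Definition dcup : diagram 0 2 := mk_diagram dcup_neq dcupK.

Section DiagramTensor.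
Variables (i j i' j' : nat) (D : diagram i j) (D' : diagram i' j').

Definition ptl (x : ('I_i + 'I_j)%type) : ('I_(i + i') + 'I_(j + j'))%type :=
  match x with inl a => inl (lshift i' a) | inr b => inr (lshift j' b) end.
Definition ptr (x : ('I_i' + 'I_j')%type) : ('I_(i + i') + 'I_(j + j'))%type :=
  match x with inl a => inl (rshift i a) | inr b => inr (rshift j b) end.

Definition dtens_fun (x : ('I_(i + i') + 'I_(j + j'))%type) :
    ('I_(i + i') + 'I_(j + j'))%type :=
  match x with
  | inl a => match split a with
             | inl c => ptl (partner D (inl c))
             | inr c => ptr (partner D' (inl c))
             end
  | inr a => match split a with
             | inl c => ptl (partner D (inr c))
             | inr c => ptr (partner D' (inr c))
             end
  end.

Lemma dtens_ptl x : dtens_fun (ptl x) = ptl (partner D x).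
Proof. by case: x => a; rewrite /= (unsplitK (inl a)). Qed.
Lemma dtens_ptr x : dtens_fun (ptr x) = ptr (partner D' x).
Proof. by case: x => a; rewrite /= (unsplitK (inr a)). Qed.
Lemma ptlr_cases x : (exists y, x = ptl y) \/ (exists y, x = ptr y).
Proof.
case: x => a; rewrite -(splitK a); case: (split a) => c /=.
- by left; exists (inl c).
- by right; exists (inl c).
- by left; exists (inr c).
- by right; exists (inr c).
Qed.
Lemma ptl_inj : injective ptl.
Proof. by move=> [a|a] [b|b] //= [] /val_inj ->. Qed.
Lemma ptr_inj : injective ptr.
Proof. by move=> [a|a] [b|b] //= [] /addnI /val_inj ->. Qed.
Lemma dtens_neq x : dtens_fun x != x.
Proof.
case: (ptlr_cases x) => -[y ->]; rewrite ?dtens_ptl ?dtens_ptr.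
- by rewrite (inj_eq ptl_inj) partner_neq.
- by rewrite (inj_eq ptr_inj) partner_neq.
Qed.
Lemma dtensK : involutive dtens_fun.
Proof.
by move=> x; case: (ptlr_cases x) => -[y ->];
   rewrite ?dtens_ptl ?dtens_ptr partnerK.
Qed.
Definition dtens : diagram (i + i') (j + j') := mk_diagram dtens_neq dtensK.
End DiagramTensor.

Section Dihedral.
Variables (T : finType) (d e : T -> T).
Definition drel : rel T := [rel x y | (d x == y) || (e x == y)].
Hypotheses (dK : involutive d) (eK : involutive e).

Lemma drel_sym : symmetric drel.
Proof.
move=> x y /=; congr orb; apply/eqP/eqP => <-.
all: by rewrite ?dK ?eK.
Qed.

Hypothesis nofix : forall x, d x = x -> e x = x -> False.

Lemma dihedral_end_aux x : e x = x ->
  exists y, [/\ y != x, (d y == y) || (e y == y), connect drel x y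
    & forall z, (d z == z) || (e z == z) -> connect drel x z -> z != x ->
        z = y].
Proof.
move=> ex; pose p z := e (d z).
have pI : injective p by move=> a b /(inv_inj eK) /(inv_inj dK).
have ipI k : injective (iter k p).
  by elim: k => // k IH a b /= /pI /IH.
set n := fingraph.order p x.
have pn : iter n p x = x by apply: fingraph.iter_order.
have n0 : (0 < n)%N by apply: fingraph.order_gt0.
have pe z : p (e (p z)) = e z by rewrite /p eK dK.
have ipe k : iter k p (e (iter k p x)) = x.
  by elim: k => //= k IH; rewrite -/(iter _ _ _) -iterS iterSr pe.
have eit a : (a <= n)%N -> e (iter a p x) = iter (n - a) p x.
  by move=> an; apply: (ipI a); rewrite ipe -iterD subnKC.
have dit a : (a < n)%N -> d (iter a p x) = iter (n - a.+1) p x.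
  by move=> an; rewrite -eit //= /p eK.
have itE a b : (a < n)%N -> (b < n)%N -> iter a p x = iter b p x -> a = b.
  by move=> an bn E; rewrite -(findex_iter an) -(findex_iter bn) E.
have cp a : connect drel x (iter a p x).
  elim: a => //= a IH; apply: (connect_trans IH).
  apply: (@connect_trans _ _ (d (iter a p x))).
    by apply: connect1; apply/orP; left.
  by apply: connect1; apply/orP; right.
have hn : (n./2 < n)%N by rewrite -divn2 ltn_Pdiv.
exists (iter n./2 p x); split.
- apply/eqP => E.
  have h0 : n./2 = 0%N by apply: itE.
  have n1 : n = 1%N.
    by move: h0 n0; rewrite -(odd_double_half n); case: (n./2); case: odd.
  by apply: (@nofix x) => //; have := dit 0%N n0; rewrite n1.
- rewrite dit // eit ?(ltnW hn) //.
  have := odd_double_half n; case: (odd n) => /= nE.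
    suff -> : (n - n./2.+1)%N = n./2 by rewrite eqxx.
    by move: nE; move: (n./2) => h <-; rewrite add1n subSS -addnn addnK.
  suff -> : (n - n./2)%N = n./2 by rewrite eqxx orbT.
  by move: nE; move: (n./2) => h <-; rewrite add0n -addnn addnK.
- exact: cp.
move=> z zE xz zx.
have [a an zA] : exists2 a, (a < n)%N & z = iter a p x.
  have cl : closed drel (fconnect p x).
    apply: intro_closed => [|u v uv /= xu].
      by apply: sym_connect_sym; apply: drel_sym.
    rewrite -(iter_findex xu) in uv.
    have an := findex_max xu.
    case/orP: uv => /eqP <-; rewrite !inE.
      by rewrite dit // fconnect_iter.
    by rewrite eit ?(ltnW an) // fconnect_iter.
  have xz' : fconnect p x z.
    have := closed_connect cl xz; rewrite !inE connect0 => <- //.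
  by exists (findex p x z); rewrite ?iter_findex ?findex_max.
have a0 : (0 < a)%N by rewrite lt0n; apply: contraNneq zx => a0; rewrite zA a0.
rewrite zA; congr (iter _ _ _); move: zE; rewrite zA dit // eit ?(ltnW an) //.
case/orP=> /eqP /itE E.
  have {}E : (n - a.+1)%N = a by apply: E => //; rewrite ltn_subrL n0.
  by rewrite -(subnK an) E addnS addnn /= uphalf_double.
have {}E : (n - a)%N = a by apply: E => //; rewrite ltn_subrL a0.
by rewrite -(subnK (ltnW an)) E addnn doubleK.
Qed.
End Dihedral.

Lemma drelC (T : finType) (d e : T -> T) : drel d e =2 drel e d.
Proof. by move=> x y; rewrite /drel /= orbC. Qed.

Lemma dihedral_end (T : finType) (d e : T -> T) :
  involutive d -> involutive e -> (forall x, d x = x -> e x = x -> False) ->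
  forall x, (d x == x) || (e x == x) ->
  exists y, [/\ y != x, (d y == y) || (e y == y), connect (drel d e) x y
    & forall z, (d z == z) || (e z == z) -> connect (drel d e) x z ->
        z != x -> z = y].
Proof.
move=> dK eK nf x /orP[] /eqP fx; last exact: dihedral_end_aux.
have nf' y : e y = y -> d y = y -> False by move=> ey dy; apply: (nf y).
have [y [yx ye xy yu]] := dihedral_end_aux eK dK nf' fx.
exists y; rewrite orbC; split => //; first by rewrite (eq_connect (drelC d e)).
by move=> z ze; rewrite (eq_connect (drelC d e)) => xz; apply: yu; rewrite // orbC.
Qed.

Section DiagramComp.
Variables (i j k : nat) (E : diagram j k) (D : diagram i j).

(* Points of the stacked picture with D below E. *)
Let P : finType := ('I_i + 'I_j + 'I_k)%type.

Definition low_arc (x : P) : P :=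
  match x with inl z => inl (partner D z) | inr c => inr c end.

Definition emb_up (z : ('I_j + 'I_k)%type) : P :=
  match z with inl b => inl (inr b) | inr c => inr c end.
Definition up_arc (x : P) : P :=
  match x with
  | inl (inl a) => inl (inl a)
  | inl (inr b) => emb_up (partner E (inl b))
  | inr c => emb_up (partner E (inr c))
  end.

Definition glue : rel P := drel low_arc up_arc.

Definition outer (x : P) : bool := if x is inl (inr _) then false else true.

Definition emb_out (x : ('I_i + 'I_k)%type) : P :=
  match x with inl a => inl (inl a) | inr c => inr c end.

(* Number of closed loops, i.e. of components made of middle points only. *)
Definition loops : nat :=
  n_comp glue [pred x | [forall y, connect glue x y ==> ~~ outer y]].

Definition dcomp_fun (x : ('I_i + 'I_k)%type) : ('I_i + 'I_k)%type :=
  odflt x [pick y | (y != x) && connect glue (emb_out x) (emb_out y)].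

Lemma low_arcK : involutive low_arc.
Proof. by case=> [z|c] //=; rewrite partnerK. Qed.
Lemma up_arc_emb z : up_arc (emb_up z) = emb_up (partner E z).
Proof. by case: z. Qed.
Lemma up_arcK : involutive up_arc.
Proof.
by case=> [[a|b]|c] //=; rewrite up_arc_emb partnerK.
Qed.
Lemma emb_up_inj : injective emb_up.
Proof. by case=> [b|c] [b'|c'] //= [->]. Qed.
Lemma emb_out_inj : injective emb_out.
Proof. by case=> [b|c] [b'|c'] //= [->]. Qed.
Lemma low_arc_fix x : (low_arc x == x) = (if x is inr _ then true else false).
Proof.
case: x => [z|c] /=; last exact: eqxx.
by apply/eqP => -[/eqP]; apply/negP/partner_neq.
Qed.
Lemma up_arc_fix x :
  (up_arc x == x) = (if x is inl (inl _) then true else false).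
Proof.
case: x => [[a|b]|c] /=; first exact: eqxx.
- by apply/eqP => /(@emb_up_inj _ (inl b)) /eqP; apply/negP/partner_neq.
- by apply/eqP => /(@emb_up_inj _ (inr c)) /eqP; apply/negP/partner_neq.
Qed.
Lemma outerE x : outer x = (low_arc x == x) || (up_arc x == x).
Proof. by rewrite low_arc_fix up_arc_fix; case: x => [[]|]. Qed.

Lemma dcomp_funP x : [/\ dcomp_fun x != x,
  connect glue (emb_out x) (emb_out (dcomp_fun x))
  & forall y, y != x -> connect glue (emb_out x) (emb_out y) ->
      y = dcomp_fun x].
Proof.
have nf y : low_arc y = y -> up_arc y = y -> False.
  by move=> /eqP + /eqP; rewrite low_arc_fix up_arc_fix; case: y => [[]|].
have ox z : (low_arc (emb_out z) == emb_out z)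
         || (up_arc (emb_out z) == emb_out z).
  by rewrite -outerE; case: z.
have [y [yx yo xy yu]] := dihedral_end low_arcK up_arcK nf (ox x).
have [z yE] : exists z, y = emb_out z.
  rewrite -outerE in yo; case: y yo {yx xy yu} => [[a|b]|c] //= _.
    by exists (inl a).
  by exists (inr c).
rewrite {}yE in yx yo xy yu.
have U w : w != x -> connect glue (emb_out x) (emb_out w) -> w = z.
  move=> wx xw; apply: emb_out_inj; apply: yu => //.
  by rewrite (inj_eq emb_out_inj).
rewrite (inj_eq emb_out_inj) in yx.
rewrite /dcomp_fun; case: pickP => [w /andP[wx xw]|/(_ z)] /=.
  by split=> // w' w'x xw'; rewrite (U w) // (U w').
by rewrite yx xy.
Qed.

Lemma dcomp_neq x : dcomp_fun x != x.
Proof. by case: (dcomp_funP x). Qed.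
Lemma dcompK : involutive dcomp_fun.
Proof.
move=> x; case: (dcomp_funP x) => fx cx _.
case: (dcomp_funP (dcomp_fun x)) => _ _ U; apply/esym/U; first by rewrite eq_sym.
suff cs : connect_sym glue by rewrite cs.
by apply: sym_connect_sym; apply: drel_sym; [apply: low_arcK|apply: up_arcK].
Qed.

Definition dcomp : diagram i k := mk_diagram dcomp_neq dcompK.
End DiagramComp.

(* The strict symmetric monoidal K-linear functor from the Brauer category with
   parameter delta to super spaces with [1] |-> V, crossing |-> gamma,
   cap |-> B, cup |-> dual copairing.  It is given by its values on diagrams,
   which form bases of the morphism spaces of the Brauer category. *)
Record brauerFunctor (K : fieldType) (V : superVect K) (B : evenForm V)
    (delta : K) := BrauerFunctor {
  bf_map :> forall i j, diagram i j -> 'Hom(tpow V i, tpow V j);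
  bf_even : forall i j (D : diagram i j), even_hom (bf_map D);
  bf_id : forall n, bf_map (did n) = \1%VF;
  bf_comp : forall i j k (E : diagram j k) (D : diagram i j),
    (bf_map E \o bf_map D)%VF = delta ^+ loops E D *: bf_map (dcomp E D);
  bf_tens : forall i j i' j' (D : diagram i j) (D' : diagram i' j'),
    bf_map (dtens D D') = tens_hom (bf_map D) (bf_map D');
  bf_cross : bf_map dcross = braiding V;
  bf_cap : forall (a : word V 0) (x y : ix V),
    coef (bf_map dcap) a (word2 x y) = B (hbasis x) (hbasis y);
  (* (B (x) id) (id (x) cup) = id *)
  bf_cup : forall (b : word V 0) (x y : ix V),
    \sum_z B (hbasis x) (hbasis z) * coef (bf_map dcup) (word2 z y) b
      = (x == y)%:R }.

Section BrauerAlgebra.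
Variables (K : fieldType) (r : nat).

Definition brauer : vectType K := {ffun diagram r r -> K^o}.

Definition bdiag (D : diagram r r) : brauer := [ffun E => (E == D)%:R].

Definition bone : brauer := bdiag (did r).

Definition bmul (delta : K) (x y : brauer) : brauer :=
  \sum_E \sum_D (x E * y D * delta ^+ loops E D) *: bdiag (dcomp E D).

Definition brauer_act (V : superVect K) (B : evenForm V) (delta : K)
    (F : brauerFunctor B delta) (x : brauer) : 'Hom(tpow V r, tpow V r) :=
  \sum_D x D *: F r r D.

End BrauerAlgebra.

(* The grading is given by the projections onto the homogeneous parts. *)
Record superAlg (K : fieldType) := SuperAlg {
  sa_sort :> algType K;
  sa_proj : bool -> {linear sa_sort -> sa_sort};
  sa_sum : forall a, sa_proj false a + sa_proj true a = a;
  sa_projK : forall b c a,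
    sa_proj b (sa_proj c a) = if b == c then sa_proj c a else 0;
  sa_one : sa_proj false 1 = 1;
  sa_mul : forall b c a a', sa_proj b a = a -> sa_proj c a' = a' ->
    sa_proj (b (+) c) (a * a') = a * a';
  sa_comm : forall b c a a', sa_proj b a = a -> sa_proj c a' = a' ->
    a * a' = (-1) ^+ (b && c) * (a' * a) }.

Definition super_morph (K : fieldType) (O R : superAlg K)
  (phi : {lrmorphism O -> R}) : Prop :=
  forall b a, phi (sa_proj O b a) = sa_proj R b (phi a).

Section OSp.
Variables (K : fieldType) (V : superVect K) (B : evenForm V).

(* x stands for the sum of the e_i (x) x(i) in V (x) R. *)
Definition ext (R : superAlg K) : Type := {ffun ix V -> R}.
HB.instance Definition _ (R : superAlg K) :=
  GRing.Zmodule.copy (ext R) {ffun ix V -> R}.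

Definition ext_rmul (R : superAlg K) (x : ext R) (a : R) : ext R :=
  [ffun i => x i * a].

Definition ext_basis (R : superAlg K) (j : ix V) : ext R :=
  [ffun i => (i == j)%:R].

Definition ext_homog (R : superAlg K) (b : bool) (x : ext R) : Prop :=
  forall i, sa_proj R (b (+) par i) (x i) = x i.

(* a |-> (-1)^(b|a|) a *)
Definition twist (R : superAlg K) (b : bool) (a : R) : R :=
  sa_proj R false a + (-1) ^+ b * sa_proj R true a.

(* <v (x) a, w (x) b> = (-1)^(|a||w|) <v,w> a b *)
Definition ext_form (R : superAlg K) (x y : ext R) : R :=
  \sum_i \sum_j B (hbasis i) (hbasis j) *: (twist (par j) (x i) * y j).

Record OSp_point (R : superAlg K) (g : ext R -> ext R) : Prop := {
  pt_add : forall x y, g (x + y) = g x + g y;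
  pt_rmul : forall x a, g (ext_rmul x a) = ext_rmul (g x) a;
  pt_even : forall b x, ext_homog b x -> ext_homog b (g x);
  pt_bij : bijective g;
  pt_form : forall x y, ext_form (g x) (g y) = ext_form x y }.

(* OSp(V)(phi) : the R-linear map sending e_j (x) 1 to (id (x) phi)(g (e_j (x) 1)). *)
Definition pt_map (O R : superAlg K) (phi : O -> R) (g : ext O -> ext O)
  (x : ext R) : ext R :=
  [ffun i => \sum_j phi (g (ext_basis O j) i) * x j].

(* A commutative super algebra representing the functor OSp(V), together with
   the universal point, which corresponds to the identity of O.  The Hopf
   structure of O is the one determined by the group structure (Yoneda). *)
Record OSpRep := {
  os_alg :> superAlg K;
  os_univ : ext os_alg -> ext os_alg;
  os_univ_point : OSp_point os_univ;
  os_exists : forall (R : superAlg K) (g : ext R -> ext R), OSp_point g ->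
    exists2 phi : {lrmorphism os_alg -> R},
      super_morph phi & pt_map phi os_univ =1 g;
  os_unique : forall (R : superAlg K) (phi psi : {lrmorphism os_alg -> R}),
    super_morph phi -> super_morph psi ->
    pt_map phi os_univ =1 pt_map psi os_univ -> phi =1 psi }.

Variable O : OSpRep.

(* c_V (e_j) is the universal point applied to e_j (x) 1; its coefficient at
   e_i is a matrix coefficient, of parity |i| + |j|. *)
Definition mcoef (i j : ix V) : O := os_univ (ext_basis O j) i.

(* Collecting the coefficients to the right of all e_(a t) in
   (e_(a 0) (x) u_0) (x) ... (x) (e_(a n-1) (x) u_(n-1)), where
   u_s = mcoef (a s) (b s), moves u_s past e_(a t) for every s < t. *)
Definition coact_sign n (a b : word V n) : K :=
  \prod_(s < n) \prod_(t < n | (s < t)%N)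
    (-1) ^+ ((par (a s) (+) par (b s)) && par (a t)).

(* The coaction on the n-th tensor power, with values in the functions from
   words to O, i.e. in (tensor power) (x) O. *)
Definition coact n (x : tpow V n) : {ffun word V n -> O} :=
  [ffun a => \sum_b (x b * coact_sign a b) *: \prod_(s < n) mcoef (a s) (b s)].

(* f (x) id_O *)
Definition hom_ext n (f : 'Hom(tpow V n, tpow V n))
  (y : {ffun word V n -> O}) : {ffun word V n -> O} :=
  [ffun a => \sum_b coef f a b *: y b].

Definition OSp_end n (f : 'Hom(tpow V n, tpow V n)) : Prop :=
  forall x, hom_ext f (coact x) = coact (f x).

(* Morphisms from the n-th tensor power to the trivial comodule K, whose
   coaction is 1 |-> 1 (x) 1. *)
Definition OSp_form n (f : 'Hom(tpow V n, K^o)) : Prop :=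
  forall x, \sum_b f (tbasis b) *: coact x b = f x *: (1 : O).

End OSp.

Section StandardForm.
Variables (K : fieldType) (V : superVect K) (B : evenForm V) (r : nat).

Lemma dbl_proof (k : 'I_r) : (k.*2 < r.*2)%N.
Proof. by rewrite ltn_double. Qed.
Lemma dblS_proof (k : 'I_r) : (k.*2.+1 < r.*2)%N.
Proof. by rewrite ltn_Sdouble. Qed.

Definition std_fun (x : tpow V r.*2) : K^o :=
  \sum_(a : word V r.*2)
    (\prod_(k < r) B (hbasis (a (Ordinal (dbl_proof k))))
                          (hbasis (a (Ordinal (dblS_proof k))))) * x a.

Lemma std_fun_is_linear : linear std_fun.
Proof.
move=> c x y; rewrite /std_fun /GRing.scale /= mulr_sumr -big_split /=.
apply: eq_bigr => b _; rewrite !ffunE mulrDr.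
by rewrite /GRing.scale /= mulrCA.
Qed.

HB.instance Definition _ :=
  GRing.isLinear.Build K (tpow V r.*2) K^o _ std_fun std_fun_is_linear.

(* v_1 (x) ... (x) v_2r |-> <v_1,v_2> ... <v_(2r-1),v_2r> *)
Definition std_form : 'Hom(tpow V r.*2, K^o) := linfun std_fun.

Definition form_orbit : seq 'Hom(tpow V r.*2, K^o) :=
  [seq (std_form \o perm_act V s)%VF | s : 'S_(r.*2)].

End StandardForm.

(* Main.v *)
Require Import Defs.
From HB Require Import structures.
From mathcomp Require Import all_boot all_order all_fingroup all_algebra ring zify.

(* Only infinitesimal points are needed to bound the invariants from above.
   Evaluating the coaction on the points 1 + S eps of OSp(V), where eps^2 = 0
   and eps has the parity of S in osp(V), shows that an invariant form, or the
   form attached to an equivariant endomorphism, is a multilinear function h of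
   2r vectors with sum_t +-h(.., S w_t, ..) = 0.  Since the odd part of V has
   dimension at least 2r, it contains r hyperbolic pairs.  Choosing an odd
   vector b orthogonal to all w_s with s <> t, and S = a<b,.> +- b<a,.> with
   a = w_t, expresses h(w) through tuples in which w_t and some w_s are replaced
   by a hyperbolic pair.  By induction, h is determined by its values on the
   orderings of the 2r hyperbolic vectors, and there only by one value for each
   perfect pairing of the positions.  The forms attached to the Brauer diagrams
   are dual to these values, up to signs.  Hence they form a basis of the
   solutions h.  That they are invariant is checked on the generators of the
   Brauer category.  When 2 = 0 in K there need not be hyperbolic pairs, but
   then r <= 1 and h is bilinear. *)

Set Implicit Arguments.
Unset Strict Implicit.
Unset Printing Implicit Defensive.

Import GRing.Theory.
Local Open Scope ring_scope.

(** * Even forms and osp(V) *)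

(** Endomorphisms have r lower and r upper ends, forms have 2r places, and the Koszul signs of the
    two differ. To serve both, tuples are indexed by an arbitrary finite type and the sign is a
    parameter [sg], required only to be trivial for even S. This is enough: in the reduction step a
    single term of the invariance sum survives, so its sign does not matter, and the relations
    between orderings of hyperbolic vectors use S made of two odd vectors. For the same reason no
    sign of a diagram form is ever computed; only the vanishing of its values on homogeneous tuples
    is recorded. Odd vectors are used because b<b,.> lies in osp(V) for b odd, which makes h vanish
    as soon as one entry b is odd, nonzero and orthogonal to all the others. Invariance under the
    whole super group comes from diagrams alone. The permuted standard forms are only shown to be
    killed by osp(V); the spanning result then makes them combinations of forms of diagrams from 2r
    points to none, hence invariant. *)

Section EvenForms.
Variables (K : fieldType) (V : superVect K) (B : evenForm V).
Implicit Types (u v w : V) (c d q : bool).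

Lemma formDl u v w : B (u + v) w = B u w + B v w.
Proof. by rewrite linearDl. Qed.
Lemma formZl k v w : B (k *: v) w = k * B v w.
Proof. exact: linearZl_LR. Qed.
Lemma formDr u v w : B u (v + w) = B u v + B u w.
Proof. by rewrite linearDr. Qed.
Lemma formZr k v w : B v (k *: w) = k * B v w.
Proof. exact: linearZr_LR. Qed.

Lemma form_parity c d v w : v \in sv_part V c -> w \in sv_part V d ->
  B v w != 0 -> c = d.
Proof.
move=> vc wd; apply: contraNeq => cd; apply/eqP/(ef_even B vc wd).
by move: cd; case: (c); case: (d).
Qed.

Lemma form_eq0C c d v w : v \in sv_part V c -> w \in sv_part V d ->
  (B v w == 0) = (B w v == 0).
Proof. by move=> vc wd; rewrite (ef_sym B vc wd) mulf_eq0 signr_eq0. Qed.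

Lemma sv_cap q : (sv_part V q :&: sv_part V (~~ q))%VS = 0%VS.
Proof.
have := sv_direct V; rewrite directv_addE /= !directvE /= !eqxx /= => /eqP.
by case: q => //=; rewrite capvC.
Qed.

Definition hcomp q v : V := daddv_pi (sv_part V q) (sv_part V (~~ q)) v.

Lemma hcomp_mem q v : hcomp q v \in sv_part V q. Proof. exact: memv_pi. Qed.
Lemma hcomp_sum v : hcomp false v + hcomp true v = v.
Proof. by apply: daddv_pi_add; [apply: (sv_cap false) | rewrite sv_full memvf]. Qed.
Lemma hcomp_id q v : v \in sv_part V q -> hcomp q v = v.
Proof. by apply: daddv_pi_id; apply: sv_cap. Qed.
Lemma hcomp_0 q v : v \in sv_part V (~~ q) -> hcomp q v = 0.
Proof.
move=> vq; have E : hcomp q v + hcomp (~~ q) v = v.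
  by case: (q); [rewrite addrC|]; exact: hcomp_sum.
by apply: (addIr v); rewrite add0r -[in RHS]E (hcomp_id vq).
Qed.

Lemma homog_nondeg c v : v \in sv_part V c ->
  (forall w, w \in sv_part V c -> B v w = 0) -> v = 0.
Proof.
move=> vc H; apply: (@ef_nondeg _ _ B) => w; rewrite -(hcomp_sum w) formDr.
have H' d : B v (hcomp d w) = 0.
  case: (eqVneq c d) (hcomp_mem d w) => [<-|cd] hd; first exact: H.
  by apply: (ef_even B vc hd); case: c d cd {vc H hd} => [] [].
by rewrite !H' addr0.
Qed.

Lemma form_oddxx v : (2%:R : K) != 0 -> v \in sv_part V true -> B v v = 0.
Proof.
move=> n2 vo; have /eqP := ef_sym B vo vo; rewrite expr1 mulN1r -subr_eq0 opprK.
by rewrite -mulr2n -mulr_natl mulf_eq0 (negPf n2) => /eqP.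
Qed.

(* Condition for 1 + S eps to preserve the form, eps being of parity e and
   acting on the right. *)
Definition osp (e : bool) (S : V -> V) : Prop :=
  [/\ linear S, (forall c v, v \in sv_part V c -> S v \in sv_part V (c (+) e))
    & forall c d v w, v \in sv_part V c -> w \in sv_part V d ->
        (-1) ^+ (e && d) * B (S v) w + B v (S w) = 0].

(** Half of the element of [osp_rank2] for a = b, kept apart because that element is 0 when 2 =
    0. *)
Lemma osp_transvection b : b \in sv_part V true ->
  osp false (fun v => B b v *: b).
Proof.
move=> bo; split=> [k u v | c v vc | c d v w vc wd].
- by rewrite formDr formZr scalerDl scalerA.
- rewrite addbF; case: (eqVneq (B b v) 0) => [->|nz]; first by rewrite scale0r mem0v.
  by rewrite -(form_parity bo vc nz) memvZ.
rewrite mul1r formZl formZr (ef_sym B vc bo).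
case: (eqVneq (B b v) 0) => [->|nz]; first by rewrite mul0r !mulr0 addr0.
by rewrite -(form_parity bo vc nz) mulN1r mulrN mulrC addrN.
Qed.

(** The sign making a<b,.> + kappa b<a,.> skew for the form, for a and b of parities [c] and [d]: -1
    for two even vectors, +1 otherwise. *)
Definition osp_kappa c d : K := - (-1) ^+ (c (+) d (+) (c && d)).

Lemma osp_rank2 c d a b : a \in sv_part V c -> b \in sv_part V d ->
  osp (c (+) d) (fun v => B b v *: a + (osp_kappa c d * B a v) *: b).
Proof.
move=> ac bd; split=> [k u v | c' v vc | c' d' v w vc wd].
- rewrite !formDr !formZr !mulrDr !scalerDl !scalerDr !scalerA addrACA.
  by congr (_ + (_ *: _ + _)); rewrite mulrCA.
- apply: memvD.
    case: (eqVneq (B b v) 0) => [->|nz]; first by rewrite scale0r mem0v.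
    by rewrite -(form_parity bd vc nz) addbC addbK memvZ.
  case: (eqVneq (B a v) 0) => [->|nz]; first by rewrite mulr0 scale0r mem0v.
  by rewrite -(form_parity ac vc nz) addKb memvZ.
rewrite formDl !formZl formDr !formZr (ef_sym B vc ac) (ef_sym B vc bd) /osp_kappa.
(* Each of the four values is 0 unless its parities match, which leaves an identity of signs in each
   of the 16 cases. *)
move: (ef_even B ac vc) (ef_even B ac wd) (ef_even B bd vc) (ef_even B bd wd).
move: (B a v) (B a w) (B b v) (B b w) => {ac bd vc wd} x y z t.
case: c c' d d' => [] [] [] [] /= Ex Ey Ez Et;
  by rewrite ?(Ex erefl) ?(Ey erefl) ?(Ez erefl) ?(Et erefl); ring.
Qed.

End EvenForms.

(** * Multilinear functions invariant under osp(V) *)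

Section Multilinear.
Variables (K : fieldType) (V : superVect K) (I : finType).
Implicit Types (w : {ffun I -> V}) (h g : {ffun I -> V} -> K).

Definition upd w (t : I) (v : V) : {ffun I -> V} :=
  [ffun s => if s == t then v else w s].

Lemma upd_eq w t v : upd w t v t = v. Proof. by rewrite ffunE eqxx. Qed.
Lemma upd_neq w t v s : s != t -> upd w t v s = w s.
Proof. by rewrite ffunE => /negPf ->. Qed.
Lemma upd_id w t : upd w t (w t) = w.
Proof. by apply/ffunP => s; rewrite ffunE; case: eqP => [->|]. Qed.
Lemma upd_upd w t u v : upd (upd w t u) t v = upd w t v.
Proof. by apply/ffunP => s; rewrite !ffunE; case: eqP. Qed.
Definition mlin h : Prop := forall w t c u v,
  h (upd w t (c *: u + v)) = c * h (upd w t u) + h (upd w t v).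

Lemma mlin0 h w t : mlin h -> h (upd w t 0) = 0.
Proof.
move=> hl; have := hl w t (-1) 0 0.
by rewrite scaler0 addr0 mulN1r addNr.
Qed.

Lemma mlinZ h w t c u : mlin h -> h (upd w t (c *: u)) = c * h (upd w t u).
Proof. by move=> hl; rewrite -[c *: u]addr0 hl mlin0 ?addr0. Qed.

Lemma mlin_sum h w t (J : Type) (s : seq J) (P : pred J) (c : J -> K)
    (u : J -> V) : mlin h ->
  h (upd w t (\sum_(j <- s | P j) c j *: u j))
    = \sum_(j <- s | P j) c j * h (upd w t (u j)).
Proof.
move=> hl; elim/big_rec2: _ => [|j x y _ <-]; first exact: mlin0.
exact: hl.
Qed.

(** Induction on the number of positions whose entry is not known to lie in [X]; one of them is
    expanded at a time. *)
Lemma mlin_span h (X : V -> Prop) : mlin h ->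
  (forall v, exists s : seq (K * V),
     (forall x, x \in s -> X x.2) /\ v = \sum_(x <- s) x.1 *: x.2) ->
  (forall w, (forall t, X (w t)) -> h w = 0) -> forall w, h w = 0.
Proof.
move=> hl sp h0.
suff H n w (A : {set I}) : #|A| = n -> (forall t, t \notin A -> X (w t)) ->
    h w = 0.
  by move=> w; apply: (H _ _ [set: I] erefl) => t; rewrite inE.
elim: n w A => [|n IH] w A An wA.
  by apply: h0 => t; apply: wA; rewrite (cards0_eq An) inE.
have /card_gt0P[t tA] : (0 < #|A|)%N by rewrite An.
have [s [sX wt]] := sp (w t).
rewrite -(upd_id w t) wt mlin_sum // big_seq big1 // => x xs.
rewrite (IH _ (A :\ t)) ?mulr0 //; first by move: An; rewrite (cardsD1 t) tA => -[].
move=> u; rewrite !inE negb_and negbK; case: eqP => [->|/eqP ut] /=.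
  by rewrite upd_eq => _; apply: sX.
by rewrite upd_neq //; apply: wA.
Qed.

Lemma mlinB h (J : finType) (c : J -> K) (f : J -> {ffun I -> V} -> K) :
  mlin h -> (forall j, mlin (f j)) ->
  mlin (fun w => h w - \sum_j c j * f j w).
Proof.
move=> hl fl w t k u v; rewrite hl.
under eq_bigr do rewrite fl mulrDr.
rewrite big_split /= opprD addrACA mulrBr; congr (_ - _ + _).
by rewrite mulr_sumr; apply: eq_bigr => j _; rewrite mulrCA.
Qed.

Definition homog (q : I -> bool) w : Prop := forall t, w t \in sv_part V (q t).

Lemma homog_upd q w t v p : homog q w -> v \in sv_part V p ->
  homog (fun s => if s == t then p else q s) (upd w t v).
Proof. by move=> wq vp s; rewrite ffunE; case: ifP. Qed.

Lemma mlin_homog h : mlin h -> (forall q w, homog q w -> h w = 0) ->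
  forall w, h w = 0.
Proof.
move=> hl h0; apply: (mlin_span (X := fun v => exists q, v \in sv_part V q)) => //.
  move=> v; exists [:: (1, hcomp false v); (1, hcomp true v)]; split.
    by move=> x; rewrite !inE => /orP[] /eqP ->; eexists; apply: hcomp_mem.
  by rewrite !big_cons big_nil addr0 !scale1r hcomp_sum.
move=> w wh.
have /fin_all_exists[q wq] : forall t, exists q, w t \in sv_part V q by [].
exact: h0 wq.
Qed.

Variables (B : evenForm V) (sg : bool -> (I -> bool) -> I -> bool).

(* Invariance under the Lie super algebra osp(V); the signs [sg] depend on the
   way the tensor factors are arranged, but not for even elements. *)
Definition lie h : Prop := forall e S q w, osp B e S -> homog q w ->
  \sum_t (-1) ^+ (sg e q t) * h (upd w t (S (w t))) = 0.

Lemma lieB h (J : finType) (c : J -> K) (f : J -> {ffun I -> V} -> K) :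
  lie h -> (forall j, lie (f j)) ->
  lie (fun w => h w - \sum_j c j * f j w).
Proof.
move=> hL fL e S q w eS wq.
under eq_bigr do rewrite mulrBr mulr_sumr.
rewrite sumrB (hL e S q w) // sub0r exchange_big /= big1 ?oppr0 // => j _.
under eq_bigr do rewrite mulrCA.
by rewrite -mulr_sumr (fL j e S q w) // mulr0.
Qed.

Hypothesis sg_even : forall q t, sg false q t = false.

Lemma lie_even h S q w : lie h -> osp B false S -> homog q w ->
  \sum_t h (upd w t (S (w t))) = 0.
Proof.
move=> hL eS wq; rewrite -[RHS](hL _ _ _ _ eS wq); apply: eq_bigr => t _.
by rewrite sg_even mul1r.
Qed.

Section Reduction.
Variable h : {ffun I -> V} -> K.
Hypotheses (hl : mlin h) (hL : lie h).

Lemma lie_null q w t b v : homog q w ->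
  b \in sv_part V true -> v \in sv_part V true -> B b v != 0 ->
  (forall s, s != t -> B b (w s) = 0) -> h (upd w t b) = 0.
Proof.
move=> wq bo vo bv bw.
have := lie_even hL (osp_transvection B bo) (homog_upd t wq vo).
rewrite (bigD1 t) //= big1 => [|s st]; last first.
  by rewrite upd_neq // bw // scale0r mlin0.
rewrite addr0 upd_upd upd_eq mlinZ // => /eqP.
by rewrite mulf_eq0 (negPf bv) => /eqP.
Qed.

(* S = (w t)<b,.> +- b<w t,.> maps v to a multiple of w t, up to b, and each
   other w s to a multiple of b. *)
Lemma lie_reduce q w t b v : homog q w ->
  b \in sv_part V true -> v \in sv_part V true -> B b v != 0 ->
  (forall s, s != t -> B b (w s) = 0) ->
  (forall s, s != t -> B (w t) (w s) != 0 ->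
    h (upd (upd w t v) s b) = 0) -> h w = 0.
Proof.
move=> wq bo vo bv bw h0.
have := hL (osp_rank2 B (wq t) bo) (homog_upd t wq vo).
rewrite (bigD1 t) //= big1 => [|s st]; last first.
  rewrite [upd w t v s]upd_neq // bw // scale0r add0r mlinZ //.
  have [->|nz] := eqVneq (B (w t) (w s)) 0; first by rewrite !(mulr0, mul0r).
  by rewrite h0 // !mulr0.
(* The term at [t] is, up to sign, <b,v> h(w) plus a multiple of the value with [b] at [t], which
   [lie_null] kills. *)
rewrite addr0 upd_upd upd_eq hl mlinZ // (lie_null wq bo vo bv bw) mulr0 addr0.
by move/eqP; rewrite upd_id !mulf_eq0 signr_eq0 (negPf bv) => /eqP.
Qed.

End Reduction.

(** * Words in the vectors of hyperbolic pairs *)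

Section Rainbow.
Variables (r : nat) (l : 'I_r * bool -> V).
Implicit Type (a : {ffun I -> 'I_r * bool}).

Definition flip (z : 'I_r * bool) : 'I_r * bool := (z.1, ~~ z.2).

Lemma flipK : involutive flip. Proof. by case=> i b; rewrite /flip negbK. Qed.
Lemma flip_neq z : flip z != z.
Proof. by case: z => i []; rewrite /flip xpair_eqE eqxx. Qed.

(** The values <l z, l z> are left open. They vanish when 2 is invertible, but for 2 = 0 the form on
    the odd part need not be alternating, and one such pair must still exist then. *)
Record hyperbolic : Prop := Hyperbolic {
  hyp_odd : forall z, l z \in sv_part V true;
  hyp_flip : forall z, B (l z) (l (flip z)) = (-1) ^+ z.2;
  hyp_orth : forall z z', z' != flip z -> z' != z -> B (l z) (l z') = 0 }.

Hypotheses (ll : hyperbolic) (n2 : (2%:R : K) != 0).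

Lemma hypE z z' : B (l z) (l z') = (-1) ^+ z.2 * (z' == flip z)%:R.
Proof.
case: eqP => [->|/eqP zf]; first by rewrite (hyp_flip ll) mulr1.
rewrite mulr0; have [->|zz] := eqVneq z' z; last exact: hyp_orth.
by rewrite (form_oddxx B n2) // (hyp_odd ll).
Qed.

Definition letters a : {ffun I -> V} := [ffun t => l (a t)].

Lemma letters_homog a : homog (fun=> true) (letters a).
Proof. by move=> t; rewrite ffunE (hyp_odd ll). Qed.

Definition updz a (t : I) z : {ffun I -> 'I_r * bool} :=
  [ffun s => if s == t then z else a s].

Lemma upd_letters a t z : upd (letters a) t (l z) = letters (updz a t z).
Proof. by apply/ffunP => s; rewrite !ffunE; case: eqP. Qed.

Hypothesis cardI : #|I| = (r * 2)%N.
Variable h : {ffun I -> V} -> K.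
Hypotheses (hl : mlin h) (hL : lie h).

Lemma hyp_neq0 z z' : (B (l z) (l z') != 0) = (z' == flip z).
Proof.
by rewrite hypE mulf_eq0 signr_eq0; case: (z' == _); rewrite ?eqxx ?oner_eq0.
Qed.

Lemma hyp_eq0 z z' : z' != flip z -> B (l z) (l z') = 0.
Proof. by rewrite -hyp_neq0 negbK => /eqP. Qed.

(* If some letter occurs but its mate does not, one reduction step gives 0.
   Otherwise a missing pair replaces a repeated letter and possibly its mate,
   which enlarges the set of letters that occur. *)
Lemma letters_eq0 a : (forall a', injective a' -> h (letters a') = 0) ->
  h (letters a) = 0.
Proof.
move=> rb; have [n] := ubnP (#|~: (a @: I)|).
elim: n a => // n IH a; rewrite ltnS => an.
have [/existsP[t tf]|/existsPn fl] :=
  boolP [exists t, flip (a t) \notin a @: I].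
  have nf s : a s != flip (a t).
    by apply: contraNneq tf => <-; apply: imset_f.
  apply: (lie_reduce hl hL (letters_homog a) (t := t)
    (b := l (a t)) (v := l (flip (a t)))); rewrite ?(hyp_odd ll) //.
  - by rewrite hyp_neq0.
  - by move=> s _; rewrite ffunE hyp_eq0.
  - by move=> s _; rewrite !ffunE hyp_neq0 (negPf (nf s)).
have [ai|ani] := boolP (injectiveb a); first by apply/rb/injectiveP.
(* There are as many letters as positions, so a repetition leaves out some letter, and its mate with
   it since mates occur together here. *)
have [z zn] : exists z, z \notin a @: I.
  apply/existsP; apply: contraR ani => /existsPn za; apply/injectiveP.
  have aT : a @: I = [set: 'I_r * bool]%SET.
    by apply/setP => z; rewrite inE; have := za z; rewrite negbK.
  have /imset_injP ai : #|a @: I| == #|I|.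
    by rewrite aT cardsT card_prod card_ord card_bool cardI.
  by move=> x y; apply: ai.
have fzn : flip z \notin a @: I.
  apply: contra zn => /imsetP[t _ zt]; have := fl t.
  by rewrite negbK -zt flipK.
have /injectivePn[t [t' t't att']] := ani.
apply: (lie_reduce hl hL (letters_homog a) (t := t)
    (b := l (flip z)) (v := l z)); rewrite ?(hyp_odd ll) //.
- by rewrite hyp_neq0 flipK.
- move=> s _; rewrite ffunE hyp_eq0 // flipK.
  by apply: contraNneq zn => <-; apply: imset_f.
move=> s st; rewrite !ffunE hyp_neq0 => /eqP as_.
rewrite !upd_letters; apply: IH.
set a' := updz _ _ _.
have a's : a' s = flip z by rewrite ffunE eqxx.
have a't : a' t = z by rewrite !ffunE eqxx eq_sym (negPf st).
(* Among the missing letters, z and its mate disappear, and at most [a s] is new because [a t]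
   recurs at [t']. *)
apply: leq_trans an.
apply: (@leq_ltn_trans #|(a s |: ((~: (a @: I)) :\ z)) :\ flip z|).
  apply/subset_leq_card/subsetP => y; rewrite !inE => /imsetP yn.
  have yfz : y != flip z.
    by apply/eqP => E; apply: yn; exists s; rewrite ?a's.
  have yz : y != z by apply/eqP => E; apply: yn; exists t; rewrite ?a't.
  rewrite yfz yz /=; apply/orP.
  have [->|yas] := eqVneq y (a s); [by left|right].
  apply/imsetP => -[u _ yu]; apply: yn.
  have us : u != s by apply: contraNneq yas => us; rewrite yu us.
  have [ut|ut] := eqVneq u t.
    have t's : t' != s.
      by apply: contraNneq yas => t's; rewrite yu ut att' t's.
    exists t' => //; rewrite !ffunE (negPf t's) eq_sym (negPf t't).
    by rewrite yu ut att'.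
  by exists u; rewrite // !ffunE (negPf us) (negPf ut).
have h1 := cardsD1 z (~: (a @: I)).
have h2 := cardsD1 (flip z) (a s |: ((~: (a @: I)) :\ z)).
have h3 := cardsU1 (a s) ((~: (a @: I)) :\ z).
move: h1 h2 h3; rewrite !inE zn fzn flip_neq /= orbT.
rewrite imset_f // !andbF /=. by lia.
Qed.
(** The coefficient of [l z] is <l (flip z), v> divided by <l (flip z), l z>, which is a sign. *)
Definition perp_part (v : V) : V :=
  v - \sum_z ((-1) ^+ (~~ z.2) * B (l (flip z)) v) *: l z.

Lemma perp_partP z v : B (l z) (perp_part v) = 0.
Proof.
rewrite linearBr linear_sumr (bigD1 (flip z)) //= big1 => [|y yz]; last first.
  by rewrite formZr hyp_eq0 // mulr0.
rewrite addr0 formZr flipK hypE eqxx mulr1 negbK mulrAC.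
by rewrite -expr2 sqrr_sign mul1r subrr.
Qed.

Lemma perp_part_mem v : v \in sv_part V true -> perp_part v \in sv_part V true.
Proof.
by move=> vo; rewrite rpredB // rpred_sum // => z _; rewrite rpredZ ?(hyp_odd ll).
Qed.

(* [A] is the set of the positions of vectors orthogonal to all letters. *)
Lemma mixed_eq0 n (A : {set I}) q w :
  (forall a', injective a' -> h (letters a') = 0) -> (#|A| < n)%N ->
  homog q w -> (forall t, t \notin A -> exists z, w t = l z) ->
  (forall t, t \in A -> forall z, B (l z) (w t) = 0) -> h w = 0.
Proof.
move=> rb; elim: n A q w => // n IH A q w An wq wl wp.
have [A0|/set0Pn[t tA]] := eqVneq A set0.
  have /fin_all_exists[a wa] : forall t, exists z, w t = l z.
    by move=> t; apply: wl; rewrite A0 inE.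
  rewrite (_ : w = letters [ffun t => a t]) ?letters_eq0 //.
  by apply/ffunP => t; rewrite !ffunE.
have cardZ : #|{: 'I_r * bool}| = #|I|.
  by rewrite card_prod card_ord card_bool cardI.
have /card_gt0P[z0 _] : (0 < #|{: 'I_r * bool}|)%N.
  by rewrite cardZ; apply/card_gt0P; exists t.
have /fin_all_exists[a wa] : forall s, exists z, s \notin A -> w s = l z.
  move=> s; have [sA|/wl[z wz]] := boolP (s \in A); first by exists z0.
  by exists z.
(* As [A] is not empty, fewer than 2r positions carry letters and some letter z is free. Its mate is
   then orthogonal to all entries. *)
have [z zn] : exists z, z \notin a @: ~: A.
  have An' : (#|a @: ~: A| < #|{: 'I_r * bool}|)%N.
    rewrite cardZ; apply: leq_ltn_trans (leq_imset_card _ _) _.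
    by rewrite -(cardsC A) -[ltnLHS]add0n ltn_add2r; apply/card_gt0P; exists t.
  apply/existsP; apply: contraLR An' => /existsPn nz; rewrite -leqNgt.
  apply/subset_leq_card/subsetP=> z _; by have := nz z; rewrite negbK.
have az s : s \notin A -> a s != z.
  by move=> sA; apply: contraNneq zn => <-; apply: imset_f; rewrite inE.
apply: (lie_reduce hl hL wq (t := t) (b := l (flip z)) (v := l z));
  rewrite ?(hyp_odd ll) //.
- by rewrite hyp_neq0 flipK.
- move=> s st; have [sA|sA] := boolP (s \in A); first exact: wp.
  by rewrite wa // hyp_eq0 // flipK az.
(* Letters are orthogonal to [w t], so an entry pairing with it sits in [A] too; the reduction takes
   both positions out of [A]. *)
move=> s st nz; have sA : s \in A.
  apply: contraNT nz => sA.
  by rewrite (wa s sA) (form_eq0C B (wq t) (hyp_odd ll _)) wp.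
have sA' : s \in A :\ t by rewrite !inE st.
apply: (IH (A :\ t :\ s) _ _ _ (homog_upd s (homog_upd t wq (hyp_odd ll z))
  (hyp_odd ll (flip z)))).
- by move: An; rewrite (cardsD1 t A) tA (cardsD1 s) sA' => /ltnW.
- move=> u; rewrite !inE !negb_and !negbK.
  have [->|us] := eqVneq u s; first by rewrite upd_eq; exists (flip z).
  have [->|ut] := eqVneq u t.
    by rewrite upd_neq 1?eq_sym // upd_eq; exists z.
  by rewrite !upd_neq //= => /wl.
- move=> u; rewrite !inE => /and3P[us ut uA] y; rewrite !upd_neq //.
  exact: wp.
Qed.

(** By multilinearity each entry may be taken to be a letter or a homogeneous vector orthogonal to
    all letters: even vectors are orthogonal to odd ones, and an odd vector is split by
    [perp_part]. *)
Lemma rainbow_eq0 : (forall a, injective a -> h (letters a) = 0) ->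
  forall w, h w = 0.
Proof.
move=> rb; apply: (mlin_span (X := fun v => (exists z, v = l z) \/
  (exists2 q, v \in sv_part V q & forall z, B (l z) v = 0))) => //.
  move=> v; pose c z := (-1) ^+ (~~ z.2) * B (l (flip z)) (hcomp true v).
  exists [:: (1, hcomp false v), (1, perp_part (hcomp true v))
           & [seq (c z, l z) | z : 'I_r * bool]]; split.
    move=> x; rewrite !inE => /or3P[/eqP ->|/eqP ->|/imageP[z _ ->]].
    - right; exists false; first exact: hcomp_mem.
      by move=> z; apply: ef_even (hyp_odd ll z) (hcomp_mem _ _) _.
    - right; exists true; first by rewrite perp_part_mem ?hcomp_mem.
      by move=> z; apply: perp_partP.
    - by left; exists z.
  rewrite !big_cons /= !scale1r big_map big_enum /= subrK.
  by rewrite hcomp_sum.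
move=> w wX.
have /fin_all_exists[q wq] : forall t, exists q, w t \in sv_part V q.
  by move=> t; case: (wX t) => [[z ->]|[q wq _]]; eexists; [apply: hyp_odd|exact: wq].
pose A := [set t | [forall z, B (l z) (w t) == 0]].
apply: (mixed_eq0 (A := A) rb (ltnSn _) wq) => t; rewrite inE.
  case: (wX t) => // -[p _ wp] /negP[]; apply/forallP => z.
  by rewrite wp.
by move=> /forallP wp z; apply/eqP.
Qed.

(** Invariance under S = x<y,.> + y<x,.>, which turns the mates of y into x and the mates of x into
    y, up to the sign of the pairing, and kills the other letters. *)
Lemma letters_rank2 a (x y : 'I_r * bool) :
  (-1) ^+ y.2 * \sum_(u | a u == flip y) h (letters (updz a u x))
  + (-1) ^+ x.2 * \sum_(u | a u == flip x) h (letters (updz a u y)) = 0.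
Proof.
have := lie_even hL (osp_rank2 B (hyp_odd ll x) (hyp_odd ll y))
  (letters_homog a).
rewrite /osp_kappa /= expr1 opprK [X in _ * X + _]big_mkcond.
rewrite [X in _ + _ * X]big_mkcond /= !mulr_sumr -big_split /=.
move=> E; rewrite -[RHS]E; apply: eq_bigr => u _.
rewrite hl mlinZ // !upd_letters ffunE !hypE mul1r.
by do 2 case: (a u == _); rewrite ?mulr1 ?mulr0 ?mul0r.
Qed.

(** Take the word with [a s] at both [t] and [s], and S for x = y = [a t]. It puts [a t] back at one
    of the two places, so twice the sum of the two values vanishes. *)
Lemma letters_swap a t s : injective a -> s != t -> a s = flip (a t) ->
  h (letters a) = 0 -> h (letters [ffun u => a (tperm t s u)]) = 0.
Proof.
move=> ai st as_ ha; pose T := updz a t (a s).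
have Tu u : (T u == flip (a t)) = (u == t) || (u == s).
  rewrite ffunE -as_; case: (u == t) => /=; first by rewrite eqxx.
  exact: inj_eq.
have := letters_rank2 T (a t) (a t); rewrite -mulrDr -mulr2n -mulr_natl.
rewrite (eq_bigl _ _ Tu) (bigD1 t) ?eqxx //= (big_pred1 s); last first.
  by move=> u /=; case: eqVneq => [->|] /=; rewrite ?andbT // eq_sym (negPf st).
have -> : updz T t (a t) = a.
  by apply/ffunP => u; rewrite !ffunE; case: eqP => [->|].
rewrite ha add0r => /eqP; rewrite !mulf_eq0 signr_eq0 (negPf n2) /= => /eqP <-.
congr (h (letters _)); apply/ffunP => u; rewrite !ffunE.
by case: tpermP => [->|->|/eqP /negPf -> /eqP /negPf ->] //;
  rewrite ?eqxx // eq_sym (negPf st).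
Qed.

(* With W x y z p the word having x, y, z, p at t, s, t1, s1, the values at
   W z z' z1 z1' and W z1 z1' z z' (a prime denotes the mate) both add up with
   the value at W z z1' z1 z' to the same multiple of the value at W z z' z z'. *)
Lemma letters_exchange a t s t1 s1 : injective a ->
  uniq [:: t; s; t1; s1] -> a s = flip (a t) -> a s1 = flip (a t1) ->
  h (letters a) = 0 ->
  h (letters [ffun u => a (tperm t t1 (tperm s s1 u))]) = 0.
Proof.
move=> ai U as_ as1 ha.
pose W x y z p : {ffun I -> 'I_r * bool} := [ffun u => if u == t then x else
  if u == s then y else if u == t1 then z else if u == s1 then p else a u].
move: U; rewrite /= !inE !negb_or andbT => /and3P[/and3P[ts tt1 ts1] /andP[st1 ss1] t1s1].
have F (u v : I) : u != v -> (u == v = false) * (v == u = false).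
  by move=> /negPf uv; split; rewrite // eq_sym.
(* A multirule deciding equality between any two of the four positions, in both orientations, and
   between letters of [a]. *)
pose N := (F _ _ ts, F _ _ tt1, F _ _ ts1, F _ _ st1, F _ _ ss1, F _ _ t1s1,
  fun x => inj_eq ai x).
have Wt x y z p : W x y z p t = x by rewrite ffunE eqxx.
have Ws x y z p : W x y z p s = y by rewrite ffunE !N eqxx.
have Wt1 x y z p : W x y z p t1 = z.
  by rewrite ffunE !N eqxx.
have Ws1 x y z p : W x y z p s1 = p.
  by rewrite ffunE !N eqxx.
have Wa x y z p u : u != t -> u != s -> u != t1 -> u != s1 -> W x y z p u = a u.
  by rewrite ffunE => /negPf -> /negPf -> /negPf -> /negPf ->.
have ffunW x y z p (b : {ffun I -> 'I_r * bool}) : b t = x -> b s = y -> b t1 = z -> b s1 = p ->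
    (forall u, u != t -> u != s -> u != t1 -> u != s1 -> b u = a u) ->
    b = W x y z p.
  move=> bt bs bt1 bs1 bu; apply/ffunP => u.
  have [->|ut] := eqVneq u t; first by rewrite Wt.
  have [->|us] := eqVneq u s; first by rewrite Ws.
  have [->|ut1] := eqVneq u t1; first by rewrite Wt1.
  have [->|us1] := eqVneq u s1; first by rewrite Ws1.
  by rewrite Wa // bu.
have U1 x y z p v : updz (W x y z p) t v = W v y z p.
  apply: ffunW => [|||| u ut us u1 u2]; rewrite ffunE ?eqxx ?N //.
  by rewrite (negPf ut) Wa.
have U2 x y z p v : updz (W x y z p) s v = W x v z p.
  apply: ffunW => [|||| u ut us u1 u2]; rewrite ffunE ?eqxx ?N //.
  by rewrite (negPf us) Wa.
have U3 x y z p v : updz (W x y z p) t1 v = W x y v p.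
  apply: ffunW => [|||| u ut us u1 u2]; rewrite ffunE ?eqxx ?N //.
  by rewrite (negPf u1) Wa.
have U4 x y z p v : updz (W x y z p) s1 v = W x y z v.
  apply: ffunW => [|||| u ut us u1 u2]; rewrite ffunE ?eqxx ?N //.
  by rewrite (negPf u2) Wa.
have big2 u v (f : I -> K) : u != v ->
    \sum_(i | (i == u) || (i == v)) f i = f u + f v.
  move=> uv; rewrite (bigD1 u) ?eqxx //= (big_pred1 v) // => i /=.
  by have [->|] := eqVneq i u; rewrite ?andbF ?andbT // (negPf uv).
(* [E1] to [E4] locate the mates replaced by the two instances of [letters_rank2] below, taken at
   the words z z' z1 z' and z z1' z z'. *)
have E1 : [pred u | W (a t) (a s) (a t1) (a s) u == a t1] =1 pred1 t1.
  move=> u; rewrite !inE.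
  have [->|ut] := eqVneq u t; first by rewrite Wt !N.
  have [->|us] := eqVneq u s; first by rewrite Ws !N.
  have [->|ut1] := eqVneq u t1; first by rewrite Wt1 eqxx.
  have [->|us1] := eqVneq u s1; first by rewrite Ws1 !N.
  by rewrite Wa // N (negPf ut1).
have E2 u : (W (a t) (a s) (a t1) (a s) u == a s) = (u == s) || (u == s1).
  have [->|ut] := eqVneq u t; first by rewrite Wt !N.
  have [->|us] := eqVneq u s; first by rewrite Ws eqxx.
  have [->|ut1] := eqVneq u t1; first by rewrite Wt1 !N.
  have [->|us1] := eqVneq u s1; first by rewrite Ws1 eqxx.
  by rewrite Wa // N (negPf us).
have E3 : [pred u | W (a t) (a s1) (a t) (a s) u == a s1] =1 pred1 s.
  move=> u; rewrite !inE.
  have [->|ut] := eqVneq u t; first by rewrite Wt !N.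
  have [->|us] := eqVneq u s; first by rewrite Ws eqxx.
  have [->|ut1] := eqVneq u t1; first by rewrite Wt1 !N.
  have [->|us1] := eqVneq u s1; first by rewrite Ws1 !N.
  by rewrite Wa // N (negPf us1).
have E4 u : (W (a t) (a s1) (a t) (a s) u == a t) = (u == t) || (u == t1).
  have [->|ut] := eqVneq u t; first by rewrite Wt eqxx.
  have [->|us] := eqVneq u s; first by rewrite Ws !N.
  have [->|ut1] := eqVneq u t1; first by rewrite Wt1 eqxx.
  have [->|us1] := eqVneq u s1.
    by rewrite Ws1 !N.
  by rewrite Wa // N (negPf ut).
have := letters_rank2 (W (a t) (a s1) (a t) (a s)) (a t1) (a s).
have := letters_rank2 (W (a t) (a s) (a t1) (a s)) (a t) (a s1).
rewrite as_ as1 !flipK -as_ -as1 (eq_bigl _ _ E1) (eq_bigl _ _ E2).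
rewrite (eq_bigl _ _ E3) (eq_bigl _ _ E4) !big_pred1_eq.
rewrite !big2 // ?U1 ?U2 ?U3 ?U4.
have -> : W (a t) (a s) (a t1) (a s1) = a by symmetry; apply: ffunW.
have -> : [ffun u => a (tperm t t1 (tperm s s1 u))] = W (a t1) (a s1) (a t) (a s).
  apply: ffunW => [|||| u ut us u1 u2]; rewrite ffunE.
  - by rewrite [tperm s s1 t]tpermD ?tpermL ?N // eq_sym ?N.
  - by rewrite tpermL tpermD // ?N // eq_sym N.
  - by rewrite [tperm s s1 t1]tpermD ?tpermR ?N // eq_sym ?N.
  - by rewrite tpermR tpermD ?N.
  by rewrite !tpermD // eq_sym.
rewrite ha as_ as1 /= !signrN addr0 !mulNr => E5.
move: E5; move: (h _) (h _) (h _) => f1 C D E5 E6.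
apply: (mulfI (negbT (signr_eq0 K (a t).2))); rewrite mulr0.
have := congr1 -%R (congr2 +%R E5 E6); rewrite addr0 oppr0 => E.
by rewrite -[RHS]E; ring.
Qed.

(** Induction on the number of positions where [a] and [a'] differ. At such a [t], the letter [a' t]
    stands in [a] at some [t1]. If [t1] is the other end of the arc of [t], this arc is reversed;
    otherwise the arcs of [t] and [t1] are exchanged as a whole. *)
Lemma rainbow_transfer (D : I -> I) a a' : injective a -> injective a' ->
  (forall t, a (D t) = flip (a t)) -> (forall t, a' (D t) = flip (a' t)) ->
  h (letters a) = 0 -> h (letters a') = 0.
Proof.
move=> ai ai' aD aD'; have [n] := ubnP #|[set t | a t != a' t]|.
elim: n a ai aD => // n IH a ai aD; rewrite ltnS => an ha.
have [->//|/eqP/ffunP ne] := eqVneq a' a.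
have /existsP[t tn] : [exists t, a t != a' t].
  rewrite -negb_forall; apply/forallP => aa'; apply: ne => x.
  by rewrite (eqP (aa' x)).
have DK : involutive D by move=> u; apply: ai; rewrite !aD flipK.
have Dn u : D u != u.
  by apply/eqP => E; have := flip_neq (a u); rewrite -aD E eqxx.
have cardZ : (#|{: 'I_r * bool}| <= #|I|)%N.
  by rewrite card_prod card_ord card_bool cardI.
have /codomP[t1 t1E] := inj_card_onto ai cardZ (a' t).
have t1t : t1 != t by apply: contraNneq tn => E; rewrite t1E E.
(* A permutation that respects the arcs, repairs position [t] and fixes every position already right
   decreases the count. *)
have step (p : {perm I}) : (forall u, p (D u) = D (p u)) -> p t = t1 ->
    (forall u, a u = a' u -> p u = u) ->
    h (letters [ffun u => a (p u)]) = 0 -> h (letters a') = 0.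
  move=> pD pt pu; apply: IH.
  - by move=> x y; rewrite !ffunE => /ai /perm_inj.
  - by move=> u; rewrite !ffunE pD aD.
  apply: leq_trans an; apply: proper_card; apply/properP; split.
    apply/subsetP => u; rewrite !inE ffunE; apply: contraNneq => aa'.
    by rewrite pu ?aa'.
  by exists t; rewrite !inE ?ffunE ?pt -?t1E ?eqxx.
(* Agreement of the two words is stable under [D], so neither end of a moved arc was right
   before. *)
have aa'D u : a u = a' u -> a (D u) = a' (D u) by rewrite aD aD' => ->.
have a't1 : a t1 != a' t1 by rewrite -t1E (inj_eq ai') eq_sym.
have [E|t1Dt] := eqVneq t1 (D t).
  apply: (step (tperm t (D t))); last exact: letters_swap.
  - by move=> u; rewrite (inj_tperm _ _ _ (inv_inj DK)) DK tpermC.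
  - by rewrite tpermL.
  move=> u ua; rewrite tpermD //.
    by apply: contraNneq tn => ->; rewrite ua.
  by apply: contraNneq a't1 => Dt; rewrite E Dt ua.
have Dt1t : D t1 != t by apply: contraNneq t1Dt => <-; rewrite DK.
apply: (step (tperm (D t) (D t1) * tperm t t1)%g).
- move=> u; rewrite !permM !(inj_tperm _ _ _ (inv_inj DK)) !DK.
  move: (D u) => x; have nd y : y \in [:: t; t1] -> (D t != y) * (D t1 != y).
    rewrite !inE => /orP[] /eqP ->; first by rewrite Dn Dt1t.
    by rewrite Dn eq_sym t1Dt.
  have net := nd t (mem_head _ _).
  have net1 : (D t != t1) * (D t1 != t1) by apply: nd; rewrite !inE eqxx orbT.
  have [->|xt] := eqVneq x t.
    by rewrite [tperm (D t) (D t1) t]tpermD ?net // tpermL tpermD ?net1.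
  have [->|xt1] := eqVneq x t1.
    by rewrite [tperm (D t) (D t1) t1]tpermD ?net1 // tpermR tpermD ?net.
  rewrite [tperm t t1 x]tpermD 1?eq_sym //.
  case: (tpermP (D t) (D t1) x) => [_|_|_ _]; apply: tpermD; rewrite eq_sym ?net ?net1 //.
- by rewrite permM [tperm (D t) _ t]tpermD ?tpermL ?Dn ?Dt1t.
- move=> u ua; have uD := aa'D _ ua.
  have ut v : a v != a' v -> (v != u) && (D v != u).
    move=> va; apply/andP; split; apply: contraNneq va => uE; first by rewrite uE ua.
    by rewrite -uE DK in uD; rewrite uD.
  have /andP[tu Dtu] := ut t tn; have /andP[t1u Dt1u] := ut t1 a't1.
  by rewrite permM !tpermD.
suff -> : [ffun u => a ((tperm (D t) (D t1) * tperm t t1)%g u)]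
    = [ffun u => a (tperm t t1 (tperm (D t) (D t1) u))].
  apply: letters_exchange => //.
  have [e1 e2] : t != D t /\ t1 != D t1 by rewrite ![_ == D _]eq_sym !Dn.
  have [e3 e4] : t != t1 /\ t != D t1 by rewrite ![t == _]eq_sym t1t.
  by rewrite /= !inE !negb_or (inj_eq (inv_inj DK)) e1 e2 e3 e4 eq_sym t1Dt.
by apply/ffunP => u; rewrite !ffunE permM.
Qed.

End Rainbow.

End Multilinear.

(** * Existence of hyperbolic pairs; span and independence of the pairing forms *)

Section Hyperbolic.
Variables (K : fieldType) (V : superVect K) (B : evenForm V).

Lemma homog_dual c v : v \in sv_part V c -> v != 0 ->
  exists2 u, u \in sv_part V c & B v u != 0.
Proof.
move=> vc v0; have [/forallP H|] :=
    boolP [forall i : 'I_(\dim (sv_part V c)), B v (vbasis (sv_part V c))`_i == 0].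
  case/eqP: v0; apply: (homog_nondeg (B := B) vc) => w wc.
  rewrite (coord_vbasis wc) linear_sumr big1 // => i _.
  by rewrite formZr (eqP (H i)) mulr0.
rewrite negb_forall => /existsP[i nz]; exists (vbasis (sv_part V c))`_i => //.
by rewrite vbasis_mem // mem_nth // size_tuple.
Qed.

(** Gram-Schmidt: an odd vector outside the span of the earlier letters has a nonzero projection x
    to their complement. Nondegeneracy gives a partner, which is projected and rescaled. For 2 = 0
    only the step from no pair to one pair occurs, where there is nothing to project. *)
Lemma exists_hyperbolic r : (2%:R : K) != 0 \/ (r <= 1)%N ->
  (r * 2 <= sdim V true)%N ->
  exists l : 'I_r * bool -> V, hyperbolic B l.
Proof.
elim: r => [|r IH] n2 rn.
  by exists (fun=> 0); split=> [[[]]|[[]]|[[]]].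
have [l ll] : exists l : 'I_r * bool -> V, hyperbolic B l.
  by apply: IH; [case: n2 => [|/ltnW]; [left|right] | lia].
have perpP z v : B (l z) (perp_part B l v) = 0.
  case: n2 => [n2|r1]; first exact: perp_partP.
  by case: z => -[i ir]; lia.
pose U := <<[seq l z | z : 'I_r * bool]>>%VS.
have /subvPn[v vo vU] : ~~ (sv_part V true <= U)%VS.
  apply/negP => /dimvS; rewrite leqNgt => /negP[]; apply: leq_trans rn.
  apply: leq_ltn_trans (dim_span _) _.
  by rewrite size_map -cardE card_prod card_ord card_bool; lia.
have lU z : l z \in U by apply/memv_span/image_f.
pose x := perp_part B l v.
have xo : x \in sv_part V true by apply: perp_part_mem.
have x0 : x != 0.
  apply: contraNneq vU => /eqP; rewrite subr_eq0 => /eqP ->.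
  by apply: rpred_sum => z _; rewrite rpredZ.
have [u uo xu] := homog_dual xo x0.
pose y := (B x u)^-1 *: perp_part B l u.
have yo : y \in sv_part V true by rewrite rpredZ // perp_part_mem.
have lx z : B (l z) x = 0 by apply: perpP.
have ly z : B (l z) y = 0 by rewrite formZr perpP mulr0.
have sym a b : a \in sv_part V true -> b \in sv_part V true -> B a b = - B b a.
  by move=> ao bo; rewrite (ef_sym B ao bo) mulN1r.
have xl z : B x (l z) = 0 by rewrite sym ?(hyp_odd ll) // lx oppr0.
have yl z : B y (l z) = 0 by rewrite sym ?(hyp_odd ll) // ly oppr0.
have xy : B x y = 1.
  rewrite formZr linearBr linear_sumr big1 ?subr0 ?mulVf // => z _.
  by rewrite formZr xl mulr0.
pose l' (z : 'I_r.+1 * bool) : V := match unlift ord0 z.1 with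
  | Some j => l (j, z.2) | None => if z.2 then y else x end.
exists l'; split.
- case=> i b; rewrite /l' /=; case: unliftP => [j|] _.
    exact: (hyp_odd ll).
  by case: b.
- case=> i b; rewrite /l' /=; case: unliftP => [j|] _; first exact: (hyp_flip ll).
  by case: b => //=; rewrite sym ?xy.
case=> i b [i' b']; rewrite /l' /flip /= !xpair_eqE.
case: unliftP => [j|] ->; case: unliftP => [j'|] -> => //.
- rewrite !(inj_eq lift_inj) => H1 H2; apply: (hyp_orth ll);
    by rewrite ?/flip /= xpair_eqE.
- by case: b'.
- by case: b.
by rewrite eqxx; case: b; case: b'.
Qed.

(** The arcs of [D] are numbered by their ends in [A], those enumerated before their partners. The
    two ends of an arc get the two letters of that number. *)
Lemma exists_rainbow (I : finType) r (D : I -> I) : #|I| = (r * 2)%N ->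
  involutive D -> (forall t, D t != t) ->
  exists2 a : {ffun I -> 'I_r * bool}, injective a
    & forall t, a (D t) = flip (a t).
Proof.
move=> cI DK Dn; pose A := [set t | (enum_rank t < enum_rank (D t))%N].
have AD t : (D t \in A) = (t \notin A).
  rewrite !inE DK -leqNgt ltn_neqAle; case: eqP => // /val_inj /enum_rank_inj E.
  by have := Dn t; rewrite E eqxx.
have cA : #|A| = r.
  have : D @: A = ~: A.
    apply/setP => t; rewrite -{1}[t]DK mem_imset; last exact: inv_inj.
    by rewrite in_setC AD.
  move=> /(congr1 (fun X => #|pred_of_set X|)) /=; rewrite card_imset; last exact: inv_inj.
  by have := cardsC A; lia.
have [f fi] : exists f : I -> 'I_r, {in A &, injective f}.
  (* [inord] needs an inhabited range; for r = 0 there are no positions at all. *)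
  case: r cI cA => [|r] cI cA.
    have t0 (t : I) : False by have := max_card (pred1 t); rewrite card1 cI.
    by exists (fun t => False_rect _ (t0 t)).
  exists (fun t => inord (index t (enum A))) => t s tA sA.
  move=> /(congr1 val); rewrite /= !inordK -?cA ?cardE ?index_mem ?mem_enum //.
  by move=> /(congr1 (nth t (enum A))); rewrite !nth_index ?mem_enum.
exists [ffun t => if t \in A then (f t, false) else (f (D t), true)].
  move=> t s; rewrite !ffunE; case: ifP => tA; case: ifP => sA // -[].
    exact: fi.
  by move=> /fi H; apply: (inv_inj DK); apply: H; rewrite AD ?tA ?sA.
by move=> t; rewrite !ffunE AD DK; case: (t \in A).
Qed.

Section Span.
Variables (I J : finType) (sg : bool -> (I -> bool) -> I -> bool).
Hypothesis sg_even : forall q t, sg false q t = false.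
Variables (r : nat) (cardI : #|I| = (r * 2)%N).
Variables (D : J -> I -> I) (f : J -> {ffun I -> V} -> K).
Hypothesis f_lin : forall j, mlin (f j).
Hypothesis f_lie : forall j, lie B sg (f j).
Hypothesis f_eq0 : forall j q w, homog q w ->
  (f j w == 0) = [exists t, B (w t) (w (D j t)) == 0].

(* The coefficients are adjusted so that the difference vanishes on the rainbow
   words one after the other. *)
Lemma lie_span_rainbow (l : 'I_r * bool -> V) : hyperbolic B l ->
  (2%:R : K) != 0 ->
  (forall a : {ffun I -> 'I_r * bool}, injective a ->
    exists j, forall t, a (D j t) = flip (a t)) ->
  forall h, mlin h -> lie B sg h ->
  exists c : J -> K, forall w, h w = \sum_j c j * f j w.
Proof.
move=> ll n2 surj h hl hL.
pose RB := [set a : {ffun I -> 'I_r * bool} | injectiveb a].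
have fE j a : (f j (letters l a) == 0) = ~~ [forall t, a (D j t) == flip (a t)].
  rewrite (f_eq0 j (letters_homog ll a)) negb_forall; apply: eq_existsb => t.
  by rewrite !ffunE -[_ == 0]negbK (hyp_neq0 ll n2).
suff [c Hc] : exists c : J -> K, forall a, a \in enum RB ->
    h (letters l a) - \sum_j c j * f j (letters l a) = 0.
  exists c => w; apply/eqP; rewrite -subr_eq0; apply/eqP.
  apply: (rainbow_eq0 sg_even ll n2 cardI (mlinB c hl f_lin) (lieB c hL f_lie)).
  by move=> a ai; apply: Hc; rewrite mem_enum inE; apply/injectiveP.
have sRB : {subset enum RB <= RB} by move=> a; rewrite mem_enum.
elim: (enum RB) sRB => [|a s IH] sRB; first by exists (fun=> 0).
have {IH} [|c Hc] := IH; first by move=> b bs; apply: sRB; rewrite inE bs orbT.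
have ai : injective a.
  by apply/injectiveP; have := sRB a (mem_head _ _); rewrite inE.
have [j aD] := surj a ai; pose g w := h w - \sum_j c j * f j w.
have gl : mlin g by apply: mlinB.
have gL : lie B sg g by apply: lieB.
(* If an earlier word has the pairing of [a], the difference already vanishes at [a] by
   [rainbow_transfer]. *)
have [/hasP[b bs /forallP bD]|nb] := boolP (has (fun b : {ffun I -> _} =>
    [forall t, b (D j t) == flip (b t)]) s).
  exists c => a'; rewrite inE => /orP[/eqP ->|]; last exact: Hc.
  apply: (rainbow_transfer sg_even ll n2 cardI gl gL (D := D j) (a := b)) => //.
  - apply/injectiveP; have := sRB b; rewrite !inE bs orbT.
    by move=> /(_ isT).
  - by move=> t; apply/eqP.
  exact: Hc.
(* Otherwise [f j] is nonzero at [a] and 0 at all earlier words, so its coefficient can be corrected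
   without spoiling them. *)
have fa : f j (letters l a) != 0.
  by rewrite fE negbK; apply/forallP => t; rewrite aD.
exists (fun i => c i + (i == j)%:R * (g (letters l a) / f j (letters l a))) => a' a's.
have -> : \sum_i (c i + (i == j)%:R * (g (letters l a) / f j (letters l a)))
      * f i (letters l a') = \sum_i c i * f i (letters l a')
        + g (letters l a) / f j (letters l a) * f j (letters l a').
  under eq_bigr do rewrite mulrDl.
  rewrite big_split /= [in X in _ + X](bigD1 j) //= eqxx mul1r.
  rewrite [X in _ + (_ + X)]big1 ?addr0 // => i /negPf ->.
  by rewrite !mul0r.
rewrite opprD addrA -/(g _); move: a's; rewrite inE => /orP[/eqP ->|a's].
  by rewrite mulfVK // subrr.
rewrite [g (letters l a')]Hc // sub0r; apply/eqP; rewrite oppr_eq0 mulf_eq0 fE.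
by apply/orP; right; apply: contra nb => H; apply/hasP; exists a'.
Qed.

(** At a rainbow word adapted to [D j] every [f i] with i other than j vanishes: some arc of [D i]
    then joins letters that are neither equal nor mates. *)
Lemma lie_free : (2%:R : K) != 0 \/ (r <= 1)%N -> (r * 2 <= sdim V true)%N ->
  (forall j, involutive (D j)) -> (forall j t, D j t != t) ->
  (forall j j', D j =1 D j' -> j = j') ->
  forall c : J -> K, (forall w, \sum_j c j * f j w = 0) -> forall j, c j = 0.
Proof.
move=> n2 rn DK Dn Dinj c c0 j.
have [l ll] := exists_hyperbolic n2 rn.
have [a ai aD] := exists_rainbow cardI (DK j) (Dn j).
pose w := letters l a; have wo := letters_homog ll a.
have := c0 w; rewrite (bigD1 j) //= big1 ?addr0 => [/eqP|i ij].
  rewrite mulf_eq0 (f_eq0 _ wo) => /orP[/eqP //|/existsP[t]].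
  by rewrite !ffunE aD (hyp_flip ll) signr_eq0.
have [/forallP ee|] := boolP [forall t, D i t == D j t].
  by case/eqP: ij; apply: Dinj => t; apply/eqP.
rewrite negb_forall => /existsP[t tn].
suff /eqP -> : f i w == 0 by rewrite mulr0.
rewrite (f_eq0 _ wo); apply/existsP; exists t; rewrite !ffunE.
by apply/eqP/(hyp_orth ll); rewrite -?aD (inj_eq ai).
Qed.

End Span.

End Hyperbolic.

(** * Two positions in characteristic two *)

Section CharTwo.
Variables (K : fieldType) (V : superVect K) (B : evenForm V) (I : finType).
Variable (sg : bool -> (I -> bool) -> I -> bool).
Hypothesis c2 : (2%:R : K) = 0.
Variables (t t' : I) (tt' : t != t') (It : forall s, s = t \/ s = t').
Variable h : {ffun I -> V} -> K.
Hypotheses (hl : mlin h) (hL : lie B sg h).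

Let pw (u v : V) : {ffun I -> V} := [ffun s => if s == t then u else v].
Let g u v := h (pw u v).

Let oppK (x : K) : - x = x.
Proof. by apply/eqP; rewrite -subr_eq0 -opprD oppr_eq0 -mulr2n -mulr_natl c2 mul0r. Qed.

Let signK (b : bool) : (-1) ^+ b = 1 :> K.
Proof. by case: b; rewrite ?expr1 ?oppK. Qed.

Let updl u v x : upd (pw u v) t x = pw x v.
Proof. by apply/ffunP => s; rewrite !ffunE; case: eqP. Qed.
Let updr u v x : upd (pw u v) t' x = pw u x.
Proof.
apply/ffunP => s; rewrite !ffunE; case: (It s) => ->.
  by rewrite eqxx (negPf tt').
by rewrite eqxx eq_sym (negPf tt').
Qed.
Let gl c u u' v : g (c *: u + u') v = c * g u v + g u' v.
Proof. by rewrite /g -(updl 0) hl !updl. Qed.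
Let gr c u v v' : g u (c *: v + v') = c * g u v + g u v'.
Proof. by rewrite /g -(updr _ 0) hl !updr. Qed.
Let gZl c u v : g (c *: u) v = c * g u v.
Proof. by rewrite /g -(updl 0) mlinZ // updl. Qed.
Let gZr c u v : g u (c *: v) = c * g u v.
Proof. by rewrite /g -(updr _ 0) mlinZ // updr. Qed.

Let g0l v : g 0 v = 0.
Proof. by rewrite -(scale0r (0 : V)) gZl mul0r. Qed.
Let g0r u : g u 0 = 0.
Proof. by rewrite -(scale0r (0 : V)) gZr mul0r. Qed.

Let glie e S c d u v : osp B e S -> u \in sv_part V c -> v \in sv_part V d ->
  g (S u) v + g u (S v) = 0.
Proof.
move=> eS uc vd.
have wq : homog (fun s => if s == t then c else d) (pw u v).
  by move=> s; rewrite ffunE; case: ifP.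
have := hL eS wq; rewrite (bigD1 t) //= (big_pred1 t'); last first.
  by move=> s /=; case: (It s) => ->; rewrite eqxx ?(negPf tt') // eq_sym tt'.
rewrite !signK !mul1r updl updr !ffunE eqxx eq_sym (negPf tt') => <-.
by [].
Qed.

(** The transvection along [b], applied to (u, w), gives <b,u> g(b,w) + <b,w> g(u,b) = 0. *)
Let g_orth b w c d u : b \in sv_part V true -> w \in sv_part V c ->
  B b w = 0 -> u \in sv_part V d -> B b u != 0 -> g b w = 0.
Proof.
move=> bo wc bw ud bu; have := glie (osp_transvection B bo) ud wc.
rewrite bw scale0r gZl g0r addr0 => /eqP.
by rewrite mulf_eq0 (negPf bu) => /eqP.
Qed.

(* k = g - c B vanishes on odd vectors: k(b, w) = 0 for b orthogonal to w, and
   polarizing this in w makes k(v, w) proportional to <v, b0>. *)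
Lemma lie_char2 : sdim V true != 0%N ->
  exists c : K, forall w, h w = c * B (w t) (w t').
Proof.
move=> V1; have [b0 b0o b00] : exists2 b, b \in sv_part V true & b != 0.
  exists (vpick (sv_part V true)); first exact: memv_pick.
  by rewrite vpick0 -dimv_eq0.
have [v1 v1o bv1] := homog_dual B b0o b00.
pose v0 := (B b0 v1)^-1 *: v1; have v0o : v0 \in sv_part V true by rewrite rpredZ.
have sym u v : u \in sv_part V true -> v \in sv_part V true -> B u v = B v u.
  by move=> uo vo; rewrite (ef_sym B uo vo) signK mul1r.
have bv0 : B b0 v0 = 1 by rewrite formZr mulVf.
have vb0 : B v0 b0 = 1 by rewrite sym.
(* Since <v0,b0> = 1, the constant is forced. *)
pose c := g v0 b0; exists c.
have orth b w d : b \in sv_part V true -> w \in sv_part V d -> B b w = 0 -> g b w = 0.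
  move=> bo wd bw; have [->|b_n0] := eqVneq b 0.
    exact: g0l.
  by have [u uo bu] := homog_dual B bo b_n0; apply: (g_orth bo wd bw uo bu).
pose k u v := g u v - c * B u v.
have kP u v w : u \in sv_part V true -> v \in sv_part V true ->
    w \in sv_part V true -> B u w * k v w = B v w * k u w.
  (* This combination of [u] and [v] is orthogonal to [w]. *)
  move=> uo vo wo; pose b := B u w *: v + (- B v w) *: u.
  have bo : b \in sv_part V true by rewrite rpredD ?rpredZ.
  have bw : B b w = 0 by rewrite formDl !formZl mulrC mulNr subrr.
  have := orth _ _ _ bo wo bw; rewrite /b gl gZl mulNr => E.
  have {}E : B u w * g v w = B v w * g u w.
    by apply/eqP; rewrite -subr_eq0 E.
  by rewrite /k !mulrBr E mulrCA [in RHS]mulrCA [B u w * _]mulrC.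
have kb v : v \in sv_part V true -> k v b0 = 0.
  move=> vo; have := kP v0 v b0 v0o vo b0o; rewrite vb0 mul1r => ->.
  by rewrite /k vb0 mulr1 subrr mulr0.
have kD v w : v \in sv_part V true -> k v (w + b0) = k v w.
  move=> vo; rewrite -[RHS]addr0 -(kb v vo) /k formDr -[w]scale1r gr scale1r mul1r.
  by rewrite mulrDr opprD addrACA.
have odd0 v w : v \in sv_part V true -> w \in sv_part V true -> k v w = 0.
  move=> vo wo.
  (* Subtract [kP] at w from [kP] at w + b0; by [kD] the values of k are the same in both. *)
  have E1 : k v w = B v b0 * k v0 w.
    have := kP v0 v (w + b0) v0o vo; rewrite rpredD // => /(_ isT).
    rewrite !kD // !formDr !mulrDl (kP v0 v w) // => /addrI.
    by rewrite vb0 mul1r.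
  have [k0|k0] := eqVneq (k v0 w) 0; first by rewrite E1 k0 mulr0.
  (* Cancelling k(v0,w) in [kP] gives <u,w> = <v0,w> <u,b0> for every odd u, so w is a multiple of
     b0, where k vanishes. *)
  have w0 : w = B v0 w *: b0.
    apply/eqP; rewrite -subr_eq0; apply/eqP.
    apply: (homog_nondeg (B := B) (c := true)); first by rewrite rpredB ?rpredZ.
    move=> u uo; rewrite sym ?rpredB ?rpredZ // linearBr formZr.
    have E2 : k u w = B u b0 * k v0 w.
      have := kP v0 u (w + b0) v0o uo; rewrite rpredD // => /(_ isT).
      rewrite !kD // !formDr !mulrDl (kP v0 u w) // => /addrI.
      by rewrite vb0 mul1r.
    have := kP v0 u w v0o uo wo; rewrite E2 mulrA => /(mulIf k0) <-.
    by rewrite subrr.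
  by case/eqP: k0; rewrite w0 /k gZr formZr mulrCA -mulrBr -/(k v0 b0) kb // mulr0.
have oe b a : b \in sv_part V true -> a \in sv_part V false -> g b a = 0.
  by move=> bo ae; apply: (orth _ _ _ bo ae); apply: (ef_even B bo ae).
have eo b a : b \in sv_part V true -> a \in sv_part V false -> g a b = 0.
  move=> bo ae; have := glie (osp_rank2 B ae b0o) v0o bo.
  rewrite gl gr bv0 mul1r (ef_even B ae v0o) // (ef_even B ae bo) //.
  by rewrite !mulr0 !scale0r g0l g0r !addr0 (oe v0 a) // mulr0 addr0.
(* The odd element S built from [a] and [b0], applied to (v0, a'), carries the constant over from
   the odd to the even part: it sends v0 to a and a' to a multiple of b0. *)
have ee a a' : a \in sv_part V false -> a' \in sv_part V false ->
    g a a' = c * B a a'.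
  move=> ae ae'; have := glie (osp_rank2 B ae b0o) v0o ae'.
  rewrite gl gr bv0 mul1r (ef_even B ae v0o) // (ef_even B b0o ae') //.
  rewrite mulr0 scale0r g0l addr0 mul0r add0r.
  rewrite gZr /osp_kappa oppK signK mul1r -/c => /eqP.
  by rewrite addr_eq0 oppK mulrC => /eqP.
have bil : mlin (fun w => h w - c * B (w t) (w t')).
  move=> w s k' u v; rewrite hl; case: (It s) => ->.
    rewrite !upd_eq !upd_neq 1?eq_sym // formDl formZl; ring.
  rewrite !upd_eq !upd_neq // formDr formZr; ring.
move=> w; apply/eqP; rewrite -subr_eq0; apply/eqP.
apply: (mlin_homog bil) => q {}w wq.
have -> : w = pw (w t) (w t').
  apply/ffunP => s; rewrite ffunE; case: (It s) => ->; rewrite ?eqxx //.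
  by rewrite eq_sym (negPf tt').
rewrite !ffunE eqxx eq_sym (negPf tt') -/(g _ _) -/(k _ _).
move: (wq t) (wq t'); case: (q t); case: (q t') => p1 p2.
- exact: odd0.
- by rewrite /k oe // (ef_even B p1 p2) // mulr0 subr0.
- by rewrite /k eo // (ef_even B p1 p2) // mulr0 subr0.
by rewrite /k ee // subrr.
Qed.
End CharTwo.

(** * The spanning result in every characteristic *)

Section SpanAll.
Variables (K : fieldType) (V : superVect K) (B : evenForm V).
Variables (I J : finType) (sg : bool -> (I -> bool) -> I -> bool).
Hypothesis sg_even : forall q t, sg false q t = false.
Variables (r : nat) (cardI : #|I| = (r * 2)%N).
Variables (D : J -> I -> I) (f : J -> {ffun I -> V} -> K).
Hypotheses (DK : forall j, involutive (D j)) (Dn : forall j t, D j t != t).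
Hypothesis f_lin : forall j, mlin (f j).
Hypothesis f_lie : forall j, lie B sg (f j).
Hypothesis f_eq0 : forall j q w, homog q w ->
  (f j w == 0) = [exists t, B (w t) (w (D j t)) == 0].
Hypothesis surj : forall a : {ffun I -> 'I_r * bool}, injective a ->
    exists j, forall t, a (D j t) = flip (a t).

(** For 2 = 0 the bound r <= 1 leaves a single pairing, so every solution must be a multiple of one
    [f j]. *)
Lemma lie_span : (2%:R : K) != 0 \/ (r <= 1)%N -> (r * 2 <= sdim V true)%N ->
  forall h, mlin h -> lie B sg h ->
  exists c : J -> K, forall w, h w = \sum_j c j * f j w.
Proof.
move=> n2r rn h hl hL; have [c2|n2] := eqVneq (2%:R : K) 0; last first.
  have [l ll] := exists_hyperbolic B (or_introl n2) rn.
  exact: (lie_span_rainbow sg_even cardI f_lin f_lie f_eq0 ll n2 surj).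
have r1 : (r <= 1)%N by case: n2r; rewrite // c2 eqxx.
have cIZ : #|I| = #|{: 'I_r * bool}| by rewrite card_prod card_ord card_bool.
(* Any bijection from positions to letters will do; it serves to produce an index [j]. *)
have [|j aD] := surj (a := [ffun t => enum_val (cast_ord cIZ (enum_rank t))]).
  by move=> s s'; rewrite !ffunE => /enum_val_inj /cast_ord_inj /enum_rank_inj.
suff [w0 f0 hf] : exists2 w0, f j w0 != 0 & forall w, h w = h w0 / f j w0 * f j w.
  exists (fun i => (i == j)%:R * (h w0 / f j w0)) => w.
  rewrite (bigD1 j) //= eqxx mul1r big1 ?addr0 // => i /negPf ->.
  by rewrite !mul0r.
have [r0|r0] : r = 0%N \/ r = 1%N by move: r1; case: (r) => [|[]]; auto.
  have It (t : I) : False by have := max_card (pred1 t); rewrite card1 cardI r0.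
  have w0 w : w = [ffun=> 0] :> {ffun I -> V} by apply/ffunP => t; case: (It t).
  have f0 : f j [ffun=> 0] != 0.
    rewrite (f_eq0 j (q := fun=> false)) ?negb_exists; last by move=> t; case: (It t).
    by apply/forallP => t; case: (It t).
  by exists [ffun=> 0] => // w; rewrite (w0 w) divfK.
rewrite r0 in rn; have cI : #|I| = 2%N by rewrite cardI r0.
have /card_gt0P[t _] : (0 < #|I|)%N by rewrite cI.
have tt' : t != D j t by rewrite eq_sym.
have It s : s = t \/ s = D j t.
  have [->|st] := eqVneq s t; [by left|right]; apply/eqP.
  apply: contraTT isT => sDt; have : uniq [:: s; t; D j t].
    by rewrite /= !inE negb_or st sDt tt'.
  by move=> /card_uniqP E; have := max_card (mem [:: s; t; D j t]); rewrite E cI.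
have V1 : sdim V true != 0%N by rewrite -lt0n (leq_trans _ rn).
have [ch hE] := lie_char2 c2 tt' It hl hL V1.
have [cf fE] := lie_char2 c2 tt' It (f_lin j) (f_lie j) V1.
have [b bo b0] : exists2 b, b \in sv_part V true & b != 0.
  exists (vpick (sv_part V true)); first exact: memv_pick.
  by rewrite vpick0 -dimv_eq0.
have [v vo bv] := homog_dual B bo b0.
pose w : {ffun I -> V} := [ffun s => if s == t then b else v].
have wo : homog (fun=> true) w by move=> s; rewrite ffunE; case: ifP.
have fw : f j w != 0.
  rewrite (f_eq0 _ wo) negb_exists; apply/forallP => s; case: (It s) => ->.
    by rewrite !ffunE eqxx (negPf (Dn _ _)).
  by rewrite DK !ffunE eqxx (negPf (Dn _ _)) (form_eq0C B vo bo).
have Bw : B (w t) (w (D j t)) != 0 by rewrite !ffunE eqxx (negPf (Dn _ _)).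
exists w => // u; rewrite (hE w) (hE u) fE [f j u]fE.
have cf0 : cf != 0 by move: fw; rewrite fE mulf_eq0 negb_or => /andP[].
rewrite -mulf_div divff // mulr1 mulrA divfK //.
Qed.
End SpanAll.

(** * Tensor powers *)

Section Tensors.
Variables (K : fieldType) (V : superVect K).

Definition crd (i : ix V) (v : V) : K :=
  match i with
  | inl a => coord (vbasis (sv_part V false)) a (hcomp false v)
  | inr a => coord (vbasis (sv_part V true)) a (hcomp true v)
  end.

Lemma crd_linear i : linear_for *%R (crd i).
Proof. by case: i => a k u v; rewrite /= /hcomp !linearP. Qed.

HB.instance Definition _ i :=
  GRing.isLinear.Build K V K *%R (crd i) (crd_linear i).

Lemma hbasis_mem (i : ix V) : hbasis i \in sv_part V (par i).
Proof.
by case: i => a /=; rewrite vbasis_mem // mem_nth // size_tuple.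
Qed.

Lemma crd_sum v : v = \sum_i crd i v *: hbasis i.
Proof.
rewrite -[LHS]hcomp_sum big_sumType /=.
by rewrite -!coord_vbasis // hcomp_mem.
Qed.

Lemma crd_hbasis i j : crd i (hbasis j) = (i == j)%:R.
Proof.
have hj := hbasis_mem j; case: i j hj => a [b|b] /= hb.
- by rewrite hcomp_id // coord_free ?(basis_free (vbasisP _)) // eq_sym.
- by rewrite hcomp_0 // linear0.
- by rewrite hcomp_0 // linear0.
by rewrite hcomp_id // coord_free ?(basis_free (vbasisP _)) // eq_sym.
Qed.

Lemma crd_par q i v : v \in sv_part V q -> crd i v != 0 -> par i = q.
Proof.
by case: q i => [] [a|a] vq //=; rewrite hcomp_0 // linear0 eqxx.
Qed.

Definition tens n (w : 'I_n -> V) : tpow V n :=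
  [ffun a : word V n => \prod_(s < n) crd (a s) (w s)].

Lemma eq_tens n (w w' : 'I_n -> V) : w =1 w' -> tens w = tens w'.
Proof.
by move=> ww; apply/ffunP => a; rewrite !ffunE; apply: eq_bigr => s _; rewrite ww.
Qed.

Lemma tens_hbasis n (a : word V n) : tens (fun s => hbasis (a s)) = tbasis a.
Proof.
apply/ffunP => b; rewrite !ffunE; under eq_bigr do rewrite crd_hbasis.
case: eqVneq => [->|ba]; first by rewrite big1 // => s _; rewrite eqxx.
have [s sn] : exists s, b s != a s.
  apply/existsP; apply: contraR ba => /existsPn H; apply/eqP/ffunP => s.
  by apply/eqP/negbNE/H.
by rewrite (bigD1 s) //= (negPf sn) mul0r.
Qed.

Lemma tens_lin n (w u v : 'I_n -> V) t c : w t = c *: u t + v t ->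
  (forall s, s != t -> w s = u s /\ w s = v s) ->
  tens w = c *: tens u + tens v.
Proof.
move=> wt ws; apply/ffunP => a; rewrite !ffunE !(bigD1 t (P := xpredT)) //= wt.
rewrite linearP /= mulrDl -mulrA /GRing.scale /=; congr (_ * (_ * _) + _ * _);
  by apply: eq_bigr => s /ws[e1 e2]; rewrite -?e1 -?e2.
Qed.

(** Lets signs defined on words be replaced by constants depending on the parities of the tuple. *)
Lemma tens_wpar n (q : 'I_n -> bool) (w : 'I_n -> V) a : homog q (finfun w) ->
  tens w a != 0 -> forall s, par (a s) = q s.
Proof.
move=> wq; rewrite ffunE => nz s; have := wq s; rewrite ffunE => /crd_par; apply.
by apply: contraNneq nz => E; rewrite (bigD1 s) //= E mul0r.
Qed.

Lemma tpow_tbasis n (x : tpow V n) : x = \sum_b x b *: tbasis b.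
Proof.
apply/ffunP => a; rewrite sum_ffunE (bigD1 a) //= big1 ?addr0 => [|b ba].
  by rewrite !ffunE eqxx /GRing.scale /= mulr1.
by rewrite !ffunE eq_sym (negPf ba) /GRing.scale /= mulr0.
Qed.

Lemma hom_tpowE i j (f : 'Hom(tpow V i, tpow V j)) x a :
  f x a = \sum_b coef f a b * x b.
Proof.
rewrite {1}[x]tpow_tbasis linear_sum sum_ffunE; apply: eq_bigr => b _.
by rewrite linearZ ffunE /GRing.scale /= mulrC.
Qed.

Lemma form_tpowE n (f : 'Hom(tpow V n, K^o)) x :
  f x = \sum_b x b * f (tbasis b).
Proof.
by rewrite {1}[x]tpow_tbasis linear_sum; apply: eq_bigr => b _; rewrite linearZ.
Qed.

Lemma coef_eq i j (f g : 'Hom(tpow V i, tpow V j)) :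
  (forall a b, coef f a b = coef g a b) -> f = g.
Proof.
move=> fg; apply/lfunP => x; apply/ffunP => a; rewrite !hom_tpowE.
by apply: eq_bigr => b _; rewrite fg.
Qed.

Lemma coef_comp i j k (g : 'Hom(tpow V j, tpow V k)) (f : 'Hom(tpow V i, tpow V j)) a b :
  coef (g \o f)%VF a b = \sum_c coef g a c * coef f c b.
Proof. by rewrite /coef comp_lfunE hom_tpowE. Qed.

Lemma coef_id n (a b : word V n) : coef \1%VF a b = (a == b)%:R.
Proof. by rewrite /coef id_lfunE ffunE. Qed.

Definition wcat m n (a : word V m) (b : word V n) : word V (m + n) :=
  [ffun s => match split s with inl t => a t | inr t => b t end].

Lemma wcatl m n (a : word V m) (b : word V n) : wleft (wcat a b) = a.
Proof.
by apply/ffunP => s; rewrite !ffunE -[lshift n s]/(unsplit (inl s)) unsplitK.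
Qed.
Lemma wcatr m n (a : word V m) (b : word V n) : wright (wcat a b) = b.
Proof.
by apply/ffunP => s; rewrite !ffunE -[rshift m s]/(unsplit (inr s)) unsplitK.
Qed.
Lemma wcatK m n (a : word V (m + n)) : wcat (wleft a) (wright a) = a.
Proof.
by apply/ffunP => s; rewrite ffunE -{2}[s]splitK; case: (split s) => t; rewrite !ffunE.
Qed.

Lemma sum_wcat (A : nmodType) m n (F : word V (m + n) -> A) :
  \sum_a F a = \sum_a \sum_b F (wcat a b).
Proof.
rewrite pair_big /= (reindex (fun p : word V m * word V n => wcat p.1 p.2)) //=.
exists (fun a => (wleft a, wright a)) => [[a b] _|a _] /=.
  by rewrite wcatl wcatr.
exact: wcatK.
Qed.

Lemma coef_tens_hom i j i' j' (f : 'Hom(tpow V i, tpow V j))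
    (g : 'Hom(tpow V i', tpow V j')) a b a' b' :
  coef (tens_hom f g) (wcat a a') (wcat b b') = coef f a b * coef g a' b'.
Proof. by rewrite coef_hom_of_coef !wcatl !wcatr. Qed.

Lemma tens_wcat m n (w : 'I_(m + n) -> V) a b : tens w (wcat a b)
  = tens (w \o lshift n) a * tens (w \o @rshift m n) b.
Proof.
rewrite !ffunE big_split_ord /=; congr (_ * _); apply: eq_bigr => s _.
  by rewrite ffunE -[lshift n s]/(unsplit (inl s)) unsplitK.
by rewrite ffunE -[rshift m s]/(unsplit (inr s)) unsplitK.
Qed.

Lemma tens_hom_tens i j i' j' (f : 'Hom(tpow V i, tpow V j))
    (g : 'Hom(tpow V i', tpow V j')) w a a' :
  tens_hom f g (tens w) (wcat a a')
  = f (tens (w \o lshift i')) a * g (tens (w \o @rshift i i')) a'.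
Proof.
rewrite !hom_tpowE sum_wcat big_distrlr /=.
apply: eq_bigr => b _; apply: eq_bigr => b' _.
by rewrite coef_tens_hom tens_wcat mulrACA.
Qed.

Variable B : evenForm V.

(* Pairs the factors position by position without Koszul signs. *)
Definition pairt n (w : 'I_n -> V) (x : tpow V n) : K :=
  \sum_(a : word V n) (\prod_(s < n) B (w s) (hbasis (a s))) * x a.

Lemma pairt_linear n (w : 'I_n -> V) : linear_for *%R (pairt w).
Proof.
move=> k x y; rewrite /pairt mulr_sumr -big_split /=; apply: eq_bigr => a _.
by rewrite !ffunE mulrDr /GRing.scale /= mulrCA.
Qed.

HB.instance Definition _ n (w : 'I_n -> V) :=
  GRing.isLinear.Build K (tpow V n) K *%R (pairt w) (pairt_linear w).

Lemma eq_pairt n (w w' : 'I_n -> V) x : w =1 w' -> pairt w x = pairt w' x.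
Proof.
move=> ww; apply: eq_bigr => a _; congr (_ * _); apply: eq_bigr => s _.
by rewrite ww.
Qed.

Lemma pairt_tens n (w u : 'I_n -> V) : pairt w (tens u) = \prod_s B (w s) (u s).
Proof.
rewrite /pairt; under [RHS]eq_bigr => s _.
  rewrite [u s]crd_sum linear_sumr; under eq_bigr do rewrite formZr mulrC.
  over.
rewrite bigA_distr_bigA; apply: eq_bigr => a _.
by rewrite ffunE -big_split.
Qed.

Lemma pairt_lin n (w u v : 'I_n -> V) t c x : w t = c *: u t + v t ->
  (forall s, s != t -> w s = u s /\ w s = v s) ->
  pairt w x = c * pairt u x + pairt v x.
Proof.
move=> wt ws; rewrite /pairt mulr_sumr -big_split /=; apply: eq_bigr => a _.
rewrite mulrA -mulrDl !(bigD1 t (P := xpredT)) //= wt formDl formZl mulrDl mulrA.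
congr ((_ * _ + _ * _) * _); by apply: eq_bigr => s /ws[e1 e2]; rewrite -?e1 -?e2.
Qed.

Lemma pairt_wcat m n (w : 'I_(m + n) -> V) (x : tpow V m) (y : tpow V n)
    (z : tpow V (m + n)) :
  (forall a b, z (wcat a b) = x a * y b) ->
  pairt w z = pairt (w \o lshift n) x * pairt (w \o @rshift m n) y.
Proof.
move=> zE; rewrite /pairt sum_wcat big_distrlr /=.
apply: eq_bigr => a _; apply: eq_bigr => b _; rewrite zE mulrACA; congr (_ * _).
rewrite big_split_ord /=; congr (_ * _); apply: eq_bigr => s _.
  by rewrite ffunE -[lshift n s]/(unsplit (inl s)) unsplitK.
by rewrite ffunE -[rshift m s]/(unsplit (inr s)) unsplitK.
Qed.

End Tensors.

(** * Infinitesimal points of OSp(V) *)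

Section DualNumbers.
Variable K : fieldType.

(** A separate name for the pairs a + b eps, to keep their componentwise product away. *)
Definition dual : Type := (K^o * K^o)%type.
HB.instance Definition _ := GRing.Lmodule.copy dual (K^o * K^o)%type.

Definition dmul (x y : dual) : dual := (x.1 * y.1, x.1 * y.2 + x.2 * y.1).

Lemma dmulA : associative dmul.
Proof. by move=> [a b] [c d] [x y]; congr (_, _) => /=; ring. Qed.
Lemma dmulC : commutative dmul.
Proof. by move=> [a b] [c d]; congr (_, _) => /=; ring. Qed.
Lemma dmul1 : left_id ((1, 0) : dual) dmul.
Proof. by move=> [a b]; congr (_, _) => /=; ring. Qed.
Lemma dmulD : left_distributive dmul +%R.
Proof. by move=> [a b] [c d] [x y]; congr (_, _) => /=; ring. Qed.
Lemma dual1_neq0 : ((1, 0) : dual) != 0.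
Proof. by rewrite xpair_eqE oner_eq0. Qed.

HB.instance Definition _ :=
  GRing.Zmodule_isComNzRing.Build dual dmulA dmulC dmul1 dmulD dual1_neq0.

Lemma dscaleAl (k : K) (x y : dual) : k *: (x * y) = (k *: x : dual) * y.
Proof. by case: x y => [a b] [c d]; congr (_, _) => /=; rewrite /GRing.scale /=; ring. Qed.

HB.instance Definition _ := GRing.Lmodule_isLalgebra.Build K dual dscaleAl.

Lemma dscaleAr (k : K) (x y : dual) : k *: (x * y) = x * (k *: y : dual).
Proof. by rewrite mulrC dscaleAl mulrC. Qed.

HB.instance Definition _ := GRing.Lalgebra_isAlgebra.Build K dual dscaleAr.

(* The parity of eps is e. *)
Definition dproj (e b : bool) (x : dual) : dual :=
  ((~~ b)%:R * x.1, (b == e)%:R * x.2).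

Lemma dproj_linear e b : linear (dproj e b).
Proof. by move=> k [a c] [x y]; congr (_, _) => /=; rewrite /GRing.scale /=; ring. Qed.

HB.instance Definition _ e b :=
  GRing.isLinear.Build K dual dual _ (dproj e b) (dproj_linear e b).

Lemma dprojP e b (x : dual) : dproj e b x = x <->
  (b -> x.1 = 0) /\ (b != e -> x.2 = 0).
Proof.
case: x => x y /=; split=> [[/=]|].
  by case: b; case: e => //=; rewrite ?mul0r => <- <-.
move=> [h1 h2]; congr (_, _) => /=.
  by case: b h1 {h2} => [/(_ isT) ->|_]; rewrite ?mulr0 ?mul1r.
by case: eqP h2 => [_|_ /(_ isT) ->]; rewrite ?mulr0 ?mul1r.
Qed.

Lemma dual_sum e (x : dual) : dproj e false x + dproj e true x = x.
Proof. by case: x => x y; case: e; congr (_, _) => /=; ring. Qed.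

Lemma dprojK e b c (x : dual) :
  dproj e b (dproj e c x) = if b == c then dproj e c x else 0.
Proof.
by case: x => x y; case: e b c => [] [] []; congr (_, _) => /=; ring.
Qed.

Lemma dproj_one e : dproj e false 1 = 1.
Proof. by case: e; congr (_, _) => /=; ring. Qed.

Lemma dproj_mul e b c (x y : dual) : dproj e b x = x -> dproj e c y = y ->
  dproj e (b (+) c) (x * y) = x * y.
Proof.
move=> /dprojP [h1 h2] /dprojP [h3 h4]; apply/dprojP.
case: x y h1 h2 h3 h4 => [x x'] [y y'] /=.
case: b; case: c; case: e => /= h1 h2 h3 h4; split=> // _;
  try (rewrite h1; last by []); try (rewrite h2; last by []);
  try (rewrite h3; last by []); try (rewrite h4; last by []);
  by rewrite !(mul0r, mulr0) ?addr0.
Qed.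

(** The product of two odd elements is 0 because eps^2 = 0, so one commutative product serves both
    parities of eps. *)
Lemma dproj_comm e b c (x y : dual) : dproj e b x = x -> dproj e c y = y ->
  x * y = (-1) ^+ (b && c) * (y * x).
Proof.
move=> /dprojP hx /dprojP hy; rewrite [y * x]mulrC.
case: b c hx hy => [] []; rewrite /= ?mul1r // => -[h1 _] [h3 _].
have -> : x * y = 0.
  by congr (_, _); rewrite /= h1 // h3 // !(mul0r, mulr0) ?addr0.
by rewrite mulr0.
Qed.

Definition dualSuper (e : bool) : superAlg K :=
  @SuperAlg K dual (dproj e) (dual_sum e) (dprojK e) (dproj_one e)
    (dproj_mul (e := e)) (dproj_comm (e := e)).

Lemma dual_prod_fst n (d : 'I_n -> dual) : (\prod_s d s).1 = \prod_s (d s).1.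
Proof. by apply: (big_morph (fun x : dual => x.1)). Qed.

(** The Leibniz rule. *)
Lemma dual_prod_snd n (d : 'I_n -> dual) :
  (\prod_s d s).2 = \sum_t (d t).2 * \prod_(s < n | s != t) (d s).1.
Proof.
elim: n d => [|n IH] d; first by rewrite !big_ord0.
rewrite !big_ord_recl /= IH dual_prod_fst addrC; congr (_ * _ + _).
  by rewrite [RHS]big_mkcond big_ord_recl /= mul1r.
rewrite mulr_sumr; apply: eq_bigr => t _.
rewrite [in RHS]big_mkcond big_ord_recl /= mulrCA; congr (_ * (_ * _)).
by rewrite big_mkcond; apply: eq_bigr => s _; rewrite (inj_eq lift_inj).
Qed.

Lemma dual_sum_snd (I : finType) (d : I -> dual) :
  (\sum_s d s).2 = \sum_s (d s).2.
Proof. by apply: (big_morph (fun x : dual => x.2)). Qed.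
Lemma dual_sum_fst (I : finType) (d : I -> dual) :
  (\sum_s d s).1 = \sum_s (d s).1.
Proof. by apply: (big_morph (fun x : dual => x.1)). Qed.

End DualNumbers.

Section Infinitesimal.
Variables (K : fieldType) (V : superVect K) (B : evenForm V).
Variables (e : bool) (S : V -> V) (eS : osp B e S).
Local Notation R := (dualSuper K e).

HB.instance Definition _ := GRing.isLinear.Build K V V _ S (let: And3 l _ _ := eS in l).

Lemma osp_mem c v : v \in sv_part V c -> S v \in sv_part V (c (+) e).
Proof. by case: eS => _ H _; apply: H. Qed.

Lemma osp_skew c d v w : v \in sv_part V c -> w \in sv_part V d ->
  B v (S w) = - ((-1) ^+ (e && d) * B (S v) w).
Proof.
by case: eS => _ _ H vc wd; apply/eqP; rewrite -addr_eq0 addrC (H c d v w).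
Qed.

Definition inf_coef (i j : ix V) : dual K := ((i == j)%:R, crd i (S (hbasis j))).

Lemma inf_coef_par i j : (inf_coef i j).2 != 0 -> par i = par j (+) e.
Proof. exact/crd_par/osp_mem/hbasis_mem. Qed.

(** The action of 1 + k S eps. The scalar [k] is there so that the inverse has the same shape. *)
Definition inf_map (k : K) (x : ext V R) : ext V R :=
  [ffun i => ((x i : dual K).1,
     (x i : dual K).2 + k * \sum_j crd i (S (hbasis j)) * (x j : dual K).1) : dual K].

Lemma inf_mapK k : cancel (inf_map k) (inf_map (- k)).
Proof.
move=> x; apply/ffunP => i; rewrite !ffunE /=.
rewrite [X in (_, _ + _ * X)](_ : _ = \sum_j crd i (S (hbasis j)) * (x j : dual K).1).
  by rewrite mulNr addrK -surjective_pairing.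
by apply: eq_bigr => j _; rewrite ffunE.
Qed.

Lemma twistE q (x : dual K) :
  twist (R := R) q x = (x.1, (-1) ^+ (e && q) * x.2) :> dual K.
Proof.
rewrite /twist; case: x => x y; case: e; case: q; congr (_, _); rewrite /= ?expr1 ?expr0; ring.
Qed.

Lemma ext_formE (x y : ext V R) : ext_form B x y =
  (\sum_i \sum_j B (hbasis i) (hbasis j) * ((x i : dual K).1 * (y j : dual K).1),
   \sum_i \sum_j B (hbasis i) (hbasis j) * ((x i : dual K).1 * (y j : dual K).2
     + (-1) ^+ (e && par j) * (x i : dual K).2 * (y j : dual K).1)) :> dual K.
Proof.
rewrite /ext_form [LHS]surjective_pairing dual_sum_fst dual_sum_snd.
congr (_, _); apply: eq_bigr => i _; rewrite ?dual_sum_fst ?dual_sum_snd;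
  by apply: eq_bigr => j _; rewrite twistE.
Qed.

Lemma inf_point : OSp_point B (inf_map 1).
Proof.
split.
- move=> x y; apply/ffunP => i; rewrite !ffunE /=; congr (_, _) => /=.
  rewrite !mul1r addrACA -big_split /=; congr (_ + _).
  by apply: eq_bigr => j _; rewrite !ffunE mulrDr.
- move=> x a; apply/ffunP => i; rewrite !ffunE /=; congr (_, _) => /=.
  rewrite !mul1r mulrDl addrA; congr (_ + _); rewrite mulr_suml.
  by apply: eq_bigr => j _; rewrite ffunE /= mulrA.
- move=> b x xb i; rewrite /= ffunE; apply/dprojP => /=.
  have /dprojP[h1 h2] := xb i; split; first exact: h1.
  move=> be; rewrite h2 // add0r mul1r big1 // => j _.
  have [->|nz] := eqVneq (crd i (S (hbasis j))) 0; first by rewrite mul0r.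
  have /dprojP[h3 _] := xb j; rewrite h3 ?mulr0 //.
  by move: be; rewrite (inf_coef_par nz) addbA; case: (b (+) par j); case: (e).
- exists (inf_map (- 1)); first exact: inf_mapK.
  by have := inf_mapK (- 1); rewrite opprK.
move=> x y; rewrite !ext_formE; congr (_, _).
  by apply: eq_bigr => i _; apply: eq_bigr => j _; rewrite !ffunE.
pose x1 i := (x i : dual K).1; pose y1 i := (y i : dual K).1.
pose Se j := S (hbasis j : V).
have E1 i : \sum_j B (hbasis i) (hbasis j) * (x1 i * \sum_l crd j (Se l) * y1 l)
    = \sum_l x1 i * y1 l * B (hbasis i) (Se l).
  under eq_bigr do rewrite mulrA mulr_sumr.
  rewrite exchange_big /=; apply: eq_bigr => l _.
  rewrite [in RHS](crd_sum (Se l)) linear_sumr mulr_sumr; apply: eq_bigr => j _.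
  by rewrite formZr; ring.
have E2 j : \sum_i B (hbasis i) (hbasis j) *
      ((-1) ^+ (e && par j) * (\sum_k crd i (Se k) * x1 k) * y1 j)
    = \sum_k x1 k * y1 j * ((-1) ^+ (e && par j) * B (Se k) (hbasis j)).
  under eq_bigr do rewrite mulr_sumr mulr_suml mulr_sumr.
  rewrite exchange_big /=; apply: eq_bigr => k _.
  rewrite [in RHS](crd_sum (Se k)) linear_sumlz mulr_sumr mulr_sumr; apply: eq_bigr => i _.
  by rewrite formZl; ring.
pose x2 i := (x i : dual K).2; pose y2 i := (y i : dual K).2.
(* The last two double sums are what S adds to the eps-component; they cancel by the defining
   relation of osp(V). *)
transitivity (\sum_i \sum_j B (hbasis i) (hbasis j) *
    (x1 i * y2 j + (-1) ^+ (e && par j) * x2 i * y1 j)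
  + (\sum_i \sum_j B (hbasis i) (hbasis j) * (x1 i * \sum_l crd j (Se l) * y1 l)
    + \sum_j \sum_i B (hbasis i) (hbasis j) *
      ((-1) ^+ (e && par j) * (\sum_k crd i (Se k) * x1 k) * y1 j))).
  rewrite [X in _ + (_ + X)]exchange_big /= -!big_split /=; apply: eq_bigr => i _.
  rewrite -!big_split /=; apply: eq_bigr => j _; rewrite !ffunE /= /x1 /y1 /x2 /y2 /Se.
  by ring.
rewrite (eq_bigr _ (fun i _ => E1 i)) (eq_bigr _ (fun i _ => E2 i)).
rewrite [X in _ + (_ + X)]exchange_big /= -[X in _ + X]big_split /=.
rewrite [X in _ + X]big1 ?addr0 // => i _; rewrite -big_split big1 //= => j _.
by rewrite -mulrDr (osp_skew (hbasis_mem i) (hbasis_mem j)) addNr mulr0.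
Qed.

Definition updf n (w : 'I_n -> V) (t : 'I_n) (v : V) : 'I_n -> V :=
  fun s => if s == t then v else w s.

(** The element eps, created at position [t], is collected on the right and passes the factors after
    [t]. *)
Definition lop_sign n (q : 'I_n -> bool) (t : 'I_n) : bool :=
  e && \big[addb/false]_(s < n | (t < s)%N) q s.

(* The eps-component of the action of 1 + S eps on the n-th tensor power. *)
Definition Lop n : 'Hom(tpow V n, tpow V n) :=
  hom_of_coef (fun a b =>
    coact_sign a b * (\prod_(s < n) inf_coef (a s) (b s) : dual K).2).

Lemma Lop_tens n (q : 'I_n -> bool) (w : 'I_n -> V) : homog q (finfun w) ->
  Lop n (tens w) = \sum_t (-1) ^+ lop_sign q t *: tens (updf w t (S (w t))).
Proof.
move=> wq; apply/ffunP => a; rewrite sum_ffunE hom_tpowE.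
pose csign (p : 'I_n -> bool) : K := \prod_(s < n) \prod_(t < n | (s < t)%N)
  (-1) ^+ ((par (a s) (+) p s) && par (a t)).
(* Only words with the parities [q] contribute, so the sign does not depend on [b] and comes out.
   The rest is an expanded product of dual numbers. *)
transitivity (csign q * (\sum_(b : word V n) \prod_(s < n)
    (crd (b s) (w s) *: inf_coef (a s) (b s)) : dual K).2).
  rewrite dual_sum_snd mulr_sumr; apply: eq_bigr => b _.
  rewrite coef_hom_of_coef scaler_prod /= /GRing.scale /=.
  have -> : \prod_(i < n) crd (b i) (w i) = tens w b by rewrite ffunE.
  have [->|nz] := eqVneq (tens w b) 0; first by rewrite mulr0 mul0r mulr0.
  rewrite mulrAC mulrA; congr (_ * _ * _); apply: eq_bigr => s _; apply: eq_bigr => t _.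
  by rewrite (tens_wpar wq nz).
rewrite -(bigA_distr_bigA (fun s i => crd i (w s) *: inf_coef (a s) i)) /=.
have -> : \prod_s \sum_i (crd i (w s) *: inf_coef (a s) i : dual K)
   = \prod_s ((crd (a s) (w s), crd (a s) (S (w s))) : dual K).
  apply: eq_bigr => s _; rewrite [LHS]surjective_pairing dual_sum_fst dual_sum_snd.
  congr (_, _).
    rewrite (bigD1 (a s)) //= big1 => [|i ia]; first by rewrite eqxx /GRing.scale /= mulr1 addr0.
    by rewrite eq_sym (negPf ia) /GRing.scale /= mulr0.
  by rewrite {2}[w s]crd_sum !linear_sum; apply: eq_bigr => i _; rewrite !linearZ.
rewrite dual_prod_snd mulr_sumr; apply: eq_bigr => t _ /=.
have -> : crd (a t) (S (w t)) * \prod_(s < n | s != t) crd (a s) (w s)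
   = tens (updf w t (S (w t))) a.
  rewrite ffunE [in RHS](bigD1 t) //= /updf eqxx; congr (_ * _).
  by apply: eq_bigr => s /negPf ->.
rewrite [in RHS]ffunE /GRing.scale /=.
have [->|nz] := eqVneq (tens (updf w t (S (w t))) a) 0; first by rewrite !mulr0.
congr (_ * _).
(* Away from [t] the word keeps the parities [q], so [csign q] reduces to its row at [t]. *)
have aq : forall s, par (a s) = if s == t then q t (+) e else q s.
  apply: tens_wpar nz => s; rewrite ffunE /updf; case: eqP => [_|_].
    by apply: osp_mem; have := wq t; rewrite ffunE.
  by have := wq s; rewrite ffunE.
rewrite /csign (bigD1 t) //= [X in _ * X]big1 => [|s st]; last first.
  by apply: big1 => t' _; rewrite aq (negPf st) addbb.
rewrite mulr1 /lop_sign.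
transitivity (\prod_(s < n | (t < s)%N) (-1 : K) ^+ (e && q s)).
  apply: eq_bigr => s ts; rewrite !aq eqxx addbAC addbb addFb.
  by case: eqP ts => [->|]; rewrite ?ltnn.
case: (e) => /=; last by rewrite big1.
by elim/big_rec2: _ => [|s x y _ ->]; rewrite ?expr0 // signr_addb.
Qed.

(** Each S is moved to the other side of the form by skewness. The extra sign involves the parity of
    the basis vector paired with S (w t), which is that of S (w t) itself. *)
Lemma pairt_Lop n (q : 'I_n -> bool) (w : 'I_n -> V) x : homog q (finfun w) ->
  pairt B w (Lop n x) = - \sum_t (-1) ^+ (lop_sign q t (+) (e && (q t (+) e)))
    * pairt B (updf w t (S (w t))) x.
Proof.
move=> wq; rewrite {1}[x]tpow_tbasis !linear_sum /=.
have -> : \sum_t (-1) ^+ (lop_sign q t (+) (e && (q t (+) e)))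
    * pairt B (updf w t (S (w t))) x
  = \sum_c x c * \sum_t (-1) ^+ (lop_sign q t (+) (e && (q t (+) e)))
    * pairt B (updf w t (S (w t))) (tbasis c).
  under [RHS]eq_bigr do rewrite mulr_sumr.
  rewrite [RHS]exchange_big /=; apply: eq_bigr => t _.
  rewrite {1}[x]tpow_tbasis !linear_sum mulr_sumr /=; apply: eq_bigr => c _.
  by rewrite linearZ mulrCA.
rewrite -sumrN; apply: eq_bigr => c _; rewrite !linearZ /= -mulrN; congr (_ * _).
rewrite -!tens_hbasis (Lop_tens (q := fun s => par (c s))); last first.
  by move=> s; rewrite ffunE hbasis_mem.
rewrite linear_sum -sumrN; apply: eq_bigr => t _; rewrite linearZ /= !pairt_tens.
rewrite !(bigD1 t (P := xpredT)) //= /updf eqxx.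
have -> : \prod_(i < n | i != t) B (w i) (if i == t then S (hbasis (c t)) else hbasis (c i))
   = \prod_(i < n | i != t) B (w i) (hbasis (c i)).
  by apply: eq_bigr => i /negPf ->.
have -> : \prod_(i < n | i != t) B (if i == t then S (w t) else w i) (hbasis (c i))
   = \prod_(i < n | i != t) B (w i) (hbasis (c i)).
  by apply: eq_bigr => i /negPf ->.
have [->|nz] := eqVneq (\prod_(i < n | i != t) B (w i) (hbasis (c i))) 0.
  by rewrite !mulr0 oppr0.
have wm s : w s \in sv_part V (q s) by have := wq s; rewrite ffunE.
have qc s : s != t -> q s = par (c s).
  move=> st; apply: (form_parity (wm s) (hbasis_mem (c s)) (B := B)).
  by apply: contraNneq nz => E; rewrite (bigD1 s) //= E mul0r.
have -> : lop_sign (fun s => par (c s)) t = lop_sign q t.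
  rewrite /lop_sign; congr (_ && _); apply: eq_bigr => s ts; rewrite qc //.
  by apply: contraTneq ts => ->; rewrite ltnn.
rewrite (osp_skew (wm t) (hbasis_mem (c t))).
have [->|nz'] := eqVneq (B (S (w t)) (hbasis (c t))) 0.
  by rewrite mulr0 oppr0 mul0r !mulr0 oppr0.
rewrite -(form_parity (osp_mem (wm t)) (hbasis_mem (c t)) nz') signr_addb.
by rewrite mulNr mulrN !mulrA.
Qed.

End Infinitesimal.

(** * Matrix coefficients of the coaction and their derivatives *)

Section Coaction.
Variables (K : fieldType) (V : superVect K) (B : evenForm V) (O : OSpRep B).

Definition cmat n (a b : word V n) : O :=
  coact_sign a b *: \prod_(s < n) mcoef O (a s) (b s).

(** Equivariance on basis words, between different tensor powers so that it applies to cap and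
    cup. *)
Definition equiv i j (f : 'Hom(tpow V i, tpow V j)) : Prop :=
  forall a c, \sum_b coef f a b *: cmat b c = \sum_b coef f b c *: cmat a b.

Lemma coactE n (x : tpow V n) a : coact O x a = \sum_b x b *: cmat a b.
Proof. by rewrite ffunE; apply: eq_bigr => b _; rewrite scalerA. Qed.

Lemma coact_tbasis n (a c : word V n) : coact O (tbasis c) a = cmat a c.
Proof.
rewrite coactE (bigD1 c) //= ffunE eqxx scale1r big1 ?addr0 // => b bc.
by rewrite ffunE (negPf bc) scale0r.
Qed.

Lemma OSp_endP n (f : 'Hom(tpow V n, tpow V n)) : OSp_end O f <-> equiv f.
Proof.
split=> [H a c | H x].
  have /ffunP/(_ a) := H (tbasis c); rewrite ffunE coactE.
  by under eq_bigr do rewrite coact_tbasis.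
apply/ffunP => a; rewrite ffunE coactE; under eq_bigr do rewrite coactE scaler_sumr.
under [RHS]eq_bigr do rewrite hom_tpowE scaler_suml.
rewrite exchange_big [RHS]exchange_big /=; apply: eq_bigr => c _.
under eq_bigr do rewrite scalerA mulrC -scalerA.
under [RHS]eq_bigr do rewrite mulrC -scalerA.
by rewrite -!scaler_sumr H.
Qed.

Lemma OSp_formP n (f : 'Hom(tpow V n, K^o)) : OSp_form O f <->
  forall c, \sum_b f (tbasis b) *: cmat b c = f (tbasis c) *: (1 : O).
Proof.
split=> [H c | H x].
  by rewrite -H; apply: eq_bigr => b _; rewrite coact_tbasis.
under eq_bigr do rewrite coactE scaler_sumr.
rewrite exchange_big /= form_tpowE scaler_suml; apply: eq_bigr => c _.
rewrite -scalerA -H scaler_sumr; apply: eq_bigr => b _.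
by move: (cmat b c) => y; rewrite !scalerA; congr (_ *: _); apply: mulrC.
Qed.

Section Derivative.
Variables (e : bool) (S : V -> V) (eS : osp B e S).

(** By the universal property the point 1 + S eps comes from a morphism of O to the dual numbers,
    which sends the matrix of the coaction to 1 + eps [Lop]. Comparing eps-components then
    differentiates any identity over O. *)
Lemma cmat_inf : exists phi : {lrmorphism O -> dualSuper K e},
  forall n (a b : word V n),
    phi (cmat a b) = ((a == b)%:R, coef (Lop S n) a b) :> dual K.
Proof.
have [phi _ H] := os_exists O (inf_point eS).
have phiE i j : phi (mcoef O i j) = inf_coef S i j :> dual K.
  have /ffunP/(_ i) := H (ext_basis _ j); rewrite !ffunE.
  rewrite (bigD1 j) //= ffunE eqxx mulr1 big1 => [|k kj]; last first.
    by rewrite ffunE (negPf kj) mulr0.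
  rewrite addr0 => ->; rewrite /inf_coef; congr (_, _); first by case: (i == j).
  rewrite mul1r (bigD1 j) //= ffunE eqxx mulr1 big1 => [|k kj]; last first.
    by rewrite ffunE (negPf kj) mulr0.
  by case: (i == j); rewrite /= addr0 add0r.
exists phi => n a b; rewrite linearZ /= rmorph_prod /=.
rewrite (eq_bigr _ (fun s _ => phiE (a s) (b s))) coef_hom_of_coef.
congr (_, _); rewrite /= /GRing.scale /= dual_prod_fst /=.
have [->|ab] := eqVneq a b.
  rewrite big1 => [|s _]; last by rewrite eqxx.
  rewrite mulr1 /coact_sign big1 // => s _; rewrite big1 // => t _.
  by rewrite addbb.
have [s sn] : exists s, a s != b s.
  apply/existsP; apply: contraR ab => /existsPn E; apply/eqP/ffunP => s.
  by apply/eqP/negbNE/E.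
by rewrite (bigD1 s) //= (negPf sn) mul0r mulr0.
Qed.

Lemma equiv_Lop i j (f : 'Hom(tpow V i, tpow V j)) : equiv f ->
  forall x, f (Lop S i x) = Lop S j (f x).
Proof.
move=> fE x; have [phi phiE] := cmat_inf.
rewrite -!comp_lfunE; congr (fun_of_lfun _ x); apply: coef_eq => a c.
have := congr1 (fun y : O => (phi y : dual K).2) (fE a c).
rewrite /= !linear_sum !coef_comp.
under eq_bigr do rewrite linearZ /= phiE /=.
under [in X in _ = X -> _]eq_bigr do rewrite linearZ /= phiE /=.
by rewrite /GRing.scale /= => ->; apply: eq_bigr => b _; rewrite mulrC.
Qed.

Lemma form_Lop n (f : 'Hom(tpow V n, K^o)) : OSp_form O f ->
  forall x, f (Lop S n x) = 0.
Proof.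
move=> /OSp_formP fE x; have [phi phiE] := cmat_inf.
suff E c : f (Lop S n (tbasis c)) = 0.
  by rewrite [x]tpow_tbasis !linear_sum big1 // => c _; rewrite !linearZ /= E scaler0.
rewrite form_tpowE.
have := congr1 (fun y : O => (phi y : dual K).2) (fE c).
rewrite /= !linear_sum !linearZ rmorph1 /=.
under eq_bigr do rewrite linearZ /= phiE /=.
rewrite scaler0 => E; rewrite -[RHS]E.
by apply: eq_bigr => b _; rewrite mulrC.
Qed.

End Derivative.
End Coaction.

(** * Forms and homomorphisms as invariant multilinear functions *)

Section Tuples.
Variables (K : fieldType) (V : superVect K) (B : evenForm V).

Definition form_tuple n (f : 'Hom(tpow V n, K^o)) (w : {ffun 'I_n -> V}) : K :=
  f (tens w).

Lemma upd_updf n (w : {ffun 'I_n -> V}) t v : upd w t v =1 updf w t v.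
Proof. by move=> s; rewrite ffunE. Qed.

Lemma form_tuple_mlin n (f : 'Hom(tpow V n, K^o)) : mlin (form_tuple f).
Proof.
move=> w t c u v; rewrite /form_tuple.
rewrite (tens_lin (u := upd w t u) (v := upd w t v) (t := t) (c := c)).
- by rewrite linearP.
- by rewrite !upd_eq.
by move=> s st; rewrite !upd_neq.
Qed.

Lemma form_tuple_lie n (f : 'Hom(tpow V n, K^o)) :
  (forall e S, osp B e S -> forall x, f (Lop S n x) = 0) ->
  lie B (fun e => @lop_sign e n) (form_tuple f).
Proof.
move=> fL e S q w eS wq; rewrite -[RHS](fL e S eS (tens w)).
rewrite (Lop_tens eS (q := q)) ?linear_sum; last by move=> s; rewrite ffunE.
apply: eq_bigr => t _; rewrite linearZ; congr (_ * f _).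
exact/eq_tens/upd_updf.
Qed.

Variables i j : nat.
Implicit Types (f : 'Hom(tpow V i, tpow V j)).

Definition hom_tuple f (w : {ffun 'I_i + 'I_j -> V}) : K :=
  pairt B (fun s => w (inr s)) (f (tens (fun s => w (inl s)))).

Lemma hom_tuple_mlin f : mlin (hom_tuple f).
Proof.
move=> w t c u v; rewrite /hom_tuple; case: t => t.
  rewrite (tens_lin (u := fun s => upd w (inl t) u (inl s))
    (v := fun s => upd w (inl t) v (inl s)) (t := t) (c := c)).
  - rewrite linearP linearP; congr (_ * _ + _); apply: eq_pairt => s;
      by rewrite !ffunE.
  - by rewrite !upd_eq.
  by move=> s st; rewrite !upd_neq.
rewrite (pairt_lin _ (u := fun s => upd w (inr t) u (inr s))
    (v := fun s => upd w (inr t) v (inr s)) (t := t) (c := c)).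
- by congr (_ * pairt _ _ (f _) + pairt _ _ (f _)); apply: eq_tens => s; rewrite !ffunE.
- by rewrite !upd_eq.
by move=> s st; rewrite !upd_neq.
Qed.

(* On the upper ends S is transposed through B, whence the additional sign. *)
Definition hom_sign (e : bool) (q : ('I_i + 'I_j)%type -> bool)
    (t : ('I_i + 'I_j)%type) : bool :=
  match t with
  | inl t => lop_sign e (fun s => q (inl s)) t
  | inr t => lop_sign e (fun s => q (inr s)) t (+) (e && (q (inr t) (+) e))
  end.

Lemma hom_tuple_lie f :
  (forall e S, osp B e S -> forall x, f (Lop S i x) = Lop S j (f x)) ->
  lie B hom_sign (hom_tuple f).
Proof.
move=> fL e S q w eS wq; rewrite big_sumType /=.
have := fL e S eS (tens (fun s => w (inl s))).
rewrite (Lop_tens eS (q := fun s => q (inl s))); last first.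
  by move=> s; rewrite ffunE; apply: wq.
move=> /(congr1 (pairt B (fun s => w (inr s)))).
rewrite (pairt_Lop eS (q := fun s => q (inr s))); last first.
  by move=> s; rewrite ffunE; apply: wq.
rewrite !linear_sum => /eqP; rewrite -subr_eq0 opprK => /eqP E.
rewrite -[RHS]E; congr (_ + _); apply: eq_bigr => t _.
  rewrite !linearZ; congr (_ * _); rewrite /hom_tuple.
  rewrite (eq_pairt _ _ (w' := fun s => w (inr s))); last by move=> s; rewrite ffunE.
  congr (pairt _ _ (f _)); apply: eq_tens => s.
  by rewrite ffunE /updf.
congr (_ * _); rewrite /hom_tuple.
rewrite (eq_pairt _ _ (w' := updf (fun s => w (inr s)) t (S (w (inr t))))); last first.
  by move=> s; rewrite ffunE /updf.
by congr (pairt _ _ (f _)); apply: eq_tens => s; rewrite ffunE.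
Qed.

End Tuples.

(** * Equivariance of the generators *)

Section Generators.
Variables (K : fieldType) (V : superVect K) (B : evenForm V) (O : OSpRep B).

Lemma signr_scale (R : superAlg K) (b : bool) (x : R) :
  (-1) ^+ b * x = (-1) ^+ b *: x.
Proof. by case: b; rewrite ?scaleN1r ?mulN1r ?scale1r ?mul1r. Qed.

Lemma twist_homog (R : superAlg K) q b (x : R) : sa_proj R b x = x ->
  twist q x = (-1) ^+ (q && b) *: x.
Proof.
move=> xb; rewrite /twist signr_scale -xb !sa_projK.
by case: b xb => xb; rewrite !xb /= ?scaler0 ?addr0 ?add0r ?andbT ?andbF ?scale1r.
Qed.

Lemma mcoef_homog (i j : ix V) :
  sa_proj O (par i (+) par j) (mcoef O i j) = mcoef O i j.
Proof.
rewrite addbC; apply: (pt_even (os_univ_point O)) => k; rewrite ffunE.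
case: eqP => [->|_]; last by rewrite linear0.
by rewrite addbb sa_one.
Qed.

Lemma mcoef_comm (i j k l : ix V) : mcoef O i j * mcoef O k l
  = (-1) ^+ ((par i (+) par j) && (par k (+) par l)) *: (mcoef O k l * mcoef O i j).
Proof. by rewrite -signr_scale; apply: sa_comm; apply: mcoef_homog. Qed.

Lemma equiv_id n : equiv O (\1%VF : 'Hom(tpow V n, tpow V n)).
Proof.
move=> a c; rewrite (bigD1 a) //= coef_id eqxx scale1r big1 ?addr0 => [|b ba].
  rewrite (bigD1 c) //= coef_id eqxx scale1r big1 ?addr0 // => b bc.
  by rewrite coef_id (negPf bc) scale0r.
by rewrite coef_id eq_sym (negPf ba) scale0r.
Qed.

Lemma equiv_comp i j k (g : 'Hom(tpow V j, tpow V k))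
    (f : 'Hom(tpow V i, tpow V j)) :
  equiv O g -> equiv O f -> equiv O (g \o f)%VF.
Proof.
move=> gE fE a c; under eq_bigr do rewrite coef_comp scaler_suml.
under [RHS]eq_bigr do rewrite coef_comp scaler_suml.
rewrite exchange_big [RHS]exchange_big /=.
transitivity (\sum_d \sum_b (coef g a d * coef f b c) *: cmat O d b).
  apply: eq_bigr => d _; under eq_bigr do rewrite -scalerA.
  rewrite -scaler_sumr fE scaler_sumr; apply: eq_bigr => b _.
  by rewrite scalerA.
rewrite exchange_big; apply: eq_bigr => b _ /=.
under eq_bigr do rewrite mulrC -scalerA.
rewrite -scaler_sumr gE scaler_sumr; apply: eq_bigr => d _.
by rewrite scalerA mulrC.
Qed.

Lemma coef_sum i j (J : finType) (x : J -> K) (f : J -> 'Hom(tpow V i, tpow V j)) a b :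
  coef (\sum_k x k *: f k) a b = \sum_k x k * coef (f k) a b.
Proof.
rewrite /coef sum_lfunE sum_ffunE; apply: eq_bigr => k _.
by rewrite scale_lfunE ffunE.
Qed.

Lemma equiv_sum i j (J : finType) (x : J -> K) (f : J -> 'Hom(tpow V i, tpow V j)) :
  (forall k, equiv O (f k)) -> equiv O (\sum_k x k *: f k).
Proof.
move=> fE a c; under eq_bigr do rewrite coef_sum scaler_suml.
under [RHS]eq_bigr do rewrite coef_sum scaler_suml.
rewrite exchange_big [RHS]exchange_big /=; apply: eq_bigr => k _.
under eq_bigr do rewrite -scalerA; under [RHS]eq_bigr do rewrite -scalerA.
by rewrite -!scaler_sumr fE.
Qed.

(** The coefficients of the left block, of total parity |a| + |c|, pass the right word [a']. *)
Lemma cmat_wcat m n (a c : word V m) (a' c' : word V n) :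
  cmat O (wcat a a') (wcat c c')
  = (-1) ^+ ((wpar a (+) wpar c) && wpar a') *: (cmat O a c * cmat O a' c').
Proof.
have El (x : word V m) (y : word V n) s : wcat x y (lshift n s) = x s.
  by rewrite -[in RHS](wcatl x y) [RHS]ffunE.
have Er (x : word V m) (y : word V n) s : wcat x y (rshift m s) = y s.
  by rewrite -[in RHS](wcatr x y) [RHS]ffunE.
have E : coact_sign (wcat a a') (wcat c c') = coact_sign a c * coact_sign a' c'
    * (-1) ^+ ((wpar a (+) wpar c) && wpar a').
  have -> : (-1) ^+ ((wpar a (+) wpar c) && wpar a')
      = \prod_(s < m) \prod_(t < n) (-1 : K) ^+ ((par (a s) (+) par (c s)) && par (a' t)).
    rewrite /wpar -[X in X && _]big_split /= big_distrl /=.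
    rewrite (big_morph (fun b : bool => (-1 : K) ^+ b) (signr_addb _) (erefl _)).
    apply: eq_bigr => s _; rewrite big_distrr /=.
    by rewrite (big_morph (fun b : bool => (-1 : K) ^+ b) (signr_addb _) (erefl _)).
  rewrite mulrAC /coact_sign big_split_ord /= -big_split /=.
  congr (_ * _); apply: eq_bigr => s _; rewrite [LHS]big_mkcond big_split_ord /=.
    rewrite [in RHS]big_mkcond; congr (_ * _); apply: eq_bigr => t _; rewrite !El ?Er //.
    by rewrite ltn_addr.
  rewrite big1 ?mul1r => [|t _]; last first.
    by rewrite ltnNge (leq_trans (ltnW (ltn_ord t))) ?leq_addr.
  rewrite [RHS]big_mkcond; apply: eq_bigr => t _.
  by rewrite !Er ltn_add2l.
rewrite /cmat E -scalerAl -scalerAr !scalerA; congr (_ *: _).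
  by rewrite mulrC mulrA.
by rewrite big_split_ord /=; congr (_ * _); apply: eq_bigr => s _; rewrite ?El ?Er.
Qed.

(** Evenness of [f] and [g] makes the sign of [cmat_wcat] the same for all contributing words, so it
    factors out. *)
Lemma equiv_tens i j i' j' (f : 'Hom(tpow V i, tpow V j))
    (g : 'Hom(tpow V i', tpow V j')) : even_hom f -> even_hom g ->
  equiv O f -> equiv O g -> equiv O (tens_hom f g).
Proof.
move=> fe ge fE gE a c; rewrite -(wcatK a) -(wcatK c).
move: (wleft a) (wright a) (wleft c) (wright c) => {a c} a a' c c'.
rewrite !sum_wcat.
pose s : K := (-1) ^+ ((wpar a (+) wpar c) && wpar a').
transitivity (s *: ((\sum_b coef f a b *: cmat O b c)
                    * (\sum_b coef g a' b *: cmat O b c'))).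
  rewrite big_distrlr scaler_sumr /=; apply: eq_bigr => b _.
  rewrite scaler_sumr; apply: eq_bigr => b' _; rewrite coef_tens_hom cmat_wcat.
  have [ab|ab] := eqVneq (wpar a) (wpar b); last by rewrite (fe _ _ ab) !(mul0r, scale0r, scaler0).
  have [ab'|ab'] := eqVneq (wpar a') (wpar b').
    rewrite -ab -ab' -/s; move: (cmat O b c) (cmat O b' c') => X Y.
    by rewrite -scalerAl -scalerAr !scalerA; congr (_ *: _); ring.
  by rewrite (ge _ _ ab') !(mulr0, mul0r, scale0r, scaler0).
rewrite fE gE big_distrlr scaler_sumr /=; apply: eq_bigr => b _.
rewrite scaler_sumr; apply: eq_bigr => b' _; rewrite coef_tens_hom cmat_wcat.
have [ab|ab] := eqVneq (wpar b) (wpar c); last by rewrite (fe _ _ ab) !(mul0r, scale0r, scaler0).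
rewrite /s ab; move: (cmat O a b) (cmat O a' b') => X Y.
by rewrite -scalerAl -scalerAr !scalerA; congr (_ *: _); ring.
Qed.

Lemma word0E (a b : word V 0) : a = b.
Proof. by apply/ffunP => -[]. Qed.

Lemma word2E (a : word V 2) : a = word2 (a ord0) (a ord_max).
Proof.
apply/ffunP => s; rewrite ffunE; case: eqP => [->//|/eqP]; case: s => [[|[|]]] // h _.
by congr (a _); apply: val_inj.
Qed.

Lemma word2_0 (x y : ix V) : word2 x y ord0 = x.
Proof. by rewrite ffunE. Qed.
Lemma word2_1 (x y : ix V) : word2 x y ord_max = y.
Proof. by rewrite ffunE. Qed.

Lemma sum_word2 (A : nmodType) (G : word V 2 -> A) :
  \sum_a G a = \sum_x \sum_y G (word2 x y).
Proof.
rewrite pair_big /= (reindex (fun p => word2 p.1 p.2)) //=.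
exists (fun a => (a ord0, a ord_max)) => [[x y] _|a _] /=.
  by rewrite word2_0 word2_1.
by rewrite -word2E.
Qed.

Lemma sum_word0 (A : nmodType) (G : word V 0 -> A) a : \sum_b G b = G a.
Proof. by rewrite (big_pred1 a) // => b; rewrite /= (word0E b a) eqxx. Qed.

Lemma cmat0 (a b : word V 0) : cmat O a b = 1.
Proof. by rewrite /cmat /coact_sign !big_ord0 scale1r. Qed.

Lemma cmat2 (x y z t : ix V) : cmat O (word2 x y) (word2 z t)
  = (-1) ^+ ((par x (+) par z) && par y) *: (mcoef O x z * mcoef O y t).
Proof.
have e1 : lift ord0 ord0 = ord_max :> 'I_2 by apply: val_inj.
rewrite /cmat /coact_sign !big_ord_recl !big_ord0 e1 !word2_0 !word2_1 mulr1.
rewrite mulr1 (big_pred1 ord_max) => [|s]; last by case: s => [[|[|]]].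
rewrite big_pred0 => [|s]; last by case: s => [[|[|]]].
by rewrite mulr1 word2_1.
Qed.

Lemma equiv_braiding : equiv O (braiding V).
Proof.
move=> a c; rewrite (word2E a) (word2E c).
move: (a ord0) (a ord_max) (c ord0) (c ord_max) => {a c} x y z t.
rewrite (bigD1 (word2 y x)) //= big1 ?addr0 => [|b]; last first.
  rewrite coef_hom_of_coef /= => bn; case: eqP => [E|]; last by rewrite mulr0 scale0r.
  case/eqP: bn; rewrite (word2E b); congr word2.
    by rewrite -[RHS](word2_1 x) E word2_1.
  by rewrite -(word2_0 x y) E word2_0.
rewrite (bigD1 (word2 t z)) //= big1 ?addr0 => [|b]; last first.
  rewrite coef_hom_of_coef /= !word2_0 !word2_1 => /negPf ->.
  by rewrite mulr0 scale0r.
rewrite !coef_hom_of_coef /= !word2_0 !word2_1 !eqxx !mulr1 !cmat2 !scalerA.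
rewrite [mcoef O y z * _]mcoef_comm scalerA; congr (_ *: _).
by case: (par x) (par y) (par z) (par t) => [] [] [] []; rewrite /=; ring.
Qed.

(** The universal point preserves the form; [twist] accounts for the sign. *)
Lemma form_mcoef (x y : ix V) :
  \sum_i \sum_j (B (hbasis i) (hbasis j) * (-1) ^+ ((par i (+) par x) && par j))
      *: (mcoef O i x * mcoef O j y) = B (hbasis x) (hbasis y) *: (1 : O).
Proof.
have := pt_form (os_univ_point O) (ext_basis O x) (ext_basis O y).
rewrite /ext_form => E.
transitivity (\sum_i \sum_j B (hbasis i) (hbasis j) *:
    (twist (par j) (os_univ (ext_basis O x) i) * os_univ (ext_basis O y) j)).
  apply: eq_bigr => i _; apply: eq_bigr => j _.
  by rewrite (twist_homog _ (mcoef_homog i x)) -scalerAl scalerA andbC.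
rewrite E (bigD1 x) //= [X in _ + X]big1 ?addr0 => [|i ix_]; last first.
  apply: big1 => j _; rewrite ffunE (negPf ix_) (twist_homog _ (b := false)) ?linear0 //.
  by rewrite ?scaler0 mul0r scaler0.
rewrite (bigD1 y) //= [X in _ + X]big1 ?addr0 => [|j jy]; last first.
  by rewrite [in X in _ * X]ffunE (negPf jy) mulr0 scaler0.
rewrite !ffunE !eqxx (twist_homog _ (b := false)) ?sa_one //.
by rewrite andbF scale1r mulr1.
Qed.

Lemma equiv_cap (f : 'Hom(tpow V 2, tpow V 0)) :
  (forall a x y, coef f a (word2 x y) = B (hbasis x) (hbasis y)) -> equiv O f.
Proof.
move=> fE a c; rewrite (word2E c) sum_word2 (sum_word0 _ a) cmat0 fE -form_mcoef.
by apply: eq_bigr => i _; apply: eq_bigr => j _; rewrite fE cmat2 scalerA.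
Qed.

(* Over the noncommutative ring O a left inverse need not be a right inverse;
   this one comes from the bijectivity of the universal point. *)
Lemma mcoef_rinv : exists w : ix V -> ix V -> O,
  forall i j, \sum_k mcoef O i k * w k j = (i == j)%:R.
Proof.
have [gi _ gK] := pt_bij (os_univ_point O).
exists (fun k j => gi (ext_basis O j) k) => i j.
have gD := pt_add (os_univ_point O).
have g0 : os_univ (0 : ext V O) = 0.
  by apply: (@addrI _ (os_univ (0 : ext V O))); rewrite -gD !addr0.
have gE x : os_univ x = \sum_k ext_rmul (os_univ (ext_basis O k)) (x k) :> ext V O.
  rewrite {1}(_ : x = \sum_k ext_rmul (ext_basis O k) (x k)).
    rewrite (big_morph (@os_univ _ _ _ O) gD g0); apply: eq_bigr => k _.
    exact: (pt_rmul (os_univ_point O)).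
  apply/ffunP => l; rewrite sum_ffunE (bigD1 l) //= big1 => [|k kl].
    by rewrite !ffunE eqxx mul1r addr0.
  by rewrite !ffunE eq_sym (negPf kl) mul0r.
have /ffunP/(_ i) := gK (ext_basis O j); rewrite gE sum_ffunE ffunE => <-.
by apply: eq_bigr => k _; rewrite ffunE.
Qed.

(** A one-sided inverse of the Gram matrix is two-sided: the vector with the entries [d] of the
    defect as coordinates is orthogonal to V. Its homogeneity allows the two arguments of the form
    to be exchanged. *)
Lemma copairing_inv (C : ix V -> ix V -> K) :
  (forall z y, par z != par y -> C z y = 0) ->
  (forall x y, \sum_z B (hbasis x) (hbasis z) * C z y = (x == y)%:R) ->
  forall z y, \sum_x C z x * B (hbasis x) (hbasis y) = (z == y)%:R.
Proof.
move=> Cp BC z y; pose d k := \sum_x C k x * B (hbasis x) (hbasis y) - (k == y)%:R.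
suff v0 : \sum_k d k *: hbasis k = 0.
  have := congr1 (crd z) v0; rewrite linear0 linear_sum (bigD1 z) //= big1 => [|k kz].
    by rewrite linearZ /= crd_hbasis eqxx mulr1 addr0 => /eqP; rewrite subr_eq0 => /eqP.
  by rewrite linearZ /= crd_hbasis eq_sym (negPf kz) mulr0.
have dp k : par k != par y -> d k = 0.
  move=> ky; rewrite /d big1 ?sub0r => [|x _].
    by case: (eqVneq k y) ky => [->|_ _]; rewrite ?eqxx // oppr0.
  have [kx|kx] := eqVneq (par k) (par x); last by rewrite Cp // mul0r.
  rewrite (ef_even B (hbasis_mem x) (hbasis_mem y)) ?mulr0 // -kx.
  by case: (par k) (par y) ky => [] [].
have vy : \sum_k d k *: hbasis k \in sv_part V (par y).
  apply: rpred_sum => k _; have [<-|ky] := eqVneq (par k) (par y).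
    by rewrite rpredZ ?hbasis_mem.
  by rewrite dp // scale0r mem0v.
apply: (homog_nondeg (B := B) vy) => w wy; apply/eqP.
rewrite (form_eq0C B vy wy) [w]crd_sum linear_sumlz big1 //= => x _.
rewrite formZl linear_sum /= (eq_bigr (fun k => B (hbasis x) (hbasis k) * d k)).
  under eq_bigr do rewrite mulrBr mulr_sumr; rewrite sumrB exchange_big /=.
  rewrite (eq_bigr (fun l => (x == l)%:R * B (hbasis l) (hbasis y))) => [|l _].
    rewrite (bigD1 x) //= eqxx mul1r big1 ?addr0 => [|l lx].
      rewrite (bigD1 y) //= eqxx mulr1 big1 ?addr0 ?subrr ?mulr0 // => k /negPf ->.
      by rewrite mulr0.
    by rewrite eq_sym (negPf lx) mul0r.
  by rewrite -BC mulr_suml; apply: eq_bigr => k _; rewrite mulrA.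
by move=> k _; rewrite formZr mulrC.
Qed.

(** Let U be the matrix of the universal point. Invariance of the form says that [A], a signed
    transpose of U times the Gram matrix, satisfies A U = Gram matrix. Hence M = C A is a left
    inverse of U, equal to the right inverse of [mcoef_rinv], and U M = 1 is the invariance of the
    copairing C. *)
Lemma equiv_cup (f : 'Hom(tpow V 0, tpow V 2)) : even_hom f ->
  (forall b x y, \sum_z B (hbasis x) (hbasis z) * coef f (word2 z y) b
     = (x == y)%:R) -> equiv O f.
Proof.
move=> fe BC a c; pose C z y := coef f (word2 z y) c.
have wp2 (x y : ix V) : wpar (word2 x y) = par x (+) par y.
  by rewrite /wpar !big_ord_recl big_ord0 addbF word2_0 ffunE.
have Cp z y : par z != par y -> C z y = 0.
  move=> zy; apply: fe; rewrite wp2 /wpar big_ord0.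
  by case: (par z) (par y) zy => [] [].
have CB := copairing_inv Cp (BC c); have [w uw] := mcoef_rinv.
pose A x j : O := \sum_i (B (hbasis i) (hbasis j)
  * (-1) ^+ ((par i (+) par x) && par j)) *: mcoef O i x.
have AU x y : \sum_j A x j * mcoef O j y = B (hbasis x) (hbasis y) *: (1 : O).
  rewrite -form_mcoef exchange_big /=; apply: eq_bigr => j _.
  by rewrite mulr_suml; apply: eq_bigr => i _; rewrite scalerAl.
pose M z j := \sum_x C z x *: A x j.
have MU z y : \sum_j M z j * mcoef O j y = (z == y)%:R.
  transitivity (\sum_x C z x *: \sum_j A x j * mcoef O j y).
    under [RHS]eq_bigr do rewrite scaler_sumr.
    rewrite [RHS]exchange_big; apply: eq_bigr => j _ /=.
    by rewrite mulr_suml; apply: eq_bigr => x _; rewrite scalerAl.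
  under eq_bigr do rewrite AU scalerA.
  by rewrite -scaler_suml CB; case: eqP; rewrite ?scale1r ?scale0r.
have Mw z j : M z j = w z j.
  transitivity (\sum_k \sum_y M z k * (mcoef O k y * w y j)).
    under eq_bigr do rewrite -mulr_sumr uw.
    rewrite (bigD1 j) //= eqxx mulr1 big1 ?addr0 // => k /negPf ->.
    by rewrite mulr0.
  rewrite exchange_big /= (bigD1 z) //= [X in _ + X]big1 ?addr0 => [|y yz].
    by under eq_bigr do rewrite mulrA; rewrite -mulr_suml MU eqxx mul1r.
  by under eq_bigr do rewrite mulrA; rewrite -mulr_suml MU eq_sym (negPf yz) mul0r.
(* Contracting [A] with C undoes the Gram matrix and gives back the transpose of U. *)
have CA x y : \sum_j C j y *: A x j
    = (-1) ^+ ((par y (+) par x) && par y) *: mcoef O y x.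
  transitivity (\sum_i ((i == y)%:R * (-1) ^+ ((par y (+) par x) && par y)) *: mcoef O i x).
    under eq_bigr do rewrite scaler_sumr; rewrite exchange_big /=.
    apply: eq_bigr => i _; under eq_bigr do rewrite scalerA.
    rewrite -scaler_suml; congr (_ *: _); rewrite -(BC c) mulr_suml.
    apply: eq_bigr => j _; rewrite -/(C j y).
    have [jy|jy] := eqVneq (par j) (par y); last by rewrite Cp // !(mulr0, mul0r).
    have [ij|ij] := eqVneq (par i) (par j).
      by rewrite ij jy mulrCA mulrA.
    rewrite (ef_even B (hbasis_mem i) (hbasis_mem j)) ?(mulr0, mul0r) //.
    by case: (par i) (par j) ij => [] [].
  rewrite (bigD1 y) //= eqxx mul1r big1 ?addr0 // => i /negPf ->.
  by rewrite mul0r scale0r.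
rewrite (word2E a); move: (a ord0) (a ord_max) => {a} x y.
(* U M = 1 multiplied by C. *)
have E : \sum_z \sum_t (C z t * (-1) ^+ ((par y (+) par t) && par y))
    *: (mcoef O x z * mcoef O y t) = C x y *: (1 : O).
  transitivity (\sum_j C j y *: \sum_z mcoef O x z * w z j); last first.
    under eq_bigr do rewrite uw.
    rewrite (bigD1 x) //= eqxx big1 ?addr0 // => j jx.
    by rewrite eq_sym (negPf jx) scaler0.
  under [RHS]eq_bigr do rewrite scaler_sumr; rewrite [RHS]exchange_big /=.
  apply: eq_bigr => z _.
  transitivity (mcoef O x z * \sum_j C j y *: M z j); last first.
    by rewrite mulr_sumr; apply: eq_bigr => j _; rewrite Mw scalerAr.
  transitivity (mcoef O x z * \sum_t C z t *: \sum_j C j y *: A t j).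
    rewrite mulr_sumr; apply: eq_bigr => t _.
    by rewrite CA scalerA -scalerAr.
  congr (_ * _); under eq_bigr do rewrite scaler_sumr; rewrite exchange_big /=.
  apply: eq_bigr => j _; rewrite scaler_sumr; apply: eq_bigr => t _.
  by rewrite !scalerA mulrC.
rewrite (sum_word0 _ c) cmat0 -/(C x y) sum_word2.
have -> : C x y = (-1) ^+ ((par x (+) par y) && par y) * C x y.
  have [xy|/Cp->] := eqVneq (par x) (par y); last by rewrite mulr0.
  by rewrite xy addbb mul1r.
rewrite -scalerA -E scaler_sumr; apply: eq_bigr => z _; rewrite scaler_sumr.
apply: eq_bigr => t _; rewrite cmat2 -/(C z t) !scalerA; congr (_ *: _).
have [zt|/Cp->] := eqVneq (par z) (par t); last by rewrite !(mul0r, mulr0).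
rewrite mulrCA; congr (_ * _); rewrite zt.
by case: (par x) (par y) (par t) => [] [] [] /=; ring.
Qed.

End Generators.

(** * Generation of the Brauer diagrams *)

Section Diagrams.

Lemma diagram_eq i j (D E : diagram i j) : partner D =1 partner E -> D = E.
Proof. by move=> DE; apply/val_inj/ffunP. Qed.

Lemma partner_mk i j f fx ff x : partner (@mk_diagram i j f fx ff) x = f x.
Proof. exact: ffunE. Qed.

Lemma ptl_ptr i j i' j' x y : @ptl i j i' j' x != @ptr i j i' j' y.
Proof.
case: x y => a [b|b] //; apply/eqP => -[E]; have := ltn_ord a;
  by rewrite E ltnNge leq_addr.
Qed.

Lemma dtens_split i j i' j' (D : diagram (i + i') (j + j')) (E : diagram i j) :
  (forall x, partner D (ptl i' j' x) = ptl i' j' (partner E x)) ->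
  exists D' : diagram i' j', D = dtens E D'.
Proof.
move=> DE.
have /fin_all_exists[f fE] y : exists z, partner D (ptr i j y) = ptr i j z.
  have [] := ptlr_cases (partner D (ptr i j y)) => // -[x E1].
  have := ptl_ptr (partner E x) y; rewrite -DE -E1 partnerK eqxx //.
have fn y : f y != y by rewrite -(inj_eq (@ptr_inj i j i' j')) -fE partner_neq.
have fK : involutive f.
  by move=> y; apply: (@ptr_inj i j i' j'); rewrite -!fE partnerK.
exists (mk_diagram fn fK); apply: diagram_eq => x; rewrite partner_mk.
case: (ptlr_cases x) => -[y ->]; first by rewrite dtens_ptl DE.
by rewrite dtens_ptr partner_mk.
Qed.

Definition tw k l : diagram (k + 2 + l) (k + 2 + l) :=
  dtens (dtens (did k) dcross) (did l).

Definition sw k l (a : 'I_(k + 2 + l)) : 'I_(k + 2 + l) :=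
  match split a with
  | inl c => lshift l
      match split c with inl d => lshift 2 d | inr d => rshift k (rev_ord d) end
  | inr c => rshift (k + 2) c
  end.

Lemma tw_inl k l a : partner (tw k l) (inl a) = inr (sw a).
Proof.
rewrite partner_mk /sw /=; case: (split a) => c; rewrite partner_mk //=.
by case: (split c) => d; rewrite partner_mk.
Qed.

Lemma tw_inr k l a : partner (tw k l) (inr a) = inl (sw a).
Proof.
rewrite partner_mk /sw /=; case: (split a) => c; rewrite partner_mk //=.
by case: (split c) => d; rewrite partner_mk.
Qed.

Lemma swK k l : involutive (@sw k l).
Proof. by move=> a; have := partnerK (tw k l) (inl a); rewrite tw_inl tw_inr => -[]. Qed.

Lemma val_sw k l (a : 'I_(k + 2 + l)) : val (sw a) =
  if val a == k then k.+1 else if val a == k.+1 then k else val a.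
Proof.
rewrite /sw; case: splitP => c ac /=; last first.
  by rewrite ac; (case: eqP => ?; last case: eqP => ?); lia.
rewrite ac; case: splitP => d cd /=; rewrite cd.
  by have := ltn_ord d; (case: eqP => ?; last case: eqP => ?); lia.
by have := ltn_ord d; (case: eqP => ?; last case: eqP => ?); lia.
Qed.

Definition lowmap n j (s : 'I_n -> 'I_n) (x : ('I_n + 'I_j)%type) : ('I_n + 'I_j)%type :=
  match x with inl a => inl (s a) | inr b => inr b end.
Definition upmap i n (s : 'I_n -> 'I_n) (x : ('I_i + 'I_n)%type) : ('I_i + 'I_n)%type :=
  match x with inl a => inl a | inr b => inr (s b) end.

Lemma lowmapK n j s : involutive s -> involutive (@lowmap n j s).
Proof. by move=> sK [a|b] /=; rewrite ?sK. Qed.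
Lemma upmapK i n s : involutive s -> involutive (@upmap i n s).
Proof. by move=> sK [a|b] /=; rewrite ?sK. Qed.

Lemma loops0 i j k (E : diagram j k) (D : diagram i j) :
  (forall b : 'I_j, exists2 y, outer y & connect (glue E D) (inl (inr b)) y) ->
  loops E D = 0%N.
Proof.
move=> H; apply: eq_card0 => x; rewrite !inE; apply/negbTE/negP.
case/andP=> _ /forallP xo.
have [y yo xy] : exists2 y, outer y & connect (glue E D) x y.
  case: x xo => [[a|b]|c] xo.
  - by exists (inl (inl a)).
  - exact: H.
  - by exists (inr c).
by have /implyP/(_ xy) := xo y; rewrite yo.
Qed.

Lemma glue_low i j k (E : diagram j k) (D : diagram i j) x :
  connect (glue E D) (inl x) (inl (partner D x)).
Proof. by apply: connect1; apply/orP; left. Qed.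
Lemma glue_up i j k (E : diagram j k) (D : diagram i j) x :
  connect (glue E D) (emb_up i x) (emb_up i (partner E x)).
Proof. by apply: connect1; apply/orP; right; rewrite up_arc_emb. Qed.

Lemma dcompE i j k (E : diagram j k) (D : diagram i j) x y : y != x ->
  connect (glue E D) (emb_out j x) (emb_out j y) -> partner (dcomp E D) x = y.
Proof. by rewrite partner_mk; case: (dcomp_funP E D x) => _ _ U yx /U ->. Qed.

Section Relabel.
Variables (n : nat) (s : 'I_n -> 'I_n) (T : diagram n n).
Hypotheses (Tl : forall a, partner T (inl a) = inr (s a)).
Hypotheses (Tr : forall a, partner T (inr a) = inl (s a)).

Lemma relabelK : involutive s.
Proof. by move=> a; have := partnerK T (inl a); rewrite Tl Tr => -[]. Qed.

(** The path in the stacked picture crosses [T], follows one arc of [D] and, if it ends below,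
    crosses [T] back. *)
Lemma dcomp_low j (D : diagram n j) x :
  partner (dcomp D T) x = lowmap s (partner D (lowmap s x)).
Proof.
apply: dcompE.
  rewrite -(inj_eq (inv_inj (lowmapK relabelK))) (lowmapK relabelK).
  exact: partner_neq.
have H y : connect (glue D T) (emb_out n y) (emb_up n (lowmap s y)).
  by case: y => [a|c] //=; rewrite -Tl; apply: glue_low.
have H' y : connect (glue D T) (emb_up n y) (emb_out n (lowmap s y)).
  by case: y => [a|c] //=; rewrite -Tr; apply: glue_low.
exact: connect_trans (H x) (connect_trans (glue_up _ _ _) (H' _)).
Qed.

Lemma loops_low j (D : diagram n j) : loops D T = 0%N.
Proof.
apply: loops0 => b; exists (inl (inl (s b))) => //.
by rewrite -Tr; apply: glue_low.
Qed.

Lemma dcomp_up i (D : diagram i n) x :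
  partner (dcomp T D) x = upmap s (partner D (upmap s x)).
Proof.
apply: dcompE.
  rewrite -(inj_eq (inv_inj (upmapK relabelK))) (upmapK relabelK).
  exact: partner_neq.
have H y : connect (glue T D) (emb_out n y) (inl (upmap s y)).
  by case: y => [a|c] //=; have := glue_up T D (inr c); rewrite Tr.
have H' y : connect (glue T D) (inl y) (emb_out n (upmap s y)).
  by case: y => [a|c] //=; have := glue_up T D (inl c); rewrite Tl.
exact: connect_trans (H x) (connect_trans (glue_low _ _ _) (H' _)).
Qed.

Lemma loops_up i (D : diagram i n) : loops T D = 0%N.
Proof.
apply: loops0 => b; exists (inr (s b)) => //.
by have := glue_up T D (inl b); rewrite Tl.
Qed.

End Relabel.

Section Induction.
Variable P : forall i j, diagram i j -> Prop.
Hypothesis P0 : P (did 0).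
Hypothesis Pid : forall i j (D : diagram i j), P D -> P (dtens (did 1) D).
Hypothesis Pcap : forall i j (D : diagram i j), P D -> P (dtens dcap D).
Hypothesis Pcup : forall i j (D : diagram i j), P D -> P (dtens dcup D).
Hypothesis Plow : forall k l j (D : diagram (k + 2 + l) j),
  P D -> P (dcomp D (tw k l)).
Hypothesis Pup : forall i k l (D : diagram i (k + 2 + l)),
  P D -> P (dcomp (tw k l) D).

(** Hides the transport from [n] to the shape [k + 2 + l] required by [tw]. As the transposition is
    an involution, [D] is recovered from [D'] by composing once more. *)
Lemma swap_low n j k (D : diagram n j) : (k.+1 < n)%N ->
  exists s : 'I_n -> 'I_n, exists D' : diagram n j,
  [/\ forall a, val (s a) = if val a == k then k.+1 else
        if val a == k.+1 then k else val a,
      forall x, partner D' x = lowmap s (partner D (lowmap s x)) & P D' -> P D].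
Proof.
move=> kn; have [l nE] : exists l, n = (k + 2 + l)%N.
  by exists (n - k.+2)%N; rewrite addn2 subnKC.
subst n; exists (@sw k l), (dcomp D (tw k l)); split; first exact: val_sw.
  by apply: dcomp_low; [apply: tw_inl|apply: tw_inr].
have {2}-> : D = dcomp (dcomp D (tw k l)) (tw k l); last exact: Plow.
have Tl := @tw_inl k l; have Tr := @tw_inr k l.
apply: diagram_eq => x; rewrite !(dcomp_low Tl Tr).
by rewrite !(lowmapK (@swK k l)).
Qed.

Lemma swap_up i n k (D : diagram i n) : (k.+1 < n)%N ->
  exists s : 'I_n -> 'I_n, exists D' : diagram i n,
  [/\ forall a, val (s a) = if val a == k then k.+1 else
        if val a == k.+1 then k else val a,
      forall x, partner D' x = upmap s (partner D (upmap s x)) & P D' -> P D].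
Proof.
move=> kn; have [l nE] : exists l, n = (k + 2 + l)%N.
  by exists (n - k.+2)%N; rewrite addn2 subnKC.
subst n; exists (@sw k l), (dcomp (tw k l) D); split; first exact: val_sw.
  by apply: dcomp_up; [apply: tw_inl|apply: tw_inr].
have {2}-> : D = dcomp (tw k l) (dcomp (tw k l) D); last exact: Pup.
have Tl := @tw_inl k l; have Tr := @tw_inr k l.
apply: diagram_eq => x; rewrite !(dcomp_up Tl Tr).
by rewrite !(upmapK (@swK k l)).
Qed.

(** Transpositions of neighbours at positions 1 and above bring the other end of the arc of 0 down
    to 1 and keep 0 fixed. *)
Lemma move_low i j m (D : diagram i.+1 j) y :
  partner D (inl ord0) = inl y -> val y = m.+1 ->
  (forall (E : diagram i.+1 j) z, partner E (inl ord0) = inl z ->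
    val z = 1%N -> P E) -> P D.
Proof.
elim: m D y => [|m IH] D y Dy ym H; first exact: H Dy ym.
have [|s [D' [sE D'E PD]]] := @swap_low i.+1 j m.+1 D; first by rewrite -ym ltn_ord.
apply/PD/(IH D' (s y)) => //; last first.
  by rewrite sE ym; (case: eqP => ?; last case: eqP => ?); lia.
have s0 : s ord0 = ord0 by apply: val_inj; rewrite sE.
by rewrite D'E /= s0 Dy.
Qed.

Lemma move_through i n m (D : diagram i.+1 n) y :
  partner D (inl ord0) = inr y -> val y = m ->
  (forall (E : diagram i.+1 n) z, partner E (inl ord0) = inr z ->
    val z = 0%N -> P E) -> P D.
Proof.
elim: m D y => [|m IH] D y Dy ym H; first exact: H Dy ym.
have [|s [D' [sE D'E PD]]] := @swap_up i.+1 n m D; first by rewrite -ym ltn_ord.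
apply/PD/(IH D' (s y)) => //; last first.
  by rewrite sE ym; (case: eqP => ?; last case: eqP => ?); lia.
by rewrite D'E /= Dy.
Qed.

Lemma move_up j m (D : diagram 0 j.+1) y :
  partner D (inr ord0) = inr y -> val y = m.+1 ->
  (forall (E : diagram 0 j.+1) z, partner E (inr ord0) = inr z ->
    val z = 1%N -> P E) -> P D.
Proof.
elim: m D y => [|m IH] D y Dy ym H; first exact: H Dy ym.
have [|s [D' [sE D'E PD]]] := @swap_up 0 j.+1 m.+1 D; first by rewrite -ym ltn_ord.
apply/PD/(IH D' (s y)) => //; last first.
  by rewrite sE ym; (case: eqP => ?; last case: eqP => ?); lia.
have s0 : s ord0 = ord0 by apply: val_inj; rewrite sE.
by rewrite D'E /= s0 Dy.
Qed.

(** Induction on the number of points. The arc at the first lower point, or at the first upper one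
    if there is no lower point, is straightened by transpositions until a cap, a cup or a vertical
    strand splits off on the left. *)
Lemma diagram_induction i j (D : diagram i j) : P D.
Proof.
have [n] := ubnP (i + j); elim: n i j D => // n IH i j D; rewrite ltnS => ijn.
case: i D ijn => [|i] D ijn.
  case: j D ijn => [|j] D ijn.
    by have -> : D = did 0 by apply: diagram_eq => -[[]|[]].
  case E0 : (partner D (inr ord0)) => [[]//|y].
  have ym : val y = (val y).-1.+1.
    rewrite prednK // lt0n; apply/eqP => yE; have := partner_neq D (inr ord0).
    by rewrite E0 (_ : y = ord0) ?eqxx //; apply: val_inj.
  apply: (move_up E0 ym) => {D E0 y ym} D y E0 y1.
  case: j D y ijn E0 y1 => [|j] D y ijn E0 y1; first by case: y y1 {E0} => [[|]].
  have [D' ->] : exists D' : diagram 0 j, D = dtens dcup D' :> diagram (0 + 0) (2 + j).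
    apply: dtens_split => -[[]//|a]; rewrite partner_mk /=.
    have y2 : y = lshift j (rev_ord ord0 : 'I_2) by apply: val_inj.
    case: a => [[|[|//]] h] /=.
      rewrite (_ : @lshift 2 j _ = ord0 :> 'I_j.+2) ?E0; last exact: val_inj.
      by congr inr; rewrite y2; apply: val_inj.
    rewrite (_ : @lshift 2 j _ = y :> 'I_j.+2) -?E0 ?partnerK; last by rewrite y2; apply: val_inj.
    by congr inr; apply: val_inj.
  by apply/Pcup/IH; lia.
case E0 : (partner D (inl ord0)) => [y|y].
  have ym : val y = (val y).-1.+1.
    rewrite prednK // lt0n; apply/eqP => yE; have := partner_neq D (inl ord0).
    by rewrite E0 (_ : y = ord0) ?eqxx //; apply: val_inj.
  apply: (move_low E0 ym) => {D E0 y ym} D y E0 y1.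
  case: i D y ijn E0 y1 => [|i] D y ijn E0 y1; first by case: y y1 {E0} => [[|]].
  have [D' ->] : exists D' : diagram i j, D = dtens dcap D' :> diagram (2 + i) (0 + j).
    apply: dtens_split => -[a|[]//]; rewrite partner_mk /=.
    have y2 : y = lshift i (rev_ord ord0 : 'I_2) by apply: val_inj.
    case: a => [[|[|//]] h] /=.
      rewrite (_ : @lshift 2 i _ = ord0 :> 'I_i.+2) ?E0; last exact: val_inj.
      by congr inl; rewrite y2; apply: val_inj.
    rewrite (_ : @lshift 2 i _ = y :> 'I_i.+2) -?E0 ?partnerK; last by rewrite y2; apply: val_inj.
    by congr inl; apply: val_inj.
  by apply/Pcap/IH; lia.
apply: (move_through E0 erefl) => {D E0 y} D y E0 y0.
case: j D y ijn E0 y0 => [|j] D y ijn E0 y0; first by case: y {E0 y0}.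
have [D' ->] : exists D' : diagram i j, D = dtens (did 1) D' :> diagram (1 + i) (1 + j).
  have yE : y = lshift j (ord0 : 'I_1) by apply: val_inj.
  apply: dtens_split => -[a|a]; rewrite partner_mk /= (ord1 a).
    rewrite (_ : @lshift 1 i _ = ord0 :> 'I_i.+1) ?E0 ?yE //; exact: val_inj.
  by rewrite -yE -E0 partnerK; congr inl; apply: val_inj.
by apply/Pid/IH; lia.
Qed.

End Induction.
End Diagrams.

(** * Values of the functor on diagrams *)

Section Functor.
Variables (K : fieldType) (V : superVect K) (B : evenForm V).

Lemma braiding_tens q (u : 'I_2 -> V) : homog q (finfun u) ->
  braiding V (tens u) = (-1) ^+ (q ord0 && q ord_max) *: tens (fun s => u (rev_ord s)).
Proof.
move=> uq; have r0 : rev_ord ord0 = ord_max :> 'I_2 by apply: val_inj.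
have r1 : rev_ord ord_max = ord0 :> 'I_2 by apply: val_inj.
have t2 (w : 'I_2 -> V) x y : tens w (word2 x y) = crd x (w ord0) * crd y (w ord_max).
  rewrite ffunE !big_ord_recl big_ord0 mulr1 word2_0.
  by rewrite (_ : lift ord0 ord0 = ord_max) ?word2_1 //; apply: val_inj.
apply/ffunP => a; rewrite (word2E a) hom_tpowE [in RHS]ffunE /GRing.scale /=.
move: (a ord0) (a ord_max) => {a} x y.
rewrite (bigD1 (word2 y x)) //= big1 ?addr0 => [|b bn]; last first.
  rewrite coef_hom_of_coef /=; case: eqP => [E|]; last by rewrite mulr0 mul0r.
  case/eqP: bn; rewrite (word2E b); congr word2.
    by rewrite -(word2_1 (b ord_max) (b ord0)) -E word2_1.
  by rewrite -(word2_0 (b ord_max) (b ord0)) -E word2_0.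
rewrite coef_hom_of_coef /= !word2_0 !word2_1 eqxx mulr1 !t2 r0 r1.
have u0 : u ord0 \in sv_part V (q ord0) by have := uq ord0; rewrite ffunE.
have u1 : u ord_max \in sv_part V (q ord_max) by have := uq ord_max; rewrite ffunE.
have [->|ny] := eqVneq (crd y (u ord0)) 0; first by rewrite !(mul0r, mulr0).
have [->|nx] := eqVneq (crd x (u ord_max)) 0; first by rewrite !(mul0r, mulr0).
by rewrite (crd_par u0 ny) (crd_par u1 nx) [crd y _ * _]mulrC.
Qed.

Lemma tpow_scaleE n (c : K) (x : tpow V n) a : (c *: x) a = c * x a.
Proof. by rewrite ffunE. Qed.

Lemma hom_tupleE i j (f : 'Hom(tpow V i, tpow V j)) (w : {ffun 'I_i + 'I_j -> V})
    (u : 'I_j -> V) (v : 'I_i -> V) :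
  (forall s, w (inr s) = u s) -> (forall s, w (inl s) = v s) ->
  hom_tuple B f w = pairt B u (f (tens v)).
Proof. by move=> wu wv; rewrite /hom_tuple (eq_pairt _ _ wu) (eq_tens wv). Qed.

Variables (delta : K) (F : brauerFunctor B delta).

Section Transposition.
Variables k l : nat.
Let i0 : 'I_(k + 2 + l) := lshift l (rshift k ord0).
Let i1 : 'I_(k + 2 + l) := lshift l (rshift k ord_max).

Let sw_ll d : sw (lshift l (lshift 2 d)) = lshift l (lshift 2 d) :> 'I_(k + 2 + l).
Proof.
rewrite /sw (_ : split _ = inl (lshift 2 d)); last exact: (unsplitK (inl _)).
by rewrite (_ : split _ = inl d); last exact: (unsplitK (inl _)).
Qed.
Let sw_lr d : sw (lshift l (rshift k d)) = lshift l (rshift k (rev_ord d)).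
Proof.
rewrite /sw (_ : split _ = inl (rshift k d)); last exact: (unsplitK (inl _)).
by rewrite (_ : split _ = inr d); last exact: (unsplitK (inr _)).
Qed.
Let sw_r c : sw (rshift (k + 2) c) = rshift (k + 2) c :> 'I_(k + 2 + l).
Proof. by rewrite /sw (_ : split _ = inr c) //; exact: (unsplitK (inr _)). Qed.

Lemma tw_tens q (w : 'I_(k + 2 + l) -> V) : homog q (finfun w) ->
  F _ _ (tw k l) (tens w) = (-1) ^+ (q i0 && q i1) *: tens (fun s => w (sw s)).
Proof.
move=> wq; rewrite !bf_tens !bf_id bf_cross; apply/ffunP => a.
rewrite -(wcatK a) -(wcatK (wleft a)) tpow_scaleE.
move: (wleft (wleft a)) (wright (wleft a)) (wright a) => a1 a2 a3.
rewrite !tens_hom_tens !id_lfunE !tens_wcat.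
rewrite (braiding_tens (q := fun d => q (lshift l (rshift k d)))); last first.
  by move=> d; rewrite ffunE; have := wq (lshift l (rshift k d)); rewrite ffunE.
rewrite tpow_scaleE mulrCA -!mulrA; congr (_ * _).
have eqt n (u v : 'I_n -> V) b : u =1 v -> tens u b = tens v b.
  by move=> uv; rewrite (eq_tens uv).
congr (_ * (_ * _)); apply: eqt => d /=.
- by rewrite sw_ll.
- by rewrite sw_lr.
by rewrite sw_r.
Qed.

(** The transposition is self-adjoint for [pairt]: where the pairing is nonzero, the parities of the
    word are those of the tuple, so both signs agree. *)
Lemma tw_pairt q (w : 'I_(k + 2 + l) -> V) x : homog q (finfun w) ->
  pairt B w (F _ _ (tw k l) x)
  = (-1) ^+ (q i0 && q i1) * pairt B (fun s => w (sw s)) x.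
Proof.
move=> wq; rewrite [x]tpow_tbasis !linear_sum mulr_sumr /=; apply: eq_bigr => c _.
rewrite !linearZ /= mulrCA; congr (_ * _); rewrite -tens_hbasis.
rewrite (tw_tens (q := fun s => par (c s))); last by move=> s; rewrite ffunE hbasis_mem.
rewrite linearZ /= !pairt_tens.
have -> : \prod_s B (w (sw s)) (hbasis (c s)) = \prod_s B (w s) (hbasis (c (sw s))).
  by rewrite (reindex_inj (inv_inj (@swK k l))); apply: eq_bigr => s _; rewrite swK.
have [->|nz] := eqVneq (\prod_s B (w s) (hbasis (c (sw s)))) 0; first by rewrite !mulr0.
have qc s : q s = par (c (sw s)).
  have ws : w s \in sv_part V (q s) by have := wq s; rewrite ffunE.
  apply: (form_parity ws (hbasis_mem (c (sw s))) (B := B)).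
  by apply: contraNneq nz => E; rewrite (bigD1 s) //= E mul0r.
rewrite !qc !sw_lr andbC (_ : rev_ord ord0 = ord_max :> 'I_2); last exact: val_inj.
by rewrite (_ : rev_ord ord_max = ord0 :> 'I_2); last exact: val_inj.
Qed.

Lemma bf_low j (D : diagram (k + 2 + l) j) :
  F _ _ (dcomp D (tw k l)) = (F _ _ D \o F _ _ (tw k l))%VF.
Proof. by rewrite bf_comp (loops_low (@tw_inr k l)) expr0 scale1r. Qed.

Lemma bf_up i (D : diagram i (k + 2 + l)) :
  F _ _ (dcomp (tw k l) D) = (F _ _ (tw k l) \o F _ _ D)%VF.
Proof. by rewrite bf_comp (loops_up (@tw_inl k l)) expr0 scale1r. Qed.

End Transposition.

Lemma bf_equiv (O : OSpRep B) i j (D : diagram i j) : equiv O (F _ _ D).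
Proof.
have tens i1 j1 i2 j2 (D1 : diagram i1 j1) (D2 : diagram i2 j2) :
    equiv O (F _ _ D1) -> equiv O (F _ _ D2) -> equiv O (F _ _ (dtens D1 D2)).
  by move=> E1 E2; rewrite bf_tens; apply: equiv_tens => //; apply: bf_even.
have did n : equiv O (F _ _ (did n)) by rewrite bf_id; apply: equiv_id.
have twE k l : equiv O (F _ _ (tw k l)).
  by apply/tens/did/tens; [apply: did | rewrite bf_cross; apply: equiv_braiding].
elim/diagram_induction: i j / D => [|i j D ED|i j D ED|i j D ED|k l j D ED|i k l D ED].
- exact: did.
- exact: tens.
- by apply: tens ED; apply: equiv_cap; apply: bf_cap.
- by apply: tens ED; apply: equiv_cup; [apply: bf_even | apply: bf_cup].
- by rewrite bf_low; apply: equiv_comp.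
by rewrite bf_up; apply: equiv_comp.
Qed.

(* The value at homogeneous tuples is, up to sign, the product of the pairings
   along the arcs of D; only its vanishing matters. *)
Definition arcs_eq0 i j (D : diagram i j) : Prop :=
  forall q w, homog q w -> (hom_tuple B (F _ _ D) w == 0)
    = [exists t, B (w t) (w (partner D t)) == 0].

Lemma arcs_eq0_tens i j i' j' (D : diagram i j) (E : diagram i' j') :
  arcs_eq0 D -> arcs_eq0 E -> arcs_eq0 (dtens D E).
Proof.
move=> DQ EQ q w wq.
pose wl : {ffun 'I_i + 'I_j -> V} := [ffun t => w (ptl i' j' t)].
pose wr : {ffun 'I_i' + 'I_j' -> V} := [ffun t => w (ptr i j t)].
have -> : hom_tuple B (F _ _ (dtens D E)) w
    = hom_tuple B (F _ _ D) wl * hom_tuple B (F _ _ E) wr.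
  rewrite /hom_tuple bf_tens.
  rewrite (pairt_wcat _ _ (fun a b => tens_hom_tens _ _ _ a b)) /=.
  by congr (_ * _); symmetry; apply: hom_tupleE => s; rewrite ffunE.
rewrite mulf_eq0 (DQ (fun t => q (ptl i' j' t))); last by move=> t; rewrite ffunE.
rewrite (EQ (fun t => q (ptr i j t))); last by move=> t; rewrite ffunE.
apply/orP/existsP => [[] /existsP[t]|[t]].
- by rewrite !ffunE => tE; exists (ptl i' j' t); rewrite partner_mk dtens_ptl.
- by rewrite !ffunE => tE; exists (ptr i j t); rewrite partner_mk dtens_ptr.
rewrite partner_mk; case: (ptlr_cases t) => -[y ->].
  by rewrite dtens_ptl => yE; left; apply/existsP; exists y; rewrite !ffunE.
by rewrite dtens_ptr => yE; right; apply/existsP; exists y; rewrite !ffunE.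
Qed.

Lemma pairt0 (w : 'I_0 -> V) x a : pairt B w x = x a.
Proof. by rewrite /pairt (sum_word0 _ a) big_ord0 mul1r. Qed.

Lemma arcs_eq0_cap : arcs_eq0 dcap.
Proof.
move=> q w wq; have a : word V 0 := ffun0 (card_ord 0).
have e1 : lift ord0 ord0 = ord_max :> 'I_2 by apply: val_inj.
have -> : hom_tuple B (F _ _ dcap) w = B (w (inl ord0)) (w (inl ord_max)).
  rewrite /hom_tuple (pairt0 _ _ a) hom_tpowE sum_word2.
  rewrite [w (inl ord0)]crd_sum linear_sumlz; apply: eq_bigr => x _.
  rewrite {1}[w (inl ord_max)]crd_sum linear_sum; apply: eq_bigr => y _.
  rewrite /= bf_cap formZl formZr ffunE !big_ord_recl big_ord0 mulr1 word2_0 e1 word2_1.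
  by rewrite /=; ring.
apply/idP/existsP => [E|[[t|[]//]]].
  by exists (inl ord0); rewrite partner_mk /= (_ : rev_ord _ = ord_max) //; apply: val_inj.
rewrite partner_mk /=; case: t => [[|[|//]]] h.
  by rewrite (_ : Ordinal h = ord0) 1?(_ : rev_ord _ = ord_max) //; apply: val_inj.
rewrite (_ : Ordinal h = ord_max) 1?(_ : rev_ord _ = ord0) //; try exact: val_inj.
by rewrite (form_eq0C B (wq _) (wq _)).
Qed.

Lemma arcs_eq0_cup : arcs_eq0 dcup.
Proof.
move=> q w wq; have a : word V 0 := ffun0 (card_ord 0).
have e1 : lift ord0 ord0 = ord_max :> 'I_2 by apply: val_inj.
have -> : hom_tuple B (F _ _ dcup) w = B (w (inr ord_max)) (w (inr ord0)).
  rewrite /hom_tuple /pairt sum_word2 exchange_big /=.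
  rewrite [in RHS](crd_sum (w (inr ord0))) linear_sum /=; apply: eq_bigr => y _.
  rewrite formZr.
  (* The snake relation [bf_cup], extended linearly in its first vector, gives the coordinates. *)
  have -> : crd y (w (inr ord0)) = \sum_z B (w (inr ord0)) (hbasis z)
      * coef (F _ _ dcup) (word2 z y) a.
    transitivity (\sum_x crd x (w (inr ord0)) * (x == y)%:R).
      rewrite (bigD1 y) //= eqxx mulr1 big1 ?addr0 // => x /negPf ->.
      by rewrite mulr0.
    under eq_bigr do rewrite -(bf_cup F a) mulr_sumr.
    rewrite exchange_big; apply: eq_bigr => z _ /=.
    rewrite [in RHS](crd_sum (w (inr ord0))) linear_sumlz mulr_suml.
    by apply: eq_bigr => x _; rewrite formZl mulrA.
  rewrite mulr_suml; apply: eq_bigr => z _.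
  rewrite hom_tpowE (sum_word0 _ a) [tens _ a]ffunE big_ord0 mulr1.
  rewrite !big_ord_recl big_ord0 mulr1 word2_0 e1 word2_1.
  by rewrite /=; ring.
apply/idP/existsP => [E|[[[]//|t]]].
  exists (inr ord_max); rewrite partner_mk /= (_ : rev_ord _ = ord0) //; exact: val_inj.
rewrite partner_mk /=; case: t => [[|[|//]]] h.
  rewrite (_ : Ordinal h = ord0) 1?(_ : rev_ord _ = ord_max) //; try exact: val_inj.
  by rewrite (form_eq0C B (wq _) (wq _)).
by rewrite (_ : Ordinal h = ord_max) 1?(_ : rev_ord _ = ord0) //; apply: val_inj.
Qed.

Lemma arcs_eq0_id1 : arcs_eq0 (did 1).
Proof.
move=> q w wq; rewrite /hom_tuple bf_id id_lfunE pairt_tens big_ord1.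
apply/idP/existsP => [E|[[t|t]]].
- by exists (inr ord0); rewrite partner_mk.
- by rewrite partner_mk /= (ord1 t) (form_eq0C B (wq _) (wq _)).
by rewrite partner_mk /= (ord1 t).
Qed.

Lemma exists_conj (T : finType) (s D : T -> T) (w : T -> V) : involutive s ->
  [exists t, B (w (s t)) (w (s (D t))) == 0]
  = [exists t, B (w t) (w (s (D (s t)))) == 0].
Proof.
move=> sK; apply/existsP/existsP => -[t tE]; exists (s t); by rewrite ?sK.
Qed.

Lemma bf_eq0 i j (D : diagram i j) : arcs_eq0 D.
Proof.
elim/diagram_induction: i j / D => [|i j D DQ|i j D DQ|i j D DQ|k l j D DQ|i k l D DQ].
- move=> q w _; rewrite /hom_tuple bf_id id_lfunE pairt_tens big_ord0 oner_eq0.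
  by symmetry; apply/existsP => -[[[]|[]]].
- exact: arcs_eq0_tens arcs_eq0_id1 DQ.
- exact: arcs_eq0_tens arcs_eq0_cap DQ.
- exact: arcs_eq0_tens arcs_eq0_cup DQ.
- move=> q w wq; pose w2 : {ffun _ -> V} := [ffun t => w (lowmap (@sw k l) t)].
  rewrite /hom_tuple bf_low comp_lfunE.
  rewrite (tw_tens (q := fun s => q (inl s))); last by move=> s; rewrite ffunE.
  rewrite !linearZ mulf_eq0 signr_eq0 /=.
  have := DQ (fun t => q (lowmap (@sw k l) t)) w2.
  rewrite (hom_tupleE _ _ (u := fun s => w (inr s)) (v := fun s => w (inl (sw s))));
    try by move=> s; rewrite ffunE.
  move=> ->; last by move=> t; rewrite ffunE.
  transitivity [exists t, B (w (lowmap (@sw k l) t)) (w (lowmap (@sw k l) (partner D t))) == 0].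
    by apply: eq_existsb => t; rewrite !ffunE.
  rewrite exists_conj; last exact: lowmapK (@swK k l).
  by apply: eq_existsb => t; rewrite (dcomp_low (@tw_inl k l) (@tw_inr k l)).
move=> q w wq; pose w2 : {ffun _ -> V} := [ffun t => w (upmap (@sw k l) t)].
rewrite /hom_tuple bf_up comp_lfunE.
rewrite (tw_pairt (q := fun s => q (inr s))); last by move=> s; rewrite ffunE.
rewrite mulf_eq0 signr_eq0 /=.
have := DQ (fun t => q (upmap (@sw k l) t)) w2.
rewrite (hom_tupleE _ _ (u := fun s => w (inr (sw s))) (v := fun s => w (inl s)));
  try by move=> s; rewrite ffunE.
move=> ->; last by move=> t; rewrite ffunE.
transitivity [exists t, B (w (upmap (@sw k l) t)) (w (upmap (@sw k l) (partner D t))) == 0].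
  by apply: eq_existsb => t; rewrite !ffunE.
rewrite exists_conj; last exact: upmapK (@swK k l).
by apply: eq_existsb => t; rewrite (dcomp_up (@tw_inl k l) (@tw_inr k l)).
Qed.

End Functor.

(** * The symmetric group orbit of the standard form *)

Section StandardForms.
Variables (K : fieldType) (V : superVect K) (B : evenForm V).

(** The exponent of [koszul] as a function of parities, so that the parity at one position can be
    varied. *)
Definition ksign n (s : 'S_n) (q : 'I_n -> bool) : bool :=
  \big[addb/false]_(t < n) \big[addb/false]_(t' < n)
    [&& (t < t')%N && (s t' < s t)%N, q t & q t'].

Lemma koszulE n (s : 'S_n) (a : word V n) :
  koszul s a = (-1) ^+ ksign s (fun t => par (a t)).
Proof.
rewrite /ksign (big_morph (fun b : bool => (-1 : K) ^+ b) (signr_addb _) (erefl _)).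
apply: eq_bigr => t _; rewrite big_mkcond.
rewrite (big_morph (fun b : bool => (-1 : K) ^+ b) (signr_addb _) (erefl _)).
by apply: eq_bigr => t' _; case: ifP.
Qed.

Lemma perm_act_tens n (s : 'S_n) q (w : 'I_n -> V) : homog q (finfun w) ->
  perm_act V s (tens w) = (-1) ^+ ksign s q *: tens (fun u => w ((s^-1)%g u)).
Proof.
move=> wq; apply/ffunP => a; rewrite hom_tpowE tpow_scaleE.
pose b : word V n := [ffun t => a (s t)].
have wb : tens (fun u => w ((s^-1)%g u)) a = tens w b.
  rewrite !ffunE (reindex_inj (@perm_inj _ s)); apply: eq_bigr => t _.
  by rewrite ffunE permK.
rewrite wb (bigD1 b) //= big1 ?addr0 => [|c cb]; last first.
  rewrite coef_hom_of_coef; case: forallP => [H|_]; last by rewrite mulr0 mul0r.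
  by case/eqP: cb; apply/ffunP => t; rewrite ffunE (eqP (H t)).
rewrite coef_hom_of_coef (_ : [forall t, _] = true) ?mulr1; last first.
  by apply/forallP => t; rewrite ffunE.
have [->|nz] := eqVneq (tens w b) 0; first by rewrite !mulr0.
rewrite koszulE; congr ((-1) ^+ (nat_of_bool _) * _); rewrite /ksign.
by apply: eq_bigr => t _; apply: eq_bigr => t' _; rewrite !(tens_wpar wq nz).
Qed.

Lemma addb_pred1 (I : finType) (t : I) (G : I -> bool) :
  \big[addb/false]_u ((u == t) && G u) = G t.
Proof. by rewrite (bigD1 t) //= eqxx big1 ?addbF // => u /negPf ->. Qed.

(** The sign changes by the parities of the entries crossing [t], that is, those to the right of [t]
    either before or after applying [s], but not both. *)
Lemma ksign_flip n (s : 'S_n) (q : 'I_n -> bool) t :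
  ksign s (fun u => q u (+) (u == t)) (+) ksign s q
  = \big[addb/false]_(u < n | (t < u)%N) q u
    (+) \big[addb/false]_(u < n | (s t < u)%N) q ((s^-1)%g u).
Proof.
pose inv (u u' : 'I_n) := (u < u')%N && (s u' < s u)%N.
transitivity (\big[addb/false]_(u < n) (inv t u && q u)
    (+) \big[addb/false]_(u < n) (inv u t && q u)).
  rewrite /ksign -big_split /=.
  have E u : \big[addb/false]_(t' < n) [&& inv u t', q u (+) (u == t) & q t' (+) (t' == t)]
     (+) \big[addb/false]_(t' < n) [&& inv u t', q u & q t']
    = ((u == t) && \big[addb/false]_(t' < n) (inv t t' && q t')) (+) (inv u t && q u).
    rewrite -big_split /= big_distrr /=.
    have -> : inv u t && q u = \big[addb/false]_(t' < n) ((t' == t) && (inv u t && q u)).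
      by rewrite (addb_pred1 t (fun=> inv u t && q u)).
    rewrite -big_split /=; apply: eq_bigr => t' _.
    have it : inv t t = false by rewrite /inv ltnn.
    have [->|ut] := eqVneq u t; have [->|tt] := eqVneq t' t; rewrite ?it //=.
    - by case: (inv t t'); case: (q t); case: (q t').
    - by case: (inv u t); case: (q t); case: (q u).
    by case: (inv u t'); case: (q t'); case: (q u).
  rewrite (eq_bigr _ (fun u _ => E u)) big_split /=; congr (_ (+) _).
  exact: addb_pred1.
have -> : \big[addb/false]_(u < n | (s t < u)%N) q ((s^-1)%g u)
    = \big[addb/false]_(u < n) (if (s t < s u)%N then q u else false).
  rewrite (reindex_inj (@perm_inj _ s)) big_mkcond /=.
  by apply: eq_bigr => u _; rewrite permK.
rewrite [in RHS]big_mkcond -!big_split /=; apply: eq_bigr => u _; rewrite /inv.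
have [->|ut] := eqVneq u t; first by rewrite !ltnn.
have sut : (s u != s t :> nat) by rewrite (inj_eq val_inj) (inj_eq (@perm_inj _ s)).
have vut : (u != t :> nat) by [].
case: (ltngtP u t) vut => // _ _; case: (ltngtP (s u) (s t)) sut => //= _ _; by case: (q u).
Qed.

(** S changes the parity of one factor by that of eps; [ksign_flip] says that this change of the
    Koszul sign makes up for the different factors passed by eps. *)
Lemma perm_act_Lop n (s : 'S_n) e S x : osp B e S ->
  perm_act V s (Lop S n x) = Lop S n (perm_act V s x).
Proof.
move=> eS; rewrite [x]tpow_tbasis !linear_sum; apply: eq_bigr => c _.
rewrite !linearZ /= -tens_hbasis; congr (_ *: _).
pose w t : V := hbasis (c t); pose q t := par (c t).
have wq : homog q (finfun w) by move=> t; rewrite ffunE hbasis_mem.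
have wq' : homog (fun u => q ((s^-1)%g u)) (finfun (fun u => w ((s^-1)%g u))).
  by move=> t; rewrite ffunE hbasis_mem.
rewrite (perm_act_tens s wq) linearZ /= (Lop_tens eS wq) (Lop_tens eS wq').
rewrite linear_sum scaler_sumr [in RHS](reindex_inj (@perm_inj _ s)) /=.
apply: eq_bigr => t _; rewrite linearZ /= permK.
have uq : homog (fun u => q u (+) (e && (u == t))) (finfun (updf w t (S (w t)))).
  move=> u; rewrite ffunE /updf; case: eqVneq => [->|ut].
    by rewrite andbT; apply: (osp_mem eS (hbasis_mem _)).
  by rewrite andbF addbF hbasis_mem.
rewrite (perm_act_tens s uq) !scalerA -!signr_addb; congr ((-1) ^+ (nat_of_bool _) *: _).
  rewrite /lop_sign; have := ksign_flip s q t; case: (e) => /= [E|_].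
    rewrite (_ : ksign s _ = ksign s (fun u => q u (+) (u == t))) //.
    have addb4 (b1 b2 b3 b4 : bool) : b1 (+) b2 = b3 (+) b4 -> b3 (+) b1 = b2 (+) b4.
      by case: b1 b2 b3 b4 => [] [] [] [].
    exact: addb4 E.
  by rewrite addbF; apply: eq_bigr => u _; apply: eq_bigr => u' _; rewrite !addbF.
by apply: eq_tens => u; rewrite /updf -(inj_eq (@perm_inj _ s)) permKV.
Qed.

Section Beta.
Variable r : nat.

Definition slot (z : 'I_r * bool) : 'I_(r.*2) :=
  if z.2 then Ordinal (dblS_proof z.1) else Ordinal (dbl_proof z.1).

Lemma slot_inj : injective slot.
Proof.
case=> [k b] [k' b'] /(congr1 val); rewrite /slot /=.
case: b b' => [] [] /= E; try (by move: (congr1 odd E); rewrite /= ?odd_double);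
  congr (_, _); apply: val_inj => /=; lia.
Qed.

Lemma slot_bij : bijective slot.
Proof.
apply: inj_card_bij slot_inj _.
by rewrite card_prod !card_ord card_bool muln2.
Qed.

Lemma slot_exb i : exists z, slot z == i.
Proof. by have [g _ gK] := slot_bij; exists (g i); rewrite gK. Qed.

(** The pairing of the standard form: [flip] carried over along the bijection [slot]. *)
Definition mate (i : 'I_(r.*2)) : 'I_(r.*2) := slot (flip (xchoose (slot_exb i))).

Lemma mateE z : mate (slot z) = slot (flip z).
Proof. by rewrite /mate; have /eqP/slot_inj -> := xchooseP (slot_exb (slot z)). Qed.

Lemma mateK : involutive mate.
Proof. by move=> i; have [z /eqP <-] := slot_exb i; rewrite !mateE flipK. Qed.

Lemma mate_neq i : mate i != i.
Proof.
have [z /eqP <-] := slot_exb i.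
by rewrite mateE (inj_eq slot_inj) flip_neq.
Qed.

Definition matching_prod (w : {ffun 'I_(r.*2) -> V}) : K :=
  \prod_(k < r) B (w (slot (k, false))) (w (slot (k, true))).

Lemma matching_prod_mlin : mlin matching_prod.
Proof.
move=> w t c u v; have [[k b] /eqP kb] := slot_exb t; rewrite -kb /matching_prod.
have other k' b' x : k' != k -> upd w (slot (k, b)) x (slot (k', b')) = w (slot (k', b')).
  by move=> kk; rewrite upd_neq // (inj_eq slot_inj) xpair_eqE (negPf kk).
have H x : \prod_(k' < r) B (upd w (slot (k, b)) x (slot (k', false)))
      (upd w (slot (k, b)) x (slot (k', true)))
    = B (upd w (slot (k, b)) x (slot (k, false))) (upd w (slot (k, b)) x (slot (k, true)))
      * \prod_(k' < r | k' != k) B (w (slot (k', false))) (w (slot (k', true))).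
  by rewrite (bigD1 k) //=; congr (_ * _); apply: eq_bigr => k' kk; rewrite !other.
rewrite !H mulrA -mulrDl; congr (_ * _).
have ft (x : V) : upd w (slot (k, false)) x (slot (k, true)) = w (slot (k, true)).
  by rewrite upd_neq // (inj_eq slot_inj) xpair_eqE eqxx.
have tf (x : V) : upd w (slot (k, true)) x (slot (k, false)) = w (slot (k, false)).
  by rewrite upd_neq // (inj_eq slot_inj) xpair_eqE eqxx.
by case: b {kb other H}; rewrite !upd_eq ?ft ?tf ?formDr ?formZr ?formDl ?formZl.
Qed.

Lemma std_form_tbasis (b : word V r.*2) :
  std_form B r (tbasis b) = matching_prod [ffun i => hbasis (b i)].
Proof.
rewrite lfunE /= /std_fun (bigD1 b) //= ffunE eqxx mulr1 [X in _ + X]big1 ?addr0 => [|a ab].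
  by rewrite /matching_prod; apply: eq_bigr => k _; rewrite !ffunE.
by rewrite ffunE (negPf ab) mulr0.
Qed.

Lemma std_form_tens (w : {ffun 'I_(r.*2) -> V}) :
  std_form B r (tens w) = matching_prod w.
Proof.
have fl := form_tuple_mlin (std_form B r).
(* A one-element index set and coefficient 1 make [mlinB] apply to a difference of two functions. *)
have hl := mlinB (J := unit) (fun=> 1) fl (fun=> matching_prod_mlin).
apply/eqP; rewrite -subr_eq0; apply/eqP.
have := mlin_span (X := fun v => exists i, v = hbasis i) hl.
rewrite /= => H; have {}H := H _ _ w.
rewrite (big_pred1 tt) ?mul1r in H; last by case.
apply: H => [v|u uX].
  exists [seq (crd i v, hbasis i) | i : ix V]; split.
    by move=> x /imageP[i _ ->]; exists i.
  by rewrite big_map big_enum /= -crd_sum.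
have /fin_all_exists[b bE] := uX.
rewrite (big_pred1 tt) ?mul1r; last by case.
rewrite /form_tuple (eq_tens (w' := fun s => hbasis (finfun b s))); last first.
  by move=> s; rewrite ffunE.
rewrite tens_hbasis std_form_tbasis (_ : [ffun i => _] = u) ?subrr //.
by apply/ffunP => i; rewrite !ffunE.
Qed.

Definition perm_form (s : 'S_(r.*2)) : 'Hom(tpow V r.*2, K^o) :=
  (std_form B r \o perm_act V s)%VF.

(** The action moves factor [t] to position [s t], so the permuted form pairs [t] with this
    position. *)
Definition perm_mate (s : 'S_(r.*2)) (t : 'I_(r.*2)) : 'I_(r.*2) :=
  (s^-1)%g (mate (s t)).

Lemma perm_mateK s : involutive (perm_mate s).
Proof. by move=> t; rewrite /perm_mate permKV mateK permK. Qed.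

Lemma perm_mate_neq s t : perm_mate s t != t.
Proof. by rewrite -(inj_eq (@perm_inj _ s)) permKV mate_neq. Qed.

Lemma perm_form_eq0 s q w : homog q w -> (form_tuple (perm_form s) w == 0)
  = [exists t, B (w t) (w (perm_mate s t)) == 0].
Proof.
move=> wq; rewrite /form_tuple comp_lfunE (perm_act_tens s (q := q)); last first.
  by move=> t; rewrite ffunE.
rewrite linearZ /= mulf_eq0 signr_eq0 /=.
rewrite (eq_tens (w' := [ffun u => w ((s^-1)%g u)])) => [|u]; last by rewrite ffunE.
rewrite std_form_tens; apply/prodf_eq0/existsP => [[k _]|[t tE]].
  rewrite !ffunE => kE; exists ((s^-1)%g (slot (k, false))).
  by rewrite /perm_mate permKV mateE.
have [[k b] /eqP kb] := slot_exb (s t); exists k => //; rewrite !ffunE.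
move: tE; rewrite /perm_mate -kb mateE -[t](permK s) -kb.
by case: b {kb}; rewrite // (form_eq0C B (wq _) (wq _)).
Qed.

(** The permutation sends each position to the slot of its letter. *)
Lemma perm_form_surj (a : {ffun 'I_(r.*2) -> 'I_r * bool}) : injective a ->
  exists s, forall t, a (perm_mate s t) = flip (a t).
Proof.
move=> ai; exists (perm (inj_comp slot_inj ai)) => t; apply: slot_inj.
set s := perm _; have sE u : slot (a u) = s u by rewrite permE.
by rewrite sE /perm_mate permKV -mateE -sE.
Qed.

End Beta.

Variables (delta : K) (F : brauerFunctor B delta).

Fixpoint caps r : diagram r.*2 0 :=
  match r with 0 => did 0 | r'.+1 => dtens dcap (caps r') end.

(** Presents the standard form as the form of a diagram, which makes it equivariant. *)
Lemma caps_coef r (a : word V 0) (b : word V r.*2) :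
  coef (F _ _ (caps r)) a b = std_form B r (tbasis b).
Proof.
rewrite std_form_tbasis /matching_prod.
elim: r a b => [|r IH] a b.
  by rewrite /= bf_id coef_id big_ord0 (word0E a b) eqxx.
rewrite [caps _]/(dtens dcap (caps r)) (bf_tens F dcap (caps r)).
rewrite (coef_hom_of_coef (i := 2 + r.*2) (j := 0 + 0)) IH big_ord_recl; congr (_ * _).
  rewrite (word2E (wleft _)) bf_cap !ffunE; congr (B (hbasis (b _)) (hbasis (b _)));
    exact: val_inj.
apply: eq_bigr => k _; rewrite !ffunE; congr (B (hbasis (b _)) (hbasis (b _)));
  exact: val_inj.
Qed.

Lemma perm_form_Lop r (O : OSpRep B) (s : 'S_(r.*2)) e S x : osp B e S ->
  perm_form s (Lop S r.*2 x) = 0.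
Proof.
move=> eS; rewrite comp_lfunE (perm_act_Lop _ _ eS).
have a : word V 0 := ffun0 (card_ord 0).
have E y : std_form B r y = F _ _ (caps r) y a.
  rewrite form_tpowE hom_tpowE; apply: eq_bigr => b _.
  by rewrite caps_coef mulrC.
(* On the power 0 the operator [Lop] vanishes: an empty product is 1, with eps-component 0. *)
rewrite E (equiv_Lop eS (bf_equiv F O (caps r))) hom_tpowE big1 // => b _.
by rewrite coef_hom_of_coef big_ord0 /= mulr0 mul0r.
Qed.

End StandardForms.

(** * The two isomorphism statements *)

Section Main.
Variables (K : fieldType) (V : superVect K) (B : evenForm V).
Variables (delta : K) (F : brauerFunctor B delta).

Lemma pairing_of_rainbow (I : finType) r (a : {ffun I -> 'I_r * bool}) :
  #|I| = (r * 2)%N -> injective a ->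
  exists f : I -> I, [/\ forall t, a (f t) = flip (a t),
    forall t, f t != t & involutive f].
Proof.
move=> cI ai.
have cZ : (#|{: 'I_r * bool}| <= #|I|)%N by rewrite card_prod card_ord card_bool cI.
have [g ga ag] := inj_card_bij ai cZ.
exists (fun t => g (flip (a t))); split=> [t|t|t].
- by rewrite ag.
- by rewrite -(inj_eq ai) ag flip_neq.
by rewrite ag flipK ga.
Qed.

(** The dual basis is read off from the copairing, the value of the functor on the cup. *)
Lemma form_dual : exists d : ix V -> V, forall x y, B (d x) (hbasis y) = (x == y)%:R.
Proof.
have a : word V 0 := ffun0 (card_ord 0).
pose C z y := coef (F _ _ dcup) (word2 z y) a.
have Cp z y : par z != par y -> C z y = 0.
  move=> zy; apply: bf_even; rewrite /wpar !big_ord_recl !big_ord0 addbF.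
  rewrite word2_0 ffunE /=.
  by case: (par z) (par y) zy => [] [].
exists (fun x => \sum_z C x z *: hbasis z) => x y.
rewrite linear_sumlz -(copairing_inv Cp (bf_cup F a)); apply: eq_bigr => z _.
by rewrite formZl.
Qed.

(** Basis vectors at the lower ends and dual basis vectors at the upper ends give back the matrix
    coefficients. *)
Lemma hom_tuple_inj i j (f g : 'Hom(tpow V i, tpow V j)) :
  hom_tuple B f =1 hom_tuple B g -> f = g.
Proof.
move=> fg; have [d dE] := form_dual; apply: coef_eq => a b.
have E (h : 'Hom(tpow V i, tpow V j)) : coef h a b
    = hom_tuple B h [ffun t => match t with inl s => hbasis (b s) | inr s => d (a s) end].
  rewrite (hom_tupleE _ _ (u := fun s => d (a s)) (v := fun s => hbasis (b s)));
    try by move=> s; rewrite ffunE.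
  rewrite tens_hbasis /pairt (bigD1 a) //= big1 ?mul1r => [|s _]; last by rewrite dE eqxx.
  rewrite big1 ?addr0 // => c ca.
  have [s sn] : exists s, a s != c s.
    apply/existsP; apply: contraR ca => /existsPn H; apply/eqP/ffunP => s.
    by rewrite (eqP (negbNE (H s))).
  by rewrite (bigD1 s) //= dE (negPf sn) !mul0r.
by rewrite !E fg.
Qed.

Lemma brauer_act_linear r : linear (brauer_act F (r := r)).
Proof.
move=> k x y; rewrite /brauer_act scaler_sumr -big_split /=.
by apply: eq_bigr => D _; rewrite !ffunE scalerDl scalerA.
Qed.

Lemma brauer_act_bdiag r (D : diagram r r) : brauer_act F (bdiag K D) = F _ _ D.
Proof.
rewrite /brauer_act (bigD1 D) //= ffunE eqxx scale1r big1 ?addr0 // => E ED.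
by rewrite ffunE (negPf ED) scale0r.
Qed.

HB.instance Definition _ r :=
  GRing.isLinear.Build K (brauer K r) _ _ (brauer_act F (r := r)) (@brauer_act_linear r).

Lemma brauer_act_mul r (x y : brauer K r) :
  brauer_act F (bmul delta x y) = (brauer_act F x \o brauer_act F y)%VF.
Proof.
apply/lfunP => z; rewrite comp_lfunE /bmul linear_sum [RHS]sum_lfunE sum_lfunE.
apply: eq_bigr => E _; rewrite scale_lfunE.
have -> : brauer_act F y = \sum_D y D *: F r r D by [].
rewrite linear_sum !sum_lfunE linear_sum scaler_sumr; apply: eq_bigr => D _.
rewrite linearZ /= brauer_act_bdiag !scale_lfunE linearZ /= -comp_lfunE bf_comp.
by rewrite scale_lfunE !scalerA.
Qed.

Lemma bf_tuple_lie (O : OSpRep B) i j (D : diagram i j) :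
  lie B (@hom_sign i j) (hom_tuple B (F _ _ D)).
Proof. by apply: hom_tuple_lie => e S eS x; exact: (equiv_Lop eS (bf_equiv F O D)). Qed.

Lemma hom_sign_even i j (q : ('I_i + 'I_j)%type -> bool) t : hom_sign false q t = false.
Proof. by case: t. Qed.

Section Bounds.
Variables (O : OSpRep B) (r : nat).
Hypotheses (n2 : (2%:R : K) != 0 \/ (r <= 1)%N) (rn : (r * 2 <= sdim V true)%N).

Lemma card_ends : #|{: 'I_r + 'I_r}| = (r * 2)%N.
Proof. by rewrite card_sum !card_ord muln2 addnn. Qed.

Lemma brauer_act_inj : injective (brauer_act F (r := r)).
Proof.
apply: raddf_inj => x x0; apply/ffunP => D; rewrite [RHS]ffunE.
apply: (lie_free card_ends (D := fun E : diagram r r => partner E)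
  (f := fun E : diagram r r => hom_tuple B (F _ _ E)) _ n2 rn).
- by move=> E q w wq; apply: bf_eq0 wq.
- exact: partnerK.
- exact: partner_neq.
- by move=> E E'; apply: diagram_eq.
move=> w; transitivity (hom_tuple B (brauer_act F x) w).
  rewrite /hom_tuple sum_lfunE linear_sum; apply: eq_bigr => E _.
  by rewrite scale_lfunE linearZ.
by rewrite [brauer_act F x]x0 /hom_tuple zero_lfunE linear0.
Qed.

Lemma brauer_act_end x : OSp_end O (brauer_act F (r := r) x).
Proof. by apply/OSp_endP/equiv_sum => D; apply: bf_equiv. Qed.

Lemma brauer_act_onto f : OSp_end O f -> exists x, brauer_act F (r := r) x = f.
Proof.
move=> /OSp_endP fE.
have [|c cE] := lie_span (@hom_sign_even r r) card_ends
  (D := fun D : diagram r r => partner D) (f := fun D => hom_tuple B (F _ _ D))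
  (@partnerK r r) (@partner_neq r r) (fun D => hom_tuple_mlin B _) (fun D => bf_tuple_lie O D)
  (fun D q w => @bf_eq0 _ _ _ _ F _ _ D q w) _ n2 rn (hom_tuple_mlin B f)
  (hom_tuple_lie (fun e S eS => equiv_Lop eS fE)).
  move=> a /(pairing_of_rainbow card_ends)[g [ag gn gK]].
  by exists (mk_diagram gn gK) => t; rewrite partner_mk.
exists [ffun D => c D]; apply: hom_tuple_inj => w; rewrite cE.
rewrite /hom_tuple sum_lfunE linear_sum; apply: eq_bigr => D _.
by rewrite scale_lfunE linearZ ffunE.
Qed.

Lemma lop_sign_even k (q : 'I_k -> bool) t : lop_sign false q t = false.
Proof. by []. Qed.

Lemma card_slots : #|'I_(r.*2)| = (r * 2)%N.
Proof. by rewrite card_ord muln2. Qed.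

(** Adds an empty upper half, so that diagrams to no points yield forms and [hom_sign] becomes
    [lop_sign]. The default 0 is never reached. *)
Definition low_tuple k (w : {ffun 'I_k -> V}) : {ffun 'I_k + 'I_0 -> V} :=
  [ffun t => match t with inl s => w s | inr _ => 0 end].

Lemma low_tuple_upd k (w : {ffun 'I_k -> V}) t v :
  low_tuple (upd w t v) = upd (low_tuple w) (inl t) v.
Proof. by apply/ffunP => -[s|[]//]; rewrite !ffunE. Qed.

Definition cap_tuple k (D : diagram k 0) (w : {ffun 'I_k -> V}) : K :=
  hom_tuple B (F _ _ D) (low_tuple w).

Lemma cap_tuple_mlin k (D : diagram k 0) : mlin (cap_tuple D).
Proof.
by move=> w t c u v; rewrite /cap_tuple !low_tuple_upd hom_tuple_mlin.
Qed.

Lemma low_tuple_homog k q (w : {ffun 'I_k -> V}) : homog q w ->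
  homog (fun t => if t is inl s then q s else false) (low_tuple w).
Proof. by move=> wq [s|[]//]; rewrite ffunE. Qed.

Lemma cap_tuple_lie k (D : diagram k 0) :
  lie B (fun e => @lop_sign e k) (cap_tuple D).
Proof.
move=> e S q w eS wq.
have := bf_tuple_lie O D eS (low_tuple_homog wq).
rewrite big_sumType /= big_ord0 addr0 => E; rewrite -[RHS]E.
by apply: eq_bigr => t _; rewrite /cap_tuple low_tuple_upd ffunE.
Qed.

Definition low_partner k (D : diagram k 0) (t : 'I_k) : 'I_k :=
  if partner D (inl t) is inl s then s else t.

Lemma low_partnerE k (D : diagram k 0) t : partner D (inl t) = inl (low_partner D t).
Proof. by rewrite /low_partner; case: (partner D (inl t)) => // -[]. Qed.

Lemma low_partnerK k (D : diagram k 0) : involutive (low_partner D).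
Proof.
move=> t; have := partnerK D (inl t); rewrite !low_partnerE.
by case.
Qed.

Lemma low_partner_neq k (D : diagram k 0) t : low_partner D t != t.
Proof. by have := partner_neq D (inl t); rewrite low_partnerE. Qed.

Lemma cap_tuple_eq0 k (D : diagram k 0) q w : homog q w -> (cap_tuple D w == 0)
  = [exists t, B (w t) (w (low_partner D t)) == 0].
Proof.
move=> wq; rewrite /cap_tuple (bf_eq0 F D (low_tuple_homog wq)).
apply/existsP/existsP => [[[t|[]//]]|[t tE]].
  by rewrite low_partnerE !ffunE => tE; exists t.
by exists (inl t); rewrite low_partnerE !ffunE.
Qed.

Lemma cap_tuple_surj (a : {ffun 'I_(r.*2) -> 'I_r * bool}) : injective a ->
  exists D : diagram r.*2 0, forall t, a (low_partner D t) = flip (a t).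
Proof.
move=> /(pairing_of_rainbow card_slots)[g [ag gn gK]].
pose f (t : ('I_(r.*2) + 'I_0)%type) : ('I_(r.*2) + 'I_0)%type :=
  match t with inl s => inl (g s) | inr s => inr s end.
have fn t : f t != t by case: t => [t|[]//]; apply: gn.
have fK : involutive f by case=> [t|[]//]; rewrite /= gK.
by exists (mk_diagram fn fK) => t; rewrite /low_partner partner_mk /= ag.
Qed.

Lemma cap_tuple_tbasis k (D : diagram k 0) (a : word V 0) (b : word V k) :
  cap_tuple D [ffun s => hbasis (b s)] = coef (F _ _ D) a b.
Proof.
rewrite /cap_tuple (hom_tupleE _ _ (u := fun=> 0) (v := fun s => hbasis (b s))).
- by rewrite (pairt0 _ _ _ a) tens_hbasis.
- by case.
by move=> s; rewrite !ffunE.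
Qed.

(** The permuted form is killed by osp(V), so it is a combination of forms of diagrams to no points,
    and these are invariant under the super group. *)
Lemma perm_form_OSp (s : 'S_(r.*2)) : OSp_form O (perm_form B s).
Proof.
have [c cE] := lie_span (fun q t => @lop_sign_even _ q t) card_slots (@low_partnerK _)
  (@low_partner_neq _) (@cap_tuple_mlin _) (@cap_tuple_lie _)
  (fun D q w => @cap_tuple_eq0 _ D q w) cap_tuple_surj n2 rn
  (form_tuple_mlin (perm_form B s))
  (form_tuple_lie (fun e S eS x => perm_form_Lop F O s x eS)).
have a : word V 0 := ffun0 (card_ord 0).
have fE b : perm_form B s (tbasis b) = \sum_D c D * coef (F _ _ D) a b.
  have := cE [ffun s => hbasis (b s)]; rewrite /form_tuple.
  rewrite (eq_tens (w' := fun s => hbasis (b s))) ?tens_hbasis => [->|t]; last by rewrite ffunE.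
  by apply: eq_bigr => D _; rewrite (cap_tuple_tbasis _ a).
apply/OSp_formP => d; rewrite fE; under eq_bigr do rewrite fE scaler_suml.
rewrite exchange_big scaler_suml; apply: eq_bigr => D _ /=.
under eq_bigr do rewrite -scalerA.
by rewrite -scaler_sumr (bf_equiv F O D) (sum_word0 _ a) cmat0 scalerA.
Qed.

Lemma OSp_form_sum (J : finType) (c : J -> K) (f : J -> 'Hom(tpow V r.*2, K^o)) :
  (forall j, OSp_form O (f j)) -> OSp_form O (\sum_j c j *: f j).
Proof.
move=> fO x; rewrite sum_lfunE scaler_suml.
under eq_bigr do rewrite sum_lfunE scaler_suml.
rewrite exchange_big; apply: eq_bigr => j _ /=.
rewrite scale_lfunE -scalerA -fO scaler_sumr; apply: eq_bigr => b _.
by rewrite scale_lfunE -scalerA.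
Qed.

Lemma form_tuple_inj k (f g : 'Hom(tpow V k, K^o)) :
  form_tuple f =1 form_tuple g -> f = g.
Proof.
move=> fg; apply/lfunP => x; rewrite !form_tpowE; apply: eq_bigr => b _.
have := fg [ffun s => hbasis (b s)]; rewrite /form_tuple.
by rewrite (eq_tens (w' := fun s => hbasis (b s))) ?tens_hbasis => [->|s];
  rewrite ?ffunE.
Qed.

Lemma OSp_form_orbit f : OSp_form O f <-> f \in <<form_orbit B r>>%VS.
Proof.
split=> [fO|].
  have [c cE] := lie_span (fun q t => @lop_sign_even _ q t) card_slots (@perm_mateK _)
    (@perm_mate_neq _) (fun s => form_tuple_mlin (perm_form B s))
    (fun s => form_tuple_lie (fun e S eS x => perm_form_Lop F O s x eS))
    (fun s q w => @perm_form_eq0 _ _ B _ s q w) (@perm_form_surj r) n2 rn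
    (form_tuple_mlin f) (form_tuple_lie (fun e S eS => form_Lop eS fO)).
  have -> : f = \sum_s c s *: perm_form B s.
    apply: form_tuple_inj => w; rewrite cE /form_tuple sum_lfunE.
    by apply: eq_bigr => s _; rewrite scale_lfunE.
  apply: rpred_sum => s _; apply/rpredZ/memv_span.
  by apply/imageP; exists s.
move=> /(coord_span (X := in_tuple (form_orbit B r))) ->.
apply: OSp_form_sum => i.
have /imageP[s _ ->] : (form_orbit B r)`_i \in form_orbit B r by rewrite mem_nth.
exact: perm_form_OSp.
Qed.

End Bounds.
End Main.

Theorem theorem6p1p2 (K : closedFieldType) (p r m n : nat)
    (V : superVect K) (B : evenForm V) (O : OSpRep B)
    (delta : K) (F : brauerFunctor B delta) :
  (p = 0%N /\ [pchar K] =i pred0) \/ p \in [pchar K] ->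
  ~~ (2 <= p <= r)%N ->
  sdim V false = m -> sdim V true = (2 * n)%N ->
  (r <= minn m n)%N ->
  delta = m%:R - (2 * n)%:R ->
  [/\ linear (brauer_act (r := r) F),
      brauer_act F (bone K r) = \1%VF,
      forall x y : brauer K r, brauer_act F (bmul delta x y)
        = (brauer_act F x \o brauer_act F y)%VF,
      injective (brauer_act (r := r) F)
    & forall f : 'Hom(tpow V r, tpow V r),
        OSp_end O f <-> exists x : brauer K r, brauer_act F x = f]
  /\
  forall f : 'Hom(tpow V r.*2, K^o),
    OSp_form O f <-> f \in <<form_orbit B r>>%VS.
Proof.
move=> pK pr _ sn rmn _.
(* If 2 = 0 then p = 2, and as p is not among 2, ..., r this forces r <= 1. *)
have n2 : (2%:R : K) != 0 \/ (r <= 1)%N.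
  have [c2|] := eqVneq (2%:R : K) 0; [right | by left].
  have p2 : 2%N \in [pchar K] by rewrite !inE /= c2 eqxx.
  case: pK => [[_ /(_ 2%N)]|pK]; first by rewrite p2.
  move: p2; rewrite (pcharf_eq pK) inE => /eqP p2.
  by move: pr; rewrite -p2 /= -ltnNge ltnS.
have rn : (r * 2 <= sdim V true)%N.
  by rewrite sn mulnC leq_mul2l /=; move: rmn; rewrite leq_min => /andP[].
split; last by move=> f; have := OSp_form_orbit F O n2 rn f.
split.
- exact: brauer_act_linear.
- by rewrite brauer_act_bdiag bf_id.
- exact: brauer_act_mul.
- exact: brauer_act_inj.
move=> f; split; first exact: brauer_act_onto.
by case=> x <-; apply: brauer_act_end.
Qed.
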